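(* Let $\omega$ be a nonzero real number and $\lambda\in\mathbb{C}$ with $\mathrm{Re}\,\lambda\neq0$. Consider the holomorphic system $$\dot x=i\omega x+f,\quad \dot y=i\omega y+g,\quad \dot z=\lambda z+h,$$ where $f,g,h$ are holomorphic near $0\in\mathbb{C}^3$ and vanish to order at least $2$. Then the system has a unique $(x,y)$-invariant holomorphic center manifold at the origin, and it contains an isochronous center family of period $2\pi/|\omega|$.
   Context: An $(x,y)$-invariant holomorphic center manifold at the origin is a germ at $0$ of a two-dimensional complex submanifold of $\mathbb{C}^3$ through $0$ that is invariant under the system and tangent at $0$ to the $(x,y)$-plane. Such a manifold $S$ contains an isochronous center family of period $T$ if every real-time trajectory of the system starting at a point of $S\setminus\{0\}$ sufficiently close to $0$ is periodic of period $T$. *)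

(* Defs.v *)
From Stdlib Require Import Reals.
Open Scope R_scope.

Definition Cpx := (R * R)%type.
Definition C0 : Cpx := (0, 0).
Definition Cadd (z w : Cpx) : Cpx := (fst z + fst w, snd z + snd w).
Definition Copp (z : Cpx) : Cpx := (- fst z, - snd z).
Definition Csub (z w : Cpx) : Cpx := Cadd z (Copp w).
Definition Cmul (z w : Cpx) : Cpx :=
  (fst z * fst w - snd z * snd w, fst z * snd w + snd z * fst w).
Definition Cnorm (z : Cpx) : R := sqrt (fst z * fst z + snd z * snd z).
Definition Cimag (w : R) : Cpx := (0, w).

Definition C3 := (Cpx * Cpx * Cpx)%type.
Definition c3x (p : C3) : Cpx := fst (fst p).
Definition c3y (p : C3) : Cpx := snd (fst p).
Definition c3z (p : C3) : Cpx := snd p.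
Definition C3zero : C3 := (C0, C0, C0).
Definition C3add (p q : C3) : C3 :=
  (Cadd (c3x p) (c3x q), Cadd (c3y p) (c3y q), Cadd (c3z p) (c3z q)).
Definition C3norm (p : C3) : R :=
  Rmax (Cnorm (c3x p)) (Rmax (Cnorm (c3y p)) (Cnorm (c3z p))).

Definition Clin3 (a b c : Cpx) (v : C3) : Cpx :=
  Cadd (Cmul a (c3x v)) (Cadd (Cmul b (c3y v)) (Cmul c (c3z v))).

Definition has_cderiv3 (F : C3 -> Cpx) (p : C3) (a b c : Cpx) : Prop :=
  forall eps, 0 < eps -> exists delta, 0 < delta /\
    forall h : C3, C3norm h < delta ->
      Cnorm (Csub (Csub (F (C3add p h)) (F p)) (Clin3 a b c h))
        <= eps * C3norm h.

Definition holomorphic_on_ball (F : C3 -> Cpx) (r : R) : Prop :=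
  forall p, C3norm p < r -> exists a b c, has_cderiv3 F p a b c.

Definition holomorphic_near0 (F : C3 -> Cpx) : Prop :=
  exists r, 0 < r /\ holomorphic_on_ball F r.

Definition vanishes_order2 (F : C3 -> Cpx) : Prop :=
  F C3zero = C0 /\ has_cderiv3 F C3zero C0 C0 C0.

Definition system (omega : R) (lambda : Cpx) (f g h : C3 -> Cpx) (p : C3) : C3 :=
  (Cadd (Cmul (Cimag omega) (c3x p)) (f p),
   Cadd (Cmul (Cimag omega) (c3y p)) (g p),
   Cadd (Cmul lambda (c3z p)) (h p)).

(** S is (near 0) a two-dimensional complex submanifold through 0, given as
    the zero set of a holomorphic F with F(0) = 0 and dF(0) = (0, 0, c),
    c <> 0 (so S is smooth at 0 with tangent plane the (x,y)-plane), and S is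
    invariant: the vector field X is tangent to S, i.e. dF(p).X(p) = 0 at
    every point p of S near 0. *)
Definition xy_center_manifold (X : C3 -> C3) (S : C3 -> Prop) : Prop :=
  exists (r : R) (F : C3 -> Cpx),
    0 < r /\ holomorphic_on_ball F r /\ F C3zero = C0 /\
    (exists c, c <> C0 /\ has_cderiv3 F C3zero C0 C0 c) /\
    (forall p, C3norm p < r -> (S p <-> F p = C0)) /\
    (forall p a b c, C3norm p < r -> F p = C0 -> has_cderiv3 F p a b c ->
       Clin3 a b c (X p) = C0).

Definition germ_eq (S1 S2 : C3 -> Prop) : Prop :=
  exists r, 0 < r /\ forall p, C3norm p < r -> (S1 p <-> S2 p).

Definition has_velocity (gamma : R -> C3) (t : R) (v : C3) : Prop :=
  derivable_pt_lim (fun s => fst (c3x (gamma s))) t (fst (c3x v)) /\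
  derivable_pt_lim (fun s => snd (c3x (gamma s))) t (snd (c3x v)) /\
  derivable_pt_lim (fun s => fst (c3y (gamma s))) t (fst (c3y v)) /\
  derivable_pt_lim (fun s => snd (c3y (gamma s))) t (snd (c3y v)) /\
  derivable_pt_lim (fun s => fst (c3z (gamma s))) t (fst (c3z v)) /\
  derivable_pt_lim (fun s => snd (c3z (gamma s))) t (snd (c3z v)).

Definition solves_on (X : C3 -> C3) (gamma : R -> C3) (a b : R) : Prop :=
  forall t, a < t < b -> has_velocity gamma t (X (gamma t)).

Definition solves_global (X : C3 -> C3) (gamma : R -> C3) : Prop :=
  forall t, has_velocity gamma t (X (gamma t)).

Definition least_period (gamma : R -> C3) (T : R) : Prop :=
  0 < T /\ (forall t, gamma (t + T) = gamma t) /\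
  (forall tau, 0 < tau < T -> exists t, gamma (t + tau) <> gamma t).

(** S contains an isochronous center family of period T: every real-time
    trajectory starting at a point of S \ {0} close enough to 0 is periodic
    of period T (it exists for all times, and every local solution through
    the point is the restriction of such a periodic solution). *)
Definition isochronous_center (X : C3 -> C3) (S : C3 -> Prop) (T : R) : Prop :=
  exists delta, 0 < delta /\
    forall p, S p -> p <> C3zero -> C3norm p < delta ->
      (exists gamma, gamma 0 = p /\ solves_global X gamma /\
                     least_period gamma T) /\
      (forall (eta : R -> C3) (a b : R), a < 0 < b -> eta 0 = p ->
         solves_on X eta a b ->
         exists gamma, solves_global X gamma /\ least_period gamma T /\
           forall t, a < t < b -> eta t = gamma t).

(* Main.v *)
(** Since [Re lambda <> 0], the eigenvalues [i omega] and [lambda] are linearly independent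
    over the reals, so a complex factor [tau] makes the real parts of [tau i omega] and
    [tau lambda] both equal to -1. For the field [Y = tau X] every eigenvalue [a] then
    contracts at the same rate, and quadratic errors contract twice as fast as linear terms.
    Hence, for a small step [t], the functional equation
    [H (p + t Y p) = (1 + t a) H p] has a holomorphic solution tangent to the
    corresponding coordinate, obtained by iteration; as [t] tends to 0 these solutions
    converge to a holomorphic [H] with [dH Y = a H]. As [dH] is complex linear, the factor
    [tau] cancels, and the three coordinates together conjugate [X] to its linear part. The
    center manifold is [H3 = 0], on which the linear flow is multiplication
    by [exp (i omega t)]. For any other center manifold, written as a graph, the
    restriction of [H3] is a quadratically small solution of [dk Y = a k], hence 0.

    Passing to limits only needs that a bounded pointwise limit of holomorphic functions is
    holomorphic, which follows from the Cauchy estimate for the first derivative. *)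
Require Import Defs.
From Stdlib Require Import Reals Lra Lia IndefiniteDescription ClassicalEpsilon.
From Coquelicot Require Import Coquelicot.
Open Scope R_scope.

(** * Goursat's lemma on rectangles *)

(** In real time the x and y directions are neutral and nothing contracts. With all real parts equal
    to -1, a sum of two or more eigenvalues has real part at most -2, so no resonance obstructs
    linearization. Concretely, [w] is replaced by [w] after an Euler step, divided by [1 + t a]; in
    the size sup |w(p)| / |p|^2 this operator has norm at most [1 - t/2]. A solution with defect [e]
    is therefore bounded by a multiple of [e/t], and every comparison in the proof needs a defect of
    order [t^2]. That order comes from Taylor's inequality, the reason why Cauchy estimates come
    first. Holomorphy is given only as complex differentiability at each point, so these estimates
    start from Goursat's bisection. Euler steps are holomorphic by the chain rule. Genuine solutions
    appear only at the end, as images under the local inverse of [H] of explicit exponentials. Since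
    the period claim also concerns an arbitrary local solution, injectivity of [H] is used to
    identify that solution with the explicit one. *)

Definition rdiff (P : R -> R -> R) (s t p q : R) : Prop :=
  forall eps, 0 < eps -> exists delta, 0 < delta /\
    forall s' t', Rabs (s' - s) < delta -> Rabs (t' - t) < delta ->
      Rabs (P s' t' - P s t - (p * (s' - s) + q * (t' - t)))
        <= eps * (Rabs (s' - s) + Rabs (t' - t)).

Lemma rdiff_near P s t p q :
  rdiff P s t p q ->
  forall eps, 0 < eps -> exists delta, 0 < delta /\
    forall s' t', Rabs (s' - s) < delta -> Rabs (t' - t) < delta ->
      Rabs (P s' t' - P s t) < eps.
Proof.
  intros H eps Heps.
  destruct (H 1 Rlt_0_1) as [d [Hd Hb]].
  set (K := Rabs p + Rabs q + 2).
  assert (HK : 0 < K) by (unfold K; generalize (Rabs_pos p) (Rabs_pos q); lra).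
  assert (HeK : 0 < eps / (2 * K)) by (apply Rdiv_lt_0_compat; lra).
  exists (Rmin d (eps / (2 * K))). split.
  { apply Rmin_case; lra. }
  intros s' t' Hs Ht.
  assert (Hs1 := Rlt_le_trans _ _ _ Hs (Rmin_l _ _)).
  assert (Hs2 := Rlt_le_trans _ _ _ Hs (Rmin_r _ _)).
  assert (Ht1 := Rlt_le_trans _ _ _ Ht (Rmin_l _ _)).
  assert (Ht2 := Rlt_le_trans _ _ _ Ht (Rmin_r _ _)).
  specialize (Hb s' t' Hs1 Ht1).
  set (x := s' - s) in *. set (y := t' - t) in *.
  replace (P s' t' - P s t) with
    ((P s' t' - P s t - (p * x + q * y)) + (p * x + q * y)) by ring.
  assert (E : K * (eps / (2 * K)) = eps / 2) by (field; lra).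
  generalize (Rabs_triang (P s' t' - P s t - (p * x + q * y)) (p * x + q * y)).
  generalize (Rabs_triang (p * x) (q * y)).
  rewrite !Rabs_mult.
  generalize (Rabs_pos p) (Rabs_pos q) (Rabs_pos x) (Rabs_pos y).
  intros.
  assert (Rabs p * Rabs x <= Rabs p * (eps / (2 * K))) by (apply Rmult_le_compat_l; lra).
  assert (Rabs q * Rabs y <= Rabs q * (eps / (2 * K))) by (apply Rmult_le_compat_l; lra).
  unfold K in E at 1. lra.
Qed.

Lemma rdiff_continuous_1 P s t p q :
  rdiff P s t p q -> continuous (fun x => P x t) s.
Proof.
  intros H. apply continuity_pt_filterlim.
  intros eps Heps.
  destruct (rdiff_near _ _ _ _ _ H eps Heps) as [d [Hd Hb]].
  exists d; split; [exact Hd|].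
  intros x [_ Hx]. apply Hb; [exact Hx|].
  rewrite Rminus_eq_0, Rabs_R0; exact Hd.
Qed.

Lemma rdiff_continuous_2 P s t p q :
  rdiff P s t p q -> continuous (fun y => P s y) t.
Proof.
  intros H. apply continuity_pt_filterlim.
  intros eps Heps.
  destruct (rdiff_near _ _ _ _ _ H eps Heps) as [d [Hd Hb]].
  exists d; split; [exact Hd|].
  intros x [_ Hx]. apply Hb; [|exact Hx].
  rewrite Rminus_eq_0, Rabs_R0; exact Hd.
Qed.

Lemma RInt_affine_error (f : R -> R) a b al be e :
  a <= b -> ex_RInt f a b ->
  (forall x, a <= x <= b -> Rabs (f x - (al + be * x)) <= e) ->
  Rabs (RInt f a b - (al * (b - a) + be * (b * b - a * a) / 2)) <= (b - a) * e.
Proof.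
  intros Hab Hf He.
  assert (Ha : is_RInt (fun x => al + be * x) a b
                 (al * (b - a) + be * (b * b - a * a) / 2)).
  { replace (al * (b - a) + be * (b * b - a * a) / 2)
      with (minus (al * b + be * (b * b) / 2) (al * a + be * (a * a) / 2))
      by (unfold minus, plus, opp; simpl; field).
    apply (is_RInt_derive (fun x => al * x + be * (x * x) / 2)).
    - intros x _. auto_derive; [trivial|]. field.
    - intros x _. apply (ex_derive_continuous (fun x => al + be * x)).
      auto_derive; trivial. }
  assert (Hd : is_RInt (fun x => f x - (al + be * x)) a b
     (RInt f a b - (al * (b - a) + be * (b * b - a * a) / 2))).
  { apply (is_RInt_minus (V := R_NormedModule)); [|exact Ha].
    exact (RInt_correct (V := R_CompleteNormedModule) f a b Hf). }
  rewrite <- (is_RInt_unique _ _ _ _ Hd).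
  apply abs_RInt_le_const; [exact Hab| |exact He].
  eexists; exact Hd.
Qed.

(** The integral of the form P ds + Q dt counterclockwise around the rectangle with sides [a, b] and
    [c, d]. *)
Definition bint (P Q : R -> R -> R) (a b c d : R) : R :=
  RInt (fun s => P s c) a b + RInt (fun t => Q b t) c d
  - RInt (fun s => P s d) a b - RInt (fun t => Q a t) c d.

Lemma nested_intervals (A w : nat -> R) :
  (forall n, A n <= A (S n)) -> (forall n, A (S n) + w (S n) <= A n + w n) ->
  (forall n, 0 <= w n) ->
  exists x, forall n, A n <= x <= A n + w n.
Proof.
  intros H1 H2 Hw.
  assert (M1 : forall n k, A n <= A (n + k)%nat).
  { intros n k; induction k as [|k IH]; [rewrite Nat.add_0_r; lra|].
    rewrite Nat.add_succ_r. generalize (H1 (n + k)%nat); lra. }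
  assert (M2 : forall n k, A (n + k)%nat + w (n + k)%nat <= A n + w n).
  { intros n k; induction k as [|k IH]; [rewrite Nat.add_0_r; lra|].
    rewrite Nat.add_succ_r. generalize (H2 (n + k)%nat); lra. }
  assert (UB : forall n m, A m <= A n + w n).
  { intros n m. destruct (Nat.le_ge_cases n m) as [L|L].
    - replace m with (n + (m - n))%nat by lia.
      generalize (M2 n (m - n)%nat) (Hw (n + (m - n))%nat); lra.
    - generalize (M1 m (n - m)%nat) (Hw n).
      replace (m + (n - m))%nat with n by lia. lra. }
  destruct (completeness (fun y => exists n, y = A n)) as [x [Hx1 Hx2]].
  - exists (A O + w O). intros y [n ->]. apply UB.
  - exists (A O). now exists O.
  - exists x. intros n. split.
    + apply Hx1. now exists n.
    + apply Hx2. intros y [m ->]. apply UB.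
Qed.

Section Goursat.
Variables (P Q : R -> R -> R) (B : R).
(** The shared [q] says that the t-derivative of [P] equals the s-derivative of [Q]: the form P ds +
    Q dt is closed at each point, with no continuity of the partial derivatives. The domain is a
    left half-plane because that is where the logarithm of a punctured disc lives. *)
Hypothesis HPQ : forall s t, s < B -> exists p q r,
  rdiff P s t p q /\ rdiff Q s t q r.

Lemma goursat_exP a b c : a < B -> b < B -> ex_RInt (fun s => P s c) a b.
Proof.
  intros Ha Hb. apply (ex_RInt_continuous (V := R_CompleteNormedModule)).
  intros z Hz.
  assert (z < B) by (apply Rle_lt_trans with (1 := proj2 Hz); apply Rmax_case; lra).
  destruct (HPQ z c H) as [p [q [r [H1 _]]]].
  exact (rdiff_continuous_1 _ _ _ _ _ H1).
Qed.

Lemma goursat_exQ b c d : b < B -> ex_RInt (fun t => Q b t) c d.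
Proof.
  intros Hb. apply (ex_RInt_continuous (V := R_CompleteNormedModule)).
  intros z Hz.
  destruct (HPQ b z Hb) as [p [q [r [_ H1]]]].
  exact (rdiff_continuous_2 _ _ _ _ _ H1).
Qed.

Lemma bint_split a m b c n d : a < B -> m < B -> b < B ->
  bint P Q a b c d = bint P Q a m c n + bint P Q m b c n
                     + bint P Q a m n d + bint P Q m b n d.
Proof.
  intros Ha Hm Hb. unfold bint.
  generalize
   (RInt_Chasles (V := R_CompleteNormedModule) (fun s => P s c) a m b
      (goursat_exP a m c Ha Hm) (goursat_exP m b c Hm Hb))
   (RInt_Chasles (V := R_CompleteNormedModule) (fun s => P s d) a m b
      (goursat_exP a m d Ha Hm) (goursat_exP m b d Hm Hb))
   (RInt_Chasles (V := R_CompleteNormedModule) (fun t => Q a t) c n d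
      (goursat_exQ a c n Ha) (goursat_exQ a n d Ha))
   (RInt_Chasles (V := R_CompleteNormedModule) (fun t => Q b t) c n d
      (goursat_exQ b c n Hb) (goursat_exQ b n d Hb)).
  unfold plus; simpl. lra.
Qed.

(** The affine parts of [P] and [Q] at the point have total integral zero around any rectangle,
    thanks to the common coefficient [q]. Only the remainders are left, at most eps/2 times the
    half-perimeter, integrated over a perimeter of twice that length. *)
Lemma bint_local s0 t0 : s0 < B -> forall eps, 0 < eps ->
  exists delta, 0 < delta /\ forall a b c d, b < B ->
    a <= s0 <= b -> c <= t0 <= d -> b - a < delta -> d - c < delta ->
    Rabs (bint P Q a b c d) <= eps * ((b - a) + (d - c)) ^ 2.
Proof.
  intros Hs0 eps Heps.
  destruct (HPQ s0 t0 Hs0) as [p [q [r [HP HQ]]]].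
  destruct (HP (eps / 2) ltac:(lra)) as [d1 [Hd1 HP']].
  destruct (HQ (eps / 2) ltac:(lra)) as [d2 [Hd2 HQ']].
  exists (Rmin d1 d2). split; [apply Rmin_case; lra|].
  intros a b c d HbB Hs Ht Hab Hcd.
  assert (Hl := Rmin_l d1 d2). assert (Hr := Rmin_r d1 d2).
  set (L := (b - a) + (d - c)).
  assert (EP : forall s t, a <= s <= b -> c <= t <= d ->
     Rabs (P s t - P s0 t0 - (p * (s - s0) + q * (t - t0))) <= eps / 2 * L).
  { intros s t h1 h2.
    assert (Rabs (s - s0) <= b - a) by (apply Rabs_le; lra).
    assert (Rabs (t - t0) <= d - c) by (apply Rabs_le; lra).
    eapply Rle_trans; [apply HP'; lra|].
    apply Rmult_le_compat_l; unfold L; lra. }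
  assert (EQ : forall s t, a <= s <= b -> c <= t <= d ->
     Rabs (Q s t - Q s0 t0 - (q * (s - s0) + r * (t - t0))) <= eps / 2 * L).
  { intros s t h1 h2.
    assert (Rabs (s - s0) <= b - a) by (apply Rabs_le; lra).
    assert (Rabs (t - t0) <= d - c) by (apply Rabs_le; lra).
    eapply Rle_trans; [apply HQ'; lra|].
    apply Rmult_le_compat_l; unfold L; lra. }
  assert (IP : forall t, c <= t <= d ->
    Rabs (RInt (fun s => P s t) a b
      - ((P s0 t0 - p * s0 + q * (t - t0)) * (b - a) + p * (b * b - a * a) / 2))
    <= (b - a) * (eps / 2 * L)).
  { intros t h. apply RInt_affine_error; [lra|apply goursat_exP; lra|].
    intros x hx.
    replace (P x t - (P s0 t0 - p * s0 + q * (t - t0) + p * x))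
      with (P x t - P s0 t0 - (p * (x - s0) + q * (t - t0))) by ring.
    now apply EP. }
  assert (IQ : forall s, a <= s <= b ->
    Rabs (RInt (fun t => Q s t) c d
      - ((Q s0 t0 - r * t0 + q * (s - s0)) * (d - c) + r * (d * d - c * c) / 2))
    <= (d - c) * (eps / 2 * L)).
  { intros s h. apply RInt_affine_error; [lra|apply goursat_exQ; lra|].
    intros x hx.
    replace (Q s x - (Q s0 t0 - r * t0 + q * (s - s0) + r * x))
      with (Q s x - Q s0 t0 - (q * (s - s0) + r * (x - t0))) by ring.
    now apply EQ. }
  generalize (IP c ltac:(lra)) (IP d ltac:(lra)) (IQ a ltac:(lra)) (IQ b ltac:(lra)).
  intros I1 I2 I3 I4. apply Rabs_le_between in I1, I2, I3, I4.
  apply Rabs_le. unfold bint.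
  replace (eps * L ^ 2) with
    (2 * ((b - a) * (eps / 2 * L)) + 2 * ((d - c) * (eps / 2 * L)))
    by (unfold L; field).
  set (u1 := RInt (fun s => P s c) a b) in *.
  set (u2 := RInt (fun s => P s d) a b) in *.
  set (u3 := RInt (fun t => Q a t) c d) in *.
  set (u4 := RInt (fun t => Q b t) c d) in *.
  nra.
Qed.

(** Lower left corner (a, c), then width and height; halving a rectangle then acts on the last two
    entries alone. *)
Definition quad : Type := (R * R * R * R)%type.

Definition qint (x : quad) : R :=
  let '(a, c, w, v) := x in bint P Q a (a + w) c (c + v).

Definition qsub (i j : bool) (x : quad) : quad :=
  let '(a, c, w, v) := x in
  (if i then a + w / 2 else a, if j then c + v / 2 else c, w / 2, v / 2).

Definition qpick (x : quad) (i j : bool) : {Rabs (qint x) / 4 <= Rabs (qint (qsub i j x))}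
  + {~ Rabs (qint x) / 4 <= Rabs (qint (qsub i j x))} := Rle_dec _ _.

(** Selects a quarter carrying at least one fourth of the absolute integral. The last quarter needs
    no test: if the other three fail, the triangle inequality forces it. *)
Definition qnext (x : quad) : quad :=
  if qpick x false false then qsub false false x else
  if qpick x true false then qsub true false x else
  if qpick x false true then qsub false true x else qsub true true x.

Lemma qint_split a c w v : 0 <= w -> a + w < B ->
  let x := (a, c, w, v) in
  qint x = qint (qsub false false x) + qint (qsub true false x)
           + qint (qsub false true x) + qint (qsub true true x).
Proof.
  intros Hw HB. simpl.
  rewrite (bint_split a (a + w / 2) (a + w) c (c + v / 2) (c + v)); try lra.
  replace (a + w / 2 + w / 2) with (a + w) by field.
  replace (c + v / 2 + v / 2) with (c + v) by field.
  reflexivity.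
Qed.

Lemma qnext_spec a c w v : 0 <= w -> a + w < B ->
  exists i j, qnext (a, c, w, v) = qsub i j (a, c, w, v) /\
   Rabs (qint (a, c, w, v)) / 4 <= Rabs (qint (qsub i j (a, c, w, v))).
Proof.
  intros Hw HB. generalize (qint_split a c w v Hw HB).
  set (x := (a, c, w, v)). intros E. cbv zeta in E. fold x in E. unfold qnext.
  destruct (qpick x false false) as [h|h1]; [now exists false, false|].
  destruct (qpick x true false) as [h|h2]; [now exists true, false|].
  destruct (qpick x false true) as [h|h3]; [now exists false, true|].
  exists true, true; split; [reflexivity|].
  apply Rnot_le_lt in h1, h2, h3.
  rewrite E in h1, h2, h3 |- *.
  revert h1 h2 h3.
  generalize (qint (qsub false false x)) (qint (qsub true false x))
   (qint (qsub false true x)) (qint (qsub true true x)).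
  intros q1 q2 q3 q4 h1 h2 h3.
  generalize (Rabs_triang (q1 + q2 + q3) q4) (Rabs_triang (q1 + q2) q3)
    (Rabs_triang q1 q2). lra.
Qed.

(** Repeated bisection keeps the integral at least 4^-n times the original one, while the closed
    form at the common point of the nested rectangles makes it at most eps times 4^-n times the
    squared half-perimeter. *)
Theorem goursat_rectangle a b c d : a <= b -> b < B -> c <= d ->
  bint P Q a b c d = 0.
Proof.
  intros Hab Hb Hcd.
  set (X := fun n => Nat.iter n qnext (a, c, b - a, d - c)).
  set (A := fun n => fst (fst (fst (X n)))).
  set (C := fun n => snd (fst (fst (X n)))).
  set (h := fun n : nat => (/ 2) ^ n).
  assert (Hh : forall n, 0 < h n) by (intros n; apply pow_lt; lra).
  assert (HX : forall n, X n = (A n, C n, (b - a) * h n, (d - c) * h n)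
     /\ A n + (b - a) * h n <= b).
  { induction n as [|n [IH IH']].
    - unfold X, A, C, h; simpl. rewrite !Rmult_1_r. split; [reflexivity|lra].
    - assert (W : 0 <= (b - a) * h n) by (apply Rmult_le_pos; [lra|apply Rlt_le, Hh]).
      destruct (qnext_spec (A n) (C n) ((b - a) * h n) ((d - c) * h n) W ltac:(lra))
        as [i [j [E _]]].
      assert (E' : X (S n) = qsub i j (X n)) by (rewrite IH, <- E, <- IH; reflexivity).
      unfold A, C. rewrite E', IH. simpl.
      unfold h in *; simpl. split.
      + f_equal; [f_equal|]; field.
      + destruct i; lra. }
  assert (HS : forall n, exists i j, X (S n) = qsub i j (X n) /\
     Rabs (qint (X n)) / 4 <= Rabs (qint (X (S n)))).
  { intros n. destruct (HX n) as [IH IH'].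
    assert (W : 0 <= (b - a) * h n) by (apply Rmult_le_pos; [lra|apply Rlt_le, Hh]).
    destruct (qnext_spec (A n) (C n) ((b - a) * h n) ((d - c) * h n) W ltac:(lra))
        as [i [j [E F]]].
    rewrite <- IH in E, F.
    exists i, j. change (X (S n)) with (qnext (X n)). now rewrite E. }
  destruct (nested_intervals A (fun n => (b - a) * h n)) as [s0 Hs0].
  { intros n. destruct (HS n) as [i [j [E _]]]. unfold A. rewrite E.
    destruct (HX n) as [-> _]. simpl.
    assert (W : 0 <= (b - a) * h n) by (apply Rmult_le_pos; [lra|apply Rlt_le, Hh]).
    destruct i; lra. }
  { intros n. destruct (HS n) as [i [j [E _]]]. unfold A. rewrite E.
    destruct (HX n) as [-> _]. simpl.
    assert (W : 0 <= (b - a) * h n) by (apply Rmult_le_pos; [lra|apply Rlt_le, Hh]).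
    unfold h in *; simpl. destruct i; lra. }
  { intros n. apply Rmult_le_pos; [lra|apply Rlt_le, Hh]. }
  destruct (nested_intervals C (fun n => (d - c) * h n)) as [t0 Ht0].
  { intros n. destruct (HS n) as [i [j [E _]]]. unfold C. rewrite E.
    destruct (HX n) as [-> _]. simpl.
    assert (W : 0 <= (d - c) * h n) by (apply Rmult_le_pos; [lra|apply Rlt_le, Hh]).
    destruct j; lra. }
  { intros n. destruct (HS n) as [i [j [E _]]]. unfold C. rewrite E.
    destruct (HX n) as [-> _]. simpl.
    assert (W : 0 <= (d - c) * h n) by (apply Rmult_le_pos; [lra|apply Rlt_le, Hh]).
    unfold h in *; simpl. destruct j; lra. }
  { intros n. apply Rmult_le_pos; [lra|apply Rlt_le, Hh]. }
  assert (Hs0B : s0 < B) by (destruct (HX 0%nat); generalize (Hs0 0%nat); lra).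
  set (L := (b - a) + (d - c)).
  (* [h n ^ 2] is 4^-n, the share retained after n choices of a quarter. *)
  assert (Low : forall n, Rabs (bint P Q a b c d) * h n ^ 2 <= Rabs (qint (X n))).
  { induction n as [|n IH].
    - unfold h, X, qint; simpl. replace (a + (b - a)) with b by ring.
      replace (c + (d - c)) with d by ring. lra.
    - destruct (HS n) as [i [j [_ F]]].
      unfold h in *; simpl in *. lra. }
  assert (Up : forall eps, 0 < eps -> Rabs (bint P Q a b c d) <= eps * L ^ 2).
  { intros eps Heps.
    destruct (bint_local s0 t0 Hs0B eps Heps) as [dl [Hdl Hloc]].
    destruct (pow_lt_1_zero (/ 2) ltac:(rewrite Rabs_pos_eq; lra) (dl / (L + 1)))
      as [N HN].
    { apply Rdiv_lt_0_compat; unfold L; lra. }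
    specialize (HN N (Nat.le_refl N)).
    change ((/ 2) ^ N) with (h N) in HN.
    rewrite Rabs_pos_eq in HN by (apply Rlt_le, Hh).
    assert (HN' : h N * (L + 1) < dl).
    { apply (Rmult_lt_compat_r (L + 1)) in HN; [|unfold L; lra].
      replace (dl / (L + 1) * (L + 1)) with dl in HN; [exact HN|].
      field. unfold L; lra. }
    destruct (HX N) as [EX EB].
    generalize (Low N). rewrite EX. unfold qint. intros LN.
    assert (HhN := Hh N).
    assert (Hloc' := Hloc (A N) (A N + (b - a) * h N) (C N) (C N + (d - c) * h N)
      ltac:(lra) (Hs0 N) (Ht0 N)).
    replace (A N + (b - a) * h N - A N) with ((b - a) * h N) in Hloc' by ring.
    replace (C N + (d - c) * h N - C N) with ((d - c) * h N) in Hloc' by ring.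
    assert (G1 : (b - a) * h N < dl) by (unfold L in HN'; nra).
    assert (G2 : (d - c) * h N < dl) by (unfold L in HN'; nra).
    specialize (Hloc' G1 G2).
    replace (eps * ((b - a) * h N + (d - c) * h N) ^ 2)
      with (eps * L ^ 2 * h N ^ 2) in Hloc' by (unfold L; ring).
    apply Rmult_le_reg_r with (h N ^ 2); [apply pow_lt, Hh|lra]. }
  destruct (Req_dec (bint P Q a b c d) 0) as [E|NE]; [exact E|exfalso].
  apply Rabs_pos_lt in NE.
  set (I := Rabs (bint P Q a b c d)) in *.
  assert (HL : 0 <= L ^ 2) by apply pow2_ge_0.
  specialize (Up (I / (2 * (L ^ 2 + 1)))).
  assert (0 < I / (2 * (L ^ 2 + 1))) by (apply Rdiv_lt_0_compat; lra).
  specialize (Up H).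
  replace (I / (2 * (L ^ 2 + 1)) * L ^ 2) with
    (I / 2 - I / (2 * (L ^ 2 + 1))) in Up by (field; lra).
  lra.
Qed.

End Goursat.

(** * Cauchy and Taylor estimates in one variable *)

(** The remainder form of differentiability avoids division, and [h = 0] needs no exception. *)
Definition cder (phi : C -> C) (z l : C) : Prop :=
  forall eps, 0 < eps -> exists delta, 0 < delta /\
    forall h, Cmod h < delta ->
      Cmod (phi (z + h) - phi z - l * h)%C <= eps * Cmod h.

Lemma Cmod_le_sum (z : C) : Cmod z <= Rabs (fst z) + Rabs (snd z).
Proof.
  destruct z as [x y].
  replace ((x, y) : C) with ((x, 0) + (0, y))%C
    by (unfold Cplus; simpl; f_equal; ring).
  eapply Rle_trans; [apply Cmod_triangle|].
  unfold Cmod; simpl.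
  replace (x * (x * 1) + 0 * (0 * 1)) with (Rsqr x) by (unfold Rsqr; ring).
  replace (0 * (0 * 1) + y * (y * 1)) with (Rsqr y) by (unfold Rsqr; ring).
  rewrite !sqrt_Rsqr_abs. rewrite Rplus_0_r, Rplus_0_l. lra.
Qed.

Lemma fst_le_Cmod (z : C) : Rabs (fst z) <= Cmod z.
Proof. eapply Rle_trans; [apply Rmax_l|apply Rmax_Cmod]. Qed.

Lemma snd_le_Cmod (z : C) : Rabs (snd z) <= Cmod z.
Proof. eapply Rle_trans; [apply Rmax_r|apply Rmax_Cmod]. Qed.

Lemma Cmod_sub_le (z w : C) : Cmod (z - w)%C <= Cmod z + Cmod w.
Proof.
  unfold Cminus. eapply Rle_trans; [apply Cmod_triangle|].
  rewrite Cmod_opp. lra.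
Qed.

Lemma cder_bound phi z l : cder phi z l ->
  exists delta, 0 < delta /\ forall h, Cmod h < delta ->
    Cmod (phi (z + h) - phi z)%C <= (Cmod l + 1) * Cmod h.
Proof.
  intros H. destruct (H 1 Rlt_0_1) as [d [Hd Hb]].
  exists d; split; [exact Hd|]. intros h Hh.
  replace (phi (z + h) - phi z)%C
    with ((phi (z + h) - phi z - l * h) + l * h)%C by ring.
  eapply Rle_trans; [apply Cmod_triangle|].
  rewrite Cmod_mult. generalize (Hb h Hh). lra.
Qed.

Lemma cder_comp phi psi z l m :
  cder psi z m -> cder phi (psi z) l -> cder (fun w => phi (psi w)) z (l * m)%C.
Proof.
  intros Hpsi Hphi eps Heps.
  destruct (cder_bound _ _ _ Hpsi) as [d0 [Hd0 Hb0]].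
  set (K := Cmod m + 1). assert (HK : 1 <= K) by (generalize (Cmod_ge_0 m); unfold K; lra).
  set (L := Cmod l + 1). assert (HL : 1 <= L) by (generalize (Cmod_ge_0 l); unfold L; lra).
  destruct (Hphi (eps / (2 * K))) as [d1 [Hd1 Hb1]].
  { apply Rdiv_lt_0_compat; lra. }
  destruct (Hpsi (eps / (2 * L))) as [d2 [Hd2 Hb2]].
  { apply Rdiv_lt_0_compat; lra. }
  assert (Hd1K : 0 < d1 / K) by (apply Rdiv_lt_0_compat; lra).
  exists (Rmin d0 (Rmin (d1 / K) d2)). split.
  { repeat apply Rmin_case; lra. }
  intros h Hh.
  assert (h0 := Rlt_le_trans _ _ _ Hh (Rmin_l _ _)).
  assert (h12 := Rlt_le_trans _ _ _ Hh (Rmin_r _ _)).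
  assert (h1 := Rlt_le_trans _ _ _ h12 (Rmin_l _ _)).
  assert (h2 := Rlt_le_trans _ _ _ h12 (Rmin_r _ _)).
  specialize (Hb0 h h0). specialize (Hb2 h h2).
  set (k := (psi (z + h) - psi z)%C) in *.
  assert (Hk : Cmod k < d1).
  { eapply Rle_lt_trans; [exact Hb0|]. fold K.
    replace d1 with (K * (d1 / K)) by (field; lra).
    apply Rmult_lt_compat_l; lra. }
  specialize (Hb1 k Hk).
  replace (psi z + k)%C with (psi (z + h)%C) in Hb1 by (unfold k; ring).
  replace (phi (psi (z + h)) - phi (psi z) - l * m * h)%C
    with ((phi (psi (z + h)) - phi (psi z) - l * k) + l * (k - m * h))%C by ring.
  eapply Rle_trans; [apply Cmod_triangle|]. rewrite Cmod_mult.
  assert (A1 : eps / (2 * K) * Cmod k <= eps / 2 * Cmod h).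
  { replace (eps / 2 * Cmod h) with (eps / (2 * K) * (K * Cmod h)) by (field; lra).
    apply Rmult_le_compat_l; [|exact Hb0].
    apply Rlt_le, Rdiv_lt_0_compat; lra. }
  assert (A2 : Cmod l * Cmod (k - m * h)%C <= eps / 2 * Cmod h).
  { replace (eps / 2 * Cmod h) with (L * (eps / (2 * L) * Cmod h)) by (field; lra).
    apply Rmult_le_compat; [apply Cmod_ge_0|apply Cmod_ge_0|unfold L; lra|exact Hb2]. }
  lra.
Qed.

Lemma cder_mult phi psi z l m :
  cder phi z l -> cder psi z m ->
  cder (fun w => phi w * psi w)%C z (l * psi z + phi z * m)%C.
Proof.
  intros Hphi Hpsi eps Heps.
  destruct (cder_bound _ _ _ Hphi) as [d0 [Hd0 Hb0]].
  destruct (cder_bound _ _ _ Hpsi) as [d0' [Hd0' Hb0']].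
  set (A := Cmod l + 1) in *. set (D := Cmod m + 1) in *.
  assert (HA : 1 <= A) by (generalize (Cmod_ge_0 l); unfold A; lra).
  assert (HD : 1 <= D) by (generalize (Cmod_ge_0 m); unfold D; lra).
  set (U := Cmod (psi z) + 1).
  assert (HU : 1 <= U) by (generalize (Cmod_ge_0 (psi z)); unfold U; lra).
  set (V := Cmod (phi z) + 1).
  assert (HV : 1 <= V) by (generalize (Cmod_ge_0 (phi z)); unfold V; lra).
  destruct (Hphi (eps / (3 * U))) as [d1 [Hd1 Hb1]].
  { apply Rdiv_lt_0_compat; lra. }
  destruct (Hpsi (eps / (3 * V))) as [d2 [Hd2 Hb2]].
  { apply Rdiv_lt_0_compat; lra. }
  assert (AD : 0 < A * D) by (apply Rmult_lt_0_compat; lra).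
  assert (Hd3 : 0 < eps / (3 * (A * D))) by (apply Rdiv_lt_0_compat; lra).
  exists (Rmin (Rmin d0 d0') (Rmin (Rmin d1 d2) (eps / (3 * (A * D))))). split.
  { repeat apply Rmin_case; lra. }
  intros h Hh.
  assert (ha := Rlt_le_trans _ _ _ Hh (Rmin_l _ _)).
  assert (hb := Rlt_le_trans _ _ _ Hh (Rmin_r _ _)).
  assert (hc := Rlt_le_trans _ _ _ hb (Rmin_l _ _)).
  assert (h3 := Rlt_le_trans _ _ _ hb (Rmin_r _ _)).
  specialize (Hb0 h (Rlt_le_trans _ _ _ ha (Rmin_l _ _))).
  specialize (Hb0' h (Rlt_le_trans _ _ _ ha (Rmin_r _ _))).
  specialize (Hb1 h (Rlt_le_trans _ _ _ hc (Rmin_l _ _))).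
  specialize (Hb2 h (Rlt_le_trans _ _ _ hc (Rmin_r _ _))).
  replace (phi (z + h) * psi (z + h) - phi z * psi z - (l * psi z + phi z * m) * h)%C
    with ((phi (z + h) - phi z - l * h) * psi z
          + (phi z * (psi (z + h) - psi z - m * h)
          + (phi (z + h) - phi z) * (psi (z + h) - psi z)))%C by ring.
  eapply Rle_trans; [apply Cmod_triangle|].
  eapply Rle_trans; [apply Rplus_le_compat_l, Cmod_triangle|].
  rewrite !Cmod_mult.
  assert (Hh0 := Cmod_ge_0 h).
  assert (A1 : Cmod (phi (z + h) - phi z - l * h)%C * Cmod (psi z) <= eps / 3 * Cmod h).
  { replace (eps / 3 * Cmod h) with (eps / (3 * U) * Cmod h * U) by (field; lra).
    apply Rmult_le_compat; [apply Cmod_ge_0|apply Cmod_ge_0|exact Hb1|unfold U; lra]. }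
  assert (A2 : Cmod (phi z) * Cmod (psi (z + h) - psi z - m * h)%C <= eps / 3 * Cmod h).
  { replace (eps / 3 * Cmod h) with (V * (eps / (3 * V) * Cmod h)) by (field; lra).
    apply Rmult_le_compat; [apply Cmod_ge_0|apply Cmod_ge_0|unfold V; lra|exact Hb2]. }
  assert (A3 : Cmod (phi (z + h) - phi z)%C * Cmod (psi (z + h) - psi z)%C
     <= eps / 3 * Cmod h).
  { apply Rle_trans with ((A * Cmod h) * (D * Cmod h)).
    - apply Rmult_le_compat; [apply Cmod_ge_0|apply Cmod_ge_0|exact Hb0|exact Hb0'].
    - replace (eps / 3 * Cmod h) with (A * D * (eps / (3 * (A * D))) * Cmod h)
        by (field; lra).
      replace (A * Cmod h * (D * Cmod h)) with (A * D * Cmod h * Cmod h) by ring.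
      apply Rmult_le_compat_r; [exact Hh0|]. apply Rmult_le_compat_l; lra. }
  lra.
Qed.

Lemma cder_affine (a b z : C) : cder (fun w => a + b * w)%C z b.
Proof.
  intros eps Heps. exists 1; split; [lra|]. intros h _.
  replace (a + b * (z + h) - (a + b * z) - b * h)%C with (RtoC 0) by ring.
  rewrite Cmod_0. apply Rmult_le_pos; [lra|apply Cmod_ge_0].
Qed.

Lemma cder_unique phi z l m : cder phi z l -> cder phi z m -> l = m.
Proof.
  intros Hl Hm.
  destruct (Ceq_dec (l - m)%C 0) as [E|E].
  { replace l with (l - m + m)%C by ring. rewrite E. ring. }
  exfalso. apply Cmod_gt_0 in E.
  destruct (Hl (Cmod (l - m)%C / 3)) as [d1 [Hd1 Hb1]]; [lra|].
  destruct (Hm (Cmod (l - m)%C / 3)) as [d2 [Hd2 Hb2]]; [lra|].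
  set (t := Rmin d1 d2 / 2).
  assert (Ht : 0 < Rmin d1 d2) by (apply Rmin_case; lra).
  assert (Hl1 := Rmin_l d1 d2). assert (Hl2 := Rmin_r d1 d2).
  assert (Et : Cmod (RtoC t) = t) by (rewrite Cmod_R; apply Rabs_pos_eq; unfold t; lra).
  specialize (Hb1 t ltac:(rewrite Et; unfold t; lra)).
  specialize (Hb2 t ltac:(rewrite Et; unfold t; lra)).
  assert (G : Cmod ((l - m) * t)%C <= 2 * (Cmod (l - m)%C / 3) * t).
  { replace ((l - m) * t)%C with
     ((phi (z + t) - phi z - m * t) - (phi (z + t) - phi z - l * t))%C by ring.
    eapply Rle_trans; [apply Cmod_sub_le|]. rewrite Et in Hb1, Hb2. lra. }
  rewrite Cmod_mult, Et in G.
  assert (0 < t) by (unfold t; lra). nra.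
Qed.

(** * The complex exponential and the Cauchy estimate *)

Definition cexp (w : C) : C := (exp (fst w) * cos (snd w), exp (fst w) * sin (snd w)).

Lemma cexp_plus (w h : C) : cexp (w + h)%C = (cexp w * cexp h)%C.
Proof.
  unfold cexp, Cmult, Cplus; simpl.
  rewrite exp_plus, cos_plus, sin_plus. f_equal; ring.
Qed.

Lemma cexp_0 : cexp 0 = RtoC 1.
Proof. unfold cexp, RtoC; simpl. rewrite exp_0, cos_0, sin_0. f_equal; ring. Qed.

Lemma Cmod_cexp (w : C) : Cmod (cexp w) = exp (fst w).
Proof.
  unfold Cmod, cexp; simpl.
  replace (exp (fst w) * cos (snd w) * (exp (fst w) * cos (snd w) * 1) +
    exp (fst w) * sin (snd w) * (exp (fst w) * sin (snd w) * 1))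
   with ((exp (fst w))² * ((sin (snd w))² + (cos (snd w))²)) by (unfold Rsqr; ring).
  rewrite sin2_cos2, Rmult_1_r. apply sqrt_Rsqr, Rlt_le, exp_pos.
Qed.

Lemma cexp_opp (w : C) : (cexp (- w) * cexp w)%C = RtoC 1.
Proof.
  rewrite <- cexp_plus. replace (- w + w)%C with (RtoC 0) by ring. apply cexp_0.
Qed.

Lemma derivable_pt_lim_linear_error (f : R -> R) x l :
  derivable_pt_lim f x l ->
  forall eps, 0 < eps -> exists delta, 0 < delta /\
    forall h, Rabs h < delta -> Rabs (f (x + h) - f x - l * h) <= eps * Rabs h.
Proof.
  intros H eps Heps. destruct (H eps Heps) as [d Hd].
  exists d; split; [apply cond_pos|]. intros h Hh.
  destruct (Req_dec h 0) as [->|Nh].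
  { rewrite Rplus_0_r, Rabs_R0.
    replace (f x - f x - l * 0) with 0 by ring. rewrite Rabs_R0. lra. }
  specialize (Hd h Nh Hh).
  replace (f (x + h) - f x - l * h) with (((f (x + h) - f x) / h - l) * h) by (field; auto).
  rewrite Rabs_mult. apply Rmult_le_compat_r; [apply Rabs_pos|lra].
Qed.

Lemma cder_cexp (z : C) : cder cexp z (cexp z).
Proof.
  intros eps Heps.
  (* By the addition formula only the increment at 0 matters. Its real and imaginary errors come out
     as at most 3 and 5 times [e |h|], so the factor 10 leaves room; [e <= 1] keeps [exp x] below
     3. *)
  set (e := Rmin 1 (eps / 10 / exp (fst z))).
  assert (Hez := exp_pos (fst z)).
  assert (He1 : e <= 1) by apply Rmin_l.
  assert (He2 : exp (fst z) * (10 * e) <= eps).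
  { apply Rle_trans with (exp (fst z) * (10 * (eps / 10 / exp (fst z)))).
    - apply Rmult_le_compat_l; [lra|]. apply Rmult_le_compat_l; [lra|apply Rmin_r].
    - right; field; lra. }
  assert (He : 0 < e).
  { apply Rmin_case; [lra|]. apply Rdiv_lt_0_compat; lra. }
  clearbody e.
  destruct (derivable_pt_lim_linear_error _ _ _ derivable_pt_lim_exp_0 e He) as [d1 [Hd1 H1]].
  destruct (derivable_pt_lim_linear_error _ _ _ derivable_pt_lim_sin_0 e He) as [d2 [Hd2 H2]].
  destruct (derivable_pt_lim_linear_error _ _ _ derivable_pt_lim_cos_0 e He) as [d3 [Hd3 H3]].
  exists (Rmin (Rmin d1 d2) (Rmin d3 e)). split; [repeat apply Rmin_case; lra|].
  intros h Hh.
  assert (ha := Rlt_le_trans _ _ _ Hh (Rmin_l _ _)).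
  assert (hb := Rlt_le_trans _ _ _ Hh (Rmin_r _ _)).
  assert (h1 := Rlt_le_trans _ _ _ ha (Rmin_l _ _)).
  assert (h2 := Rlt_le_trans _ _ _ ha (Rmin_r _ _)).
  assert (h3 := Rlt_le_trans _ _ _ hb (Rmin_l _ _)).
  assert (h4 := Rlt_le_trans _ _ _ hb (Rmin_r _ _)).
  rewrite cexp_plus.
  replace (cexp z * cexp h - cexp z - cexp z * h)%C
    with (cexp z * (cexp h - 1 - h))%C by ring.
  rewrite Cmod_mult, Cmod_cexp.
  apply Rle_trans with (exp (fst z) * (10 * e * Cmod h)).
  2: { rewrite <- Rmult_assoc. apply Rmult_le_compat_r; [apply Cmod_ge_0|exact He2]. }
  apply Rmult_le_compat_l; [lra|].
  destruct h as [x y]. set (N := Cmod (x, y)) in *.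
  assert (Hx : Rabs x <= N) by apply (fst_le_Cmod (x, y)).
  assert (Hy : Rabs y <= N) by apply (snd_le_Cmod (x, y)).
  specialize (H1 x ltac:(lra)). specialize (H2 y ltac:(lra)). specialize (H3 y ltac:(lra)).
  rewrite Rplus_0_l in H1, H2, H3. rewrite exp_0 in H1. rewrite sin_0 in H2.
  rewrite cos_0 in H3.
  eapply Rle_trans; [apply Cmod_le_sum|].
  unfold cexp, Cminus, Cplus, Copp, RtoC; simpl.
  assert (Hc : Rabs (cos y) <= 1) by (apply Rabs_le; generalize (COS_bound y); lra).
  assert (Px := Rabs_pos x). assert (Py := Rabs_pos y).
  assert (T1 : Rabs (exp x * cos y + - (1) + - x) <= e * N + 2 * (e * N)).
  { replace (exp x * cos y + - (1) + - x)
     with ((exp x - 1 - 1 * x) * cos y + (1 + x) * (cos y - 1 - 0 * y)) by ring.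
    eapply Rle_trans; [apply Rabs_triang|]. rewrite !Rabs_mult.
    apply Rplus_le_compat.
    - rewrite <- (Rmult_1_r (e * N)).
      apply Rmult_le_compat; try apply Rabs_pos; try lra.
      eapply Rle_trans; [exact H1|apply Rmult_le_compat_l; lra].
    - apply Rmult_le_compat; try apply Rabs_pos.
      + generalize (Rabs_triang 1 x). rewrite Rabs_R1. lra.
      + eapply Rle_trans; [exact H3|apply Rmult_le_compat_l; lra]. }
  assert (X1 : Rabs (exp x - 1) <= 2 * e).
  { replace (exp x - 1) with ((exp x - 1 - 1 * x) + x) by ring.
    eapply Rle_trans; [apply Rabs_triang|]. nra. }
  assert (X2 : Rabs (exp x) <= 3).
  { replace (exp x) with ((exp x - 1) + 1) by ring.
    eapply Rle_trans; [apply Rabs_triang|]. rewrite Rabs_R1. lra. }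
  assert (T2 : Rabs (exp x * sin y + - 0 + - y) <= 3 * (e * N) + 2 * e * N).
  { replace (exp x * sin y + - 0 + - y)
     with (exp x * (sin y - 0 - 1 * y) + (exp x - 1) * y) by ring.
    eapply Rle_trans; [apply Rabs_triang|]. rewrite !Rabs_mult.
    apply Rplus_le_compat.
    - apply Rmult_le_compat; try apply Rabs_pos; try lra.
      eapply Rle_trans; [exact H2|apply Rmult_le_compat_l; lra].
    - apply Rmult_le_compat; try apply Rabs_pos; lra. }
  assert (0 <= e * N) by (apply Rmult_le_pos; lra).
  lra.
Qed.

(** These are the Cauchy-Riemann equations for the real and imaginary parts of [K]. *)
Lemma cder_rdiff K s t l : cder K (s, t) l ->
  rdiff (fun s t => fst (K (s, t))) s t (fst l) (- snd l) /\
  rdiff (fun s t => snd (K (s, t))) s t (snd l) (fst l).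
Proof.
  intros H.
  assert (G : forall eps, 0 < eps -> exists delta, 0 < delta /\
    forall s' t', Rabs (s' - s) < delta -> Rabs (t' - t) < delta ->
      Cmod (K (s', t') - K (s, t) - l * ((s' - s)%R, (t' - t)%R))%C
        <= eps * (Rabs (s' - s) + Rabs (t' - t))).
  { intros eps Heps. destruct (H eps Heps) as [d [Hd Hb]].
    exists (d / 2); split; [lra|]. intros s' t' Hs Ht.
    assert (Hle := Cmod_le_sum (s' - s, t' - t)). simpl in Hle.
    specialize (Hb (s' - s, t' - t) ltac:(lra)).
    replace ((s, t) + ((s' - s)%R, (t' - t)%R))%C with ((s', t') : C) in Hb
      by (unfold Cplus; simpl; f_equal; ring).
    eapply Rle_trans; [exact Hb|]. apply Rmult_le_compat_l; lra. }
  split; intros eps Heps; destruct (G eps Heps) as [d [Hd Hb]];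
    exists d; (split; [exact Hd|]); intros s' t' Hs Ht; specialize (Hb s' t' Hs Ht).
  - eapply Rle_trans; [|exact Hb]. eapply Rle_trans; [|apply fst_le_Cmod].
    right; f_equal. unfold Cminus, Cplus, Copp, Cmult; simpl. ring.
  - eapply Rle_trans; [|exact Hb]. eapply Rle_trans; [|apply snd_le_Cmod].
    right; f_equal. unfold Cminus, Cplus, Copp, Cmult; simpl. ring.
Qed.

Definition is_disc_hol (phi : C -> C) (R M : R) : Prop :=
  forall z, Cmod z < R -> Cmod (phi z) <= M /\ exists l, cder phi z l.

(* In logarithmic coordinates w = log zeta the integral of (phi - phi 0) / zeta over
   a circle is the integral of K over a vertical segment of length 2 pi; by Goursat
   it does not depend on the radius, and it tends to 2 pi phi'(0) at radius 0. *)
Lemma cauchy_estimate_re phi R M l :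
  0 < R -> is_disc_hol phi R M -> cder phi 0 l -> Rabs (fst l) <= 4 * M / R.
Proof.
  intros HR Hol Hl.
  set (K := fun w : C => ((phi (cexp w) - phi 0) * cexp (- w))%C).
  set (B := ln R).
  assert (HB : exp B = R) by (apply exp_ln; exact HR).
  assert (HK : forall w : C, fst w < B -> exists m, cder K w m).
  { intros w Hw.
    assert (Hc : Cmod (cexp w) < R).
    { rewrite Cmod_cexp, <- HB. now apply exp_increasing. }
    destruct (proj2 (Hol _ Hc)) as [m Hm].
    eexists. apply cder_mult.
    - apply (cder_comp (fun z => phi z - phi 0)%C cexp w).
      + apply cder_cexp.
      + intros eps Heps. destruct (Hm eps Heps) as [d [Hd Hb]].
        exists d; split; [exact Hd|]. intros h Hh.
        replace (phi (cexp w + h) - phi 0 - (phi (cexp w) - phi 0) - m * h)%C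
         with (phi (cexp w + h) - phi (cexp w) - m * h)%C by ring.
        now apply Hb.
    - apply (cder_comp cexp (fun w => - w)%C w).
      + intros eps Heps.
        destruct (cder_affine 0 (-(1)) w eps Heps) as [d [Hd Hb]].
        exists d; split; [exact Hd|]. intros h Hh.
        replace (- (w + h) - - w - - (1) * h)%C
         with (0 + - (1) * (w + h) - (0 + - (1) * w) - - (1) * h)%C by ring.
        now apply Hb.
      + apply cder_cexp. }
  assert (Hper : forall s, K (s, 2 * PI) = K (s, 0)).
  { intros s. unfold K.
    replace (cexp (s, 2 * PI)) with (cexp (s, 0)).
    2: { unfold cexp; simpl. now rewrite cos_2PI, sin_2PI, cos_0, sin_0. }
    replace (cexp (- (s, (2 * PI)%R))) with (cexp (- (s, 0))); [reflexivity|].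
    unfold cexp; simpl.
    now rewrite !cos_neg, !sin_neg, cos_2PI, sin_2PI, cos_0, sin_0. }
  set (u := fun s t => fst (K (s, t))). set (v := fun s t => snd (K (s, t))).
  (* For K = u + i v, the imaginary part of K dw is v ds + u dt. Cauchy-Riemann makes it closed,
     with shared coefficient the real part of the derivative; on vertical segments it reduces to u
     dt. The horizontal sides cancel by periodicity. *)
  assert (HPQ : forall s t, s < B -> exists p q r, rdiff v s t p q /\ rdiff u s t q r).
  { intros s t Hs. destruct (HK (s, t) Hs) as [m Hm].
    apply cder_rdiff in Hm. destruct Hm as [H1 H2].
    exists (snd m), (fst m), (- snd m). split; assumption. }
  assert (P2 : 0 < 2 * PI) by (generalize PI_RGT_0; lra).
  set (b := ln (R / 2)).
  assert (Hb : exp b = R / 2) by (apply exp_ln; lra).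
  assert (HbB : b < B) by (apply ln_increasing; lra).
  assert (Hconst : forall a, a <= b ->
     RInt (fun t => u b t) 0 (2 * PI) = RInt (fun t => u a t) 0 (2 * PI)).
  { intros a Ha.
    assert (G := goursat_rectangle v u B HPQ a b 0 (2 * PI) Ha HbB (Rlt_le _ _ P2)).
    unfold bint in G.
    assert (E : RInt (fun s => v s (2 * PI)) a b = RInt (fun s => v s 0) a b).
    { apply RInt_ext. intros x _. unfold v. now rewrite Hper. }
    rewrite E in G. lra. }
  assert (HexQ : forall a, a <= b -> ex_RInt (fun t => u a t) 0 (2 * PI)).
  { intros a Ha. apply (goursat_exQ v u B HPQ). lra. }
  (* On the circle of radius R/2, the difference phi - phi(0) is at most 2M and is divided by
     R/2. *)
  assert (HM : forall t, Rabs (u b t) <= 4 * M / R).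
  { intros t. unfold u. eapply Rle_trans; [apply fst_le_Cmod|]. unfold K.
    rewrite Cmod_mult, !Cmod_cexp. simpl. rewrite exp_Ropp, Hb.
    assert (M1 : Cmod (phi (cexp (b, t))) <= M).
    { apply Hol. rewrite Cmod_cexp; simpl. lra. }
    assert (M2 : Cmod (phi 0) <= M) by (apply Hol; rewrite Cmod_0; lra).
    replace (4 * M / R) with ((2 * M) * / (R / 2)) by (field; lra).
    apply Rmult_le_compat_r; [apply Rlt_le, Rinv_0_lt_compat; lra|].
    eapply Rle_trans; [apply Cmod_sub_le|]. lra. }
  apply Rnot_lt_le. intros Hlt.
  set (eps := (Rabs (fst l) - 4 * M / R) / 2).
  assert (Heps : 0 < eps) by (unfold eps; lra).
  destruct (Hl eps Heps) as [d [Hd Hdl]].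
  (* The inner radius is at most d/2, inside the range where the difference quotient is within [eps]
     of [l]. *)
  set (a := Rmin b (ln (d / 2))).
  assert (Hab : a <= b) by apply Rmin_l.
  assert (Had : exp a < d).
  { apply Rle_lt_trans with (exp (ln (d / 2))).
    - assert (Hr : a <= ln (d / 2)) by apply Rmin_r.
      destruct Hr as [Hr|Hr]; [left; now apply exp_increasing|right; now rewrite Hr].
    - rewrite exp_ln; lra. }
  assert (Hua : forall t, Rabs (u a t - fst l) <= eps).
  { intros t. unfold u.
    replace (fst (K (a, t)) - fst l) with (fst (K (a, t) - l)%C)
      by (unfold Cminus, Cplus, Copp; simpl; ring).
    eapply Rle_trans; [apply fst_le_Cmod|].
    set (w := (a, t) : C).
    specialize (Hdl (cexp w)). rewrite Cmod_cexp in Hdl. specialize (Hdl Had).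
    rewrite Cplus_0_l in Hdl.
    replace (K w - l)%C with ((phi (cexp w) - phi 0 - l * cexp w) * cexp (- w))%C.
    2: { unfold K. transitivity ((phi (cexp w) - phi 0) * cexp (- w)
           - l * (cexp (- w) * cexp w))%C; [ring|]. rewrite cexp_opp. ring. }
    rewrite Cmod_mult, Cmod_cexp.
    change (fst (- w)%C) with (- a). rewrite exp_Ropp.
    change (fst w) with a in Hdl.
    assert (Ea := exp_pos a).
    replace eps with (eps * exp a * / exp a) by (field; lra).
    apply Rmult_le_compat_r; [apply Rlt_le, Rinv_0_lt_compat; lra|exact Hdl]. }
  assert (I1 : Rabs (RInt (fun t => u b t) 0 (2 * PI)) <= (2 * PI - 0) * (4 * M / R)).
  { apply abs_RInt_le_const; [lra|now apply HexQ, Rle_refl|]. intros t _. apply HM. }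
  assert (I2 := RInt_affine_error (fun t => u a t) 0 (2 * PI) (fst l) 0 eps
    (Rlt_le _ _ P2) (HexQ a Hab)
    ltac:(intros x _; rewrite Rmult_0_l, Rplus_0_r; apply Hua)).
  rewrite (Hconst a Hab) in I1.
  set (I := RInt (fun t => u a t) 0 (2 * PI)) in *.
  replace (fst l * (2 * PI - 0) + 0 * (2 * PI * (2 * PI) - 0 * 0) / 2)
    with (2 * PI * fst l) in I2 by field.
  assert (I3 : 2 * PI * Rabs (fst l) <= 2 * PI * (4 * M / R + eps)).
  { rewrite <- (Rabs_pos_eq (2 * PI)) at 1 by lra. rewrite <- Rabs_mult.
    replace (2 * PI * fst l) with (I - (I - 2 * PI * fst l)) by ring.
    unfold Rminus at 1. eapply Rle_trans; [apply Rabs_triang|].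
    rewrite Rabs_Ropp. lra. }
  apply Rmult_le_reg_l in I3; [|lra]. unfold eps in I3. lra.
Qed.

(** The real part of the derivative of [- Ci * phi] is the imaginary part of [l]; the two bounds
    4M/R add up. *)
Lemma cauchy_estimate phi R M l :
  0 < R -> is_disc_hol phi R M -> cder phi 0 l -> Cmod l <= 8 * M / R.
Proof.
  intros HR Hol Hl.
  assert (H1 := cauchy_estimate_re phi R M l HR Hol Hl).
  assert (Hi : forall z m, cder phi z m -> cder (fun z => - Ci * phi z)%C z (- Ci * m)%C).
  { intros z m Hm eps Heps. destruct (Hm eps Heps) as [d [Hd Hb]].
    exists d; split; [exact Hd|]. intros h Hh.
    replace (- Ci * phi (z + h) - - Ci * phi z - - Ci * m * h)%C
      with (- Ci * (phi (z + h) - phi z - m * h))%C by ring.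
    rewrite Cmod_mult, Cmod_opp, Cmod_Ci, Rmult_1_l. now apply Hb. }
  assert (H2 : Rabs (fst (- Ci * l)%C) <= 4 * M / R).
  { apply (cauchy_estimate_re (fun z => - Ci * phi z)%C R M); [exact HR| |now apply Hi].
    intros z Hz. destruct (Hol z Hz) as [A [m Hm]]. split.
    - rewrite Cmod_mult, Cmod_opp, Cmod_Ci, Rmult_1_l. exact A.
    - exists (- Ci * m)%C. now apply Hi. }
  replace (fst (- Ci * l)%C) with (snd l) in H2 by (simpl; ring).
  eapply Rle_trans; [apply Cmod_le_sum|]. lra.
Qed.

(** * Mean value inequalities, Lipschitz and Taylor bounds on a disc *)

Lemma mvt_bound (f : R -> R) L :
  (forall t, 0 <= t <= 1 -> exists l, derivable_pt_lim f t l /\ Rabs l <= L) ->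
  Rabs (f 1 - f 0) <= L.
Proof.
  intros H.
  assert (D : forall t, 0 <= t <= 1 ->
     derivable_pt_lim f t (Derive f t) /\ Rabs (Derive f t) <= L).
  { intros t Ht. destruct (H t Ht) as [l [Hl HL]].
    assert (Hd : is_derive f t l) by (apply is_derive_Reals; exact Hl).
    rewrite (is_derive_unique _ _ _ Hd). now split. }
  destruct (MVT_cor2 f (Derive f) 0 1 Rlt_0_1) as [c [E Hc]].
  { intros t Ht. now apply D. }
  rewrite E. replace (Derive f c * (1 - 0)) with (Derive f c) by ring.
  apply D; lra.
Qed.

Definition cvel (f : R -> C) (t : R) (l : C) : Prop :=
  derivable_pt_lim (fun s => fst (f s)) t (fst l) /\
  derivable_pt_lim (fun s => snd (f s)) t (snd l).

Lemma derivable_pt_lim_of_linear_error (f : R -> R) x l :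
  (forall eps, 0 < eps -> exists delta, 0 < delta /\
    forall h, Rabs h < delta -> Rabs (f (x + h) - f x - l * h) <= eps * Rabs h) ->
  derivable_pt_lim f x l.
Proof.
  intros H eps Heps. destruct (H (eps / 2) ltac:(lra)) as [d [Hd Hb]].
  exists (mkposreal d Hd). simpl. intros h Nh Hh. specialize (Hb h Hh).
  assert (Hh0 := Rabs_pos_lt h Nh).
  replace ((f (x + h) - f x) / h - l) with ((f (x + h) - f x - l * h) / h) by (field; exact Nh).
  unfold Rdiv. rewrite Rabs_mult, Rabs_inv.
  apply (Rmult_lt_reg_r (Rabs h)); [exact Hh0|].
  rewrite Rmult_assoc, Rinv_l, Rmult_1_r by lra. nra.
Qed.

Lemma cvel_linear_error f t l : cvel f t l <->
  forall eps, 0 < eps -> exists delta, 0 < delta /\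
    forall h, Rabs h < delta -> Cmod (f (t + h)%R - f t - RtoC h * l)%C <= eps * Rabs h.
Proof.
  split.
  - intros [H1 H2] eps Heps.
    destruct (derivable_pt_lim_linear_error _ _ _ H1 (eps / 2) ltac:(lra)) as [d1 [Hd1 B1]].
    destruct (derivable_pt_lim_linear_error _ _ _ H2 (eps / 2) ltac:(lra)) as [d2 [Hd2 B2]].
    exists (Rmin d1 d2). split; [apply Rmin_case; lra|]. intros h Hh.
    specialize (B1 h (Rlt_le_trans _ _ _ Hh (Rmin_l _ _))).
    specialize (B2 h (Rlt_le_trans _ _ _ Hh (Rmin_r _ _))).
    eapply Rle_trans; [apply Cmod_le_sum|].
    replace (fst (f (t + h)%R - f t - h * l)%C) with (fst (f (t + h)) - fst (f t) - fst l * h)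
      by (unfold Cminus, Cplus, Copp, Cmult, RtoC; simpl; ring).
    replace (snd (f (t + h)%R - f t - h * l)%C) with (snd (f (t + h)) - snd (f t) - snd l * h)
      by (unfold Cminus, Cplus, Copp, Cmult, RtoC; simpl; ring).
    lra.
  - intros H. split; apply derivable_pt_lim_of_linear_error; intros eps Heps;
      destruct (H eps Heps) as [d [Hd Hb]]; exists d; (split; [exact Hd|]); intros h Hh;
      specialize (Hb h Hh); eapply Rle_trans; [|exact Hb| |exact Hb].
    + eapply Rle_trans; [|apply fst_le_Cmod]. right. f_equal.
      unfold Cminus, Cplus, Copp, Cmult, RtoC; simpl. ring.
    + eapply Rle_trans; [|apply snd_le_Cmod]. right. f_equal.
      unfold Cminus, Cplus, Copp, Cmult, RtoC; simpl. ring.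
Qed.

(** The factor 2 is the price of applying the real mean value theorem to the two parts
    separately. *)
Lemma Cmvt_bound (f : R -> C) L :
  (forall t, 0 <= t <= 1 -> exists l : C, Cmod l <= L /\ cvel f t l) ->
  Cmod (f 1 - f 0)%C <= 2 * L.
Proof.
  intros H. eapply Rle_trans; [apply Cmod_le_sum|].
  assert (H1 : Rabs (fst (f 1) - fst (f 0)) <= L).
  { apply (mvt_bound (fun s => fst (f s))). intros t Ht.
    destruct (H t Ht) as [l [HL [D1 D2]]]. exists (fst l). split; [exact D1|].
    eapply Rle_trans; [apply fst_le_Cmod|exact HL]. }
  assert (H2 : Rabs (snd (f 1) - snd (f 0)) <= L).
  { apply (mvt_bound (fun s => snd (f s))). intros t Ht.
    destruct (H t Ht) as [l [HL [D1 D2]]]. exists (snd l). split; [exact D2|].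
    eapply Rle_trans; [apply snd_le_Cmod|exact HL]. }
  unfold Cminus, Cplus, Copp; simpl. unfold Rminus in *. lra.
Qed.

Lemma cder_line phi (z d l : C) t : cder phi (z + RtoC t * d)%C l ->
  cvel (fun s => phi (z + RtoC s * d)%C) t (l * d)%C.
Proof.
  intros H. apply cvel_linear_error. intros eps Heps.
  assert (Hd := Cmod_ge_0 d).
  destruct (H (eps / (Cmod d + 1))) as [dl [Hdl Hb]].
  { apply Rdiv_lt_0_compat; lra. }
  exists (dl / (Cmod d + 1)). split; [apply Rdiv_lt_0_compat; lra|]. intros h Hh.
  assert (Hh0 := Rabs_pos h).
  specialize (Hb (RtoC h * d)%C). rewrite Cmod_mult, Cmod_R in Hb.
  replace (z + RtoC t * d + RtoC h * d)%C with (z + RtoC (t + h) * d)%C in Hb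
    by (rewrite RtoC_plus; ring).
  replace (l * (RtoC h * d))%C with (RtoC h * (l * d))%C in Hb by ring.
  eapply Rle_trans; [apply Hb|].
  - apply (Rmult_lt_compat_r (Cmod d + 1)) in Hh; [|lra].
    replace (dl / (Cmod d + 1) * (Cmod d + 1)) with dl in Hh by (field; lra). nra.
  - replace (eps * Rabs h) with (eps / (Cmod d + 1) * (Rabs h * (Cmod d + 1))) by (field; lra).
    apply Rmult_le_compat_l; [apply Rlt_le, Rdiv_lt_0_compat; lra|].
    apply Rmult_le_compat_l; lra.
Qed.

Lemma Cmod_segment (z w : C) t r : 0 <= t <= 1 -> Cmod z <= r -> Cmod w <= r ->
  Cmod (z + RtoC t * (w - z))%C <= r.
Proof.
  intros Ht Hz Hw.
  replace (z + RtoC t * (w - z))%C with (RtoC (1 - t) * z + RtoC t * w)%C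
    by (rewrite RtoC_minus; ring).
  eapply Rle_trans; [apply Cmod_triangle|]. rewrite !Cmod_mult, !Cmod_R.
  rewrite !Rabs_pos_eq by lra. nra.
Qed.

Lemma segment_lipschitz phi (z w : C) L :
  (forall t, 0 <= t <= 1 -> exists l,
     cder phi (z + RtoC t * (w - z))%C l /\ Cmod l <= L) ->
  Cmod (phi w - phi z)%C <= 2 * (L * Cmod (w - z)%C).
Proof.
  intros H.
  replace (phi w - phi z)%C with
    (phi (z + RtoC 1 * (w - z)) - phi (z + RtoC 0 * (w - z)))%C
    by (f_equal; f_equal; [|f_equal]; ring).
  apply (Cmvt_bound (fun s => phi (z + RtoC s * (w - z))%C)).
  intros t Ht. destruct (H t Ht) as [l [D B]].
  exists (l * (w - z))%C. split.
  - rewrite Cmod_mult. apply Rmult_le_compat_r; [apply Cmod_ge_0|exact B].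
  - now apply cder_line.
Qed.

Lemma cder_shift phi (w z l : C) :
  cder phi (w + z)%C l -> cder (fun x => phi (w + x)%C) z l.
Proof.
  intros H eps Heps. destruct (H eps Heps) as [d [Hd Hb]].
  exists d; split; [exact Hd|]. intros h Hh. rewrite Cplus_assoc. now apply Hb.
Qed.

Lemma cder_minus phi psi (z l m : C) : cder phi z l -> cder psi z m ->
  cder (fun x => phi x - psi x)%C z (l - m)%C.
Proof.
  intros H1 H2 eps Heps.
  destruct (H1 (eps / 2) ltac:(lra)) as [d1 [Hd1 Hb1]].
  destruct (H2 (eps / 2) ltac:(lra)) as [d2 [Hd2 Hb2]].
  exists (Rmin d1 d2); split; [apply Rmin_case; lra|]. intros h Hh.
  specialize (Hb1 h (Rlt_le_trans _ _ _ Hh (Rmin_l _ _))).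
  specialize (Hb2 h (Rlt_le_trans _ _ _ Hh (Rmin_r _ _))).
  replace (phi (z + h) - psi (z + h) - (phi z - psi z) - (l - m) * h)%C
   with ((phi (z + h) - phi z - l * h) - (psi (z + h) - psi z - m * h))%C by ring.
  eapply Rle_trans; [apply Cmod_sub_le|]. lra.
Qed.

Lemma disc_derivative phi R M w l : 0 < R -> is_disc_hol phi R M ->
  Cmod w <= R / 2 -> cder phi w l -> Cmod l <= 16 * M / R.
Proof.
  intros HR Hol Hw Hl.
  replace (16 * M / R) with (8 * M / (R / 2)) by (field; lra).
  apply (cauchy_estimate (fun x => phi (w + x)%C)); [lra| |].
  - intros z Hz. destruct (Hol (w + z)%C) as [A [m Hm]].
    { eapply Rle_lt_trans; [apply Cmod_triangle|lra]. }
    split; [exact A|]. exists m. now apply cder_shift.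
  - apply cder_shift. now rewrite Cplus_0_r.
Qed.

Lemma disc_lipschitz phi R M z w : 0 < R -> is_disc_hol phi R M ->
  Cmod z <= R / 2 -> Cmod w <= R / 2 ->
  Cmod (phi w - phi z)%C <= 32 * M / R * Cmod (w - z)%C.
Proof.
  intros HR Hol Hz Hw.
  replace (32 * M / R * Cmod (w - z)%C) with (2 * (16 * M / R * Cmod (w - z)%C))
    by (field; lra).
  apply segment_lipschitz. intros t Ht.
  assert (Hs := Cmod_segment z w t _ Ht Hz Hw).
  destruct (Hol (z + RtoC t * (w - z))%C ltac:(lra)) as [_ [l Hl]].
  exists l; split; [exact Hl|]. now apply (disc_derivative phi R M _ _ HR Hol Hs).
Qed.

(** A second-order bound from first derivatives only: phi'(w) - l is the derivative at 0 of x ->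
    phi(w + x) - phi(x), a function of size 32 M |w| / R on the disc of radius R/4 by the Lipschitz
    bound. Cauchy's estimate there gives 1024 M |w| / R^2, and integrating along the segment doubles
    the constant. *)
Lemma disc_taylor phi R M z l : 0 < R -> is_disc_hol phi R M ->
  Cmod z <= R / 4 -> cder phi 0 l ->
  Cmod (phi z - phi 0 - l * z)%C <= 2048 * M / R ^ 2 * Cmod z ^ 2.
Proof.
  intros HR Hol Hz Hl.
  assert (HM : 0 <= M).
  { eapply Rle_trans; [apply Cmod_ge_0|]. apply (Hol 0). rewrite Cmod_0; lra. }
  assert (Hz0 := Cmod_ge_0 z).
  assert (G := segment_lipschitz (fun w => phi w - (0 + l * w))%C 0 z
                 (1024 * M / R ^ 2 * Cmod z)).
  cbv beta in G.
  replace (phi z - (0 + l * z) - (phi 0 - (0 + l * 0)))%C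
    with (phi z - phi 0 - l * z)%C in G by ring.
  replace (z - 0)%C with z in G by ring.
  replace (2048 * M / R ^ 2 * Cmod z ^ 2)
    with (2 * (1024 * M / R ^ 2 * Cmod z * Cmod z)) by (field; lra).
  apply G. clear G. intros t Ht. set (w := (0 + RtoC t * z)%C).
  assert (Hw : Cmod w <= Cmod z).
  { unfold w. rewrite Cplus_0_l, Cmod_mult, Cmod_R, Rabs_pos_eq by lra. nra. }
  destruct (Hol w ltac:(lra)) as [_ [m Hm]].
  exists (m - l)%C. split.
  - apply cder_minus; [exact Hm|apply cder_affine].
  - apply Rle_trans with (8 * (32 * M / R * Cmod w) / (R / 4)).
    + apply (cauchy_estimate (fun x => phi (w + x) - phi x)%C); [lra| |].
      * intros x Hx. split.
        -- replace (Cmod w) with (Cmod ((w + x) - x)%C) by (f_equal; ring).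
           apply (disc_lipschitz phi R M); [exact HR|exact Hol|lra|].
           eapply Rle_trans; [apply Cmod_triangle|lra].
        -- destruct (Hol (w + x)%C) as [_ [m1 Hm1]].
           { eapply Rle_lt_trans; [apply Cmod_triangle|lra]. }
           destruct (Hol x ltac:(lra)) as [_ [m2 Hm2]].
           exists (m1 - m2)%C. apply cder_minus; [now apply cder_shift|exact Hm2].
      * apply cder_minus; [|exact Hl]. apply cder_shift. now rewrite Cplus_0_r.
    + replace (8 * (32 * M / R * Cmod w) / (R / 4)) with (1024 * M / R ^ 2 * Cmod w)
        by (field; lra).
      apply Rmult_le_compat_l; [|exact Hw].
      apply Rdiv_le_0_compat; [lra|apply pow_lt; lra].
Qed.

(** * Holomorphic functions of three variables *)

Lemma Cnorm_Cmod (z : C) : Cnorm z = Cmod z.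
Proof. unfold Cnorm, Cmod; simpl. f_equal. ring. Qed.

Lemma C3norm_Cmod (p : C3) :
  C3norm p = Rmax (Cmod (c3x p)) (Rmax (Cmod (c3y p)) (Cmod (c3z p))).
Proof. unfold C3norm. now rewrite !Cnorm_Cmod. Qed.

Definition C3sub (p q : C3) : C3 :=
  ((c3x p - c3x q)%C, (c3y p - c3y q)%C, (c3z p - c3z q)%C).
Definition C3scal (k : C) (p : C3) : C3 :=
  ((k * c3x p)%C, (k * c3y p)%C, (k * c3z p)%C).

(** The complex numbers of the statement are convertible to Coquelicot's [C]; renaming the
    operations makes [ring] applicable. *)
Ltac Cpx_to_C :=
  change Cpx with C in *; change Csub with Cminus in *; change Cadd with Cplus in *;
  change Cmul with Cmult in *; change Defs.Copp with Complex.Copp in *;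
  change C0 with (RtoC 0) in *.
Ltac C3ring :=
  repeat match goal with p : C3 |- _ => destruct p as [[? ?] ?] end;
  unfold C3sub, C3scal, C3add, C3zero, Clin3, c3x, c3y, c3z in *; simpl fst in *; simpl snd in *;
  Cpx_to_C; repeat match goal with |- (_, _) = (_, _) => apply f_equal2 end; ring.

Lemma C3norm_x p : Cmod (c3x p) <= C3norm p.
Proof. rewrite C3norm_Cmod. apply Rmax_l. Qed.
Lemma C3norm_y p : Cmod (c3y p) <= C3norm p.
Proof. rewrite C3norm_Cmod. eapply Rle_trans; [apply Rmax_l|apply Rmax_r]. Qed.
Lemma C3norm_z p : Cmod (c3z p) <= C3norm p.
Proof. rewrite C3norm_Cmod. eapply Rle_trans; [apply Rmax_r|apply Rmax_r]. Qed.

Lemma C3norm_le p r : Cmod (c3x p) <= r -> Cmod (c3y p) <= r -> Cmod (c3z p) <= r ->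
  C3norm p <= r.
Proof. intros. rewrite C3norm_Cmod. repeat apply Rmax_lub; assumption. Qed.

Lemma C3norm_lt p r : Cmod (c3x p) < r -> Cmod (c3y p) < r -> Cmod (c3z p) < r ->
  C3norm p < r.
Proof. intros. rewrite C3norm_Cmod. repeat apply Rmax_lub_lt; assumption. Qed.

Lemma C3norm_pos p : 0 <= C3norm p.
Proof. eapply Rle_trans; [apply Cmod_ge_0|apply C3norm_x]. Qed.

Lemma C3norm_triangle p q : C3norm (C3add p q) <= C3norm p + C3norm q.
Proof.
  apply C3norm_le.
  - eapply Rle_trans; [apply (Cmod_triangle (c3x p) (c3x q))|].
    generalize (C3norm_x p) (C3norm_x q); lra.
  - eapply Rle_trans; [apply (Cmod_triangle (c3y p) (c3y q))|].
    generalize (C3norm_y p) (C3norm_y q); lra.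
  - eapply Rle_trans; [apply (Cmod_triangle (c3z p) (c3z q))|].
    generalize (C3norm_z p) (C3norm_z q); lra.
Qed.

Lemma C3norm_scal k p : C3norm (C3scal k p) = Cmod k * C3norm p.
Proof.
  rewrite !C3norm_Cmod. unfold C3scal, c3x, c3y, c3z; simpl. rewrite !Cmod_mult.
  rewrite !RmaxRmult by apply Cmod_ge_0. reflexivity.
Qed.

Lemma C3norm_zero : C3norm C3zero = 0.
Proof.
  replace C3zero with (C3scal 0 C3zero) by C3ring.
  rewrite C3norm_scal, Cmod_0. ring.
Qed.

Lemma C3norm_opp p : C3norm (C3sub C3zero p) = C3norm p.
Proof.
  replace (C3sub C3zero p) with (C3scal (-(1))%C p) by C3ring.
  rewrite C3norm_scal, Cmod_m1. ring.
Qed.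

Lemma C3norm_sub p q : C3norm (C3sub p q) <= C3norm p + C3norm q.
Proof.
  replace (C3sub p q) with (C3add p (C3sub C3zero q)) by C3ring.
  eapply Rle_trans; [apply C3norm_triangle|]. rewrite C3norm_opp. lra.
Qed.

Lemma C3norm_sym p q : C3norm (C3sub p q) = C3norm (C3sub q p).
Proof.
  rewrite <- (C3norm_opp (C3sub q p)). apply f_equal. C3ring.
Qed.

Lemma C3norm_sub_diag p : C3norm (C3sub p p) = 0.
Proof. replace (C3sub p p) with C3zero by C3ring. apply C3norm_zero. Qed.

Lemma C3norm_eq_0 p : C3norm p <= 0 -> p = C3zero.
Proof.
  intros H. destruct p as [[x y] z].
  assert (Hx := C3norm_x (x, y, z)). assert (Hy := C3norm_y (x, y, z)).
  assert (Hz := C3norm_z (x, y, z)). unfold c3x, c3y, c3z in *; simpl in *.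
  assert (E : forall w : C, Cmod w <= 0 -> w = C0).
  { intros w Hw. apply Cmod_eq_0. apply Rle_antisym; [exact Hw|apply Cmod_ge_0]. }
  unfold C3zero. rewrite (E x), (E y), (E z) by lra. reflexivity.
Qed.

Lemma C3sub_eq p q : C3norm (C3sub p q) <= 0 -> p = q.
Proof.
  intros H. apply C3norm_eq_0 in H.
  replace p with (C3add (C3sub p q) q) by C3ring. rewrite H. C3ring.
Qed.

(* Derivatives are complex-linear functions rather than the coefficient triples of
   [has_cderiv3], so that the chain rule is composition. *)
Definition is_lin (L : C3 -> C) : Prop := exists a b c : C, forall v, L v = Clin3 a b c v.

Lemma is_lin_Clin3 a b c : is_lin (Clin3 a b c).
Proof. now exists a, b, c. Qed.

Lemma lin_add L u v : is_lin L -> L (C3add u v) = (L u + L v)%C.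
Proof. intros [a [b [c H]]]. rewrite !H. C3ring. Qed.

Lemma lin_scal L k v : is_lin L -> L (C3scal k v) = (k * L v)%C.
Proof. intros [a [b [c H]]]. rewrite !H. C3ring. Qed.

Lemma lin_sub L u v : is_lin L -> L (C3sub u v) = (L u - L v)%C.
Proof. intros [a [b [c H]]]. rewrite !H. C3ring. Qed.

Lemma lin_bounded L : is_lin L ->
  exists K, 0 <= K /\ forall v, Cmod (L v) <= K * C3norm v.
Proof.
  intros [a [b [c H]]]. exists (Cmod a + Cmod b + Cmod c).
  generalize (Cmod_ge_0 a) (Cmod_ge_0 b) (Cmod_ge_0 c). intros Ha Hb Hc.
  split; [lra|]. intros v. rewrite H. unfold Clin3. Cpx_to_C.
  eapply Rle_trans; [apply Cmod_triangle|].
  eapply Rle_trans; [apply Rplus_le_compat_l, Cmod_triangle|].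
  rewrite !Cmod_mult.
  generalize (C3norm_x v) (C3norm_y v) (C3norm_z v). intros. nra.
Qed.

Definition fder (F : C3 -> C) (p : C3) (L : C3 -> C) : Prop :=
  forall eps, 0 < eps -> exists delta, 0 < delta /\
    forall h, C3norm h < delta ->
      Cmod (F (C3add p h) - F p - L h)%C <= eps * C3norm h.

Lemma has_cderiv3_fder F p a b c : has_cderiv3 F p a b c <-> fder F p (Clin3 a b c).
Proof.
  split; intros H eps Heps; destruct (H eps Heps) as [d [Hd Hb]];
   exists d; (split; [exact Hd|]); intros h Hh; specialize (Hb h Hh).
  - rewrite Cnorm_Cmod in Hb. exact Hb.
  - rewrite Cnorm_Cmod. exact Hb.
Qed.

Lemma fder_ext F p L L' : (forall v, L v = L' v) -> fder F p L -> fder F p L'.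
Proof.
  intros E H eps Heps. destruct (H eps Heps) as [d [Hd Hb]].
  exists d; split; [exact Hd|]. intros h Hh. rewrite <- E. now apply Hb.
Qed.

Lemma fder_ext_fun F G p L : (exists r, 0 < r /\ forall h, C3norm h < r ->
   F (C3add p h) = G (C3add p h)) -> fder F p L -> fder G p L.
Proof.
  intros [r [Hr E]] H eps Heps. destruct (H eps Heps) as [d [Hd Hb]].
  exists (Rmin d r); split; [apply Rmin_case; lra|]. intros h Hh.
  assert (E0 : F p = G p).
  { replace p with (C3add p C3zero) by C3ring. apply E. rewrite C3norm_zero; exact Hr. }
  rewrite <- E0, <- E. apply Hb.
  - eapply Rlt_le_trans; [exact Hh|apply Rmin_l].
  - eapply Rlt_le_trans; [exact Hh|apply Rmin_r].
Qed.

Definition has_fder (F : C3 -> C) (p : C3) : Prop := exists L, is_lin L /\ fder F p L.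

Lemma has_fder_cderiv3 F p : has_fder F p <-> exists a b c, has_cderiv3 F p a b c.
Proof.
  split.
  - intros [L [[a [b [c E]]] H]]. exists a, b, c. apply has_cderiv3_fder.
    now apply fder_ext with L.
  - intros [a [b [c H]]]. exists (Clin3 a b c). split; [apply is_lin_Clin3|].
    now apply has_cderiv3_fder.
Qed.

Definition is_lin3 (D : C3 -> C3) : Prop :=
  is_lin (fun v => c3x (D v)) /\ is_lin (fun v => c3y (D v)) /\ is_lin (fun v => c3z (D v)).

Definition vder (Psi : C3 -> C3) (p : C3) (D : C3 -> C3) : Prop :=
  fder (fun q => c3x (Psi q)) p (fun v => c3x (D v)) /\
  fder (fun q => c3y (Psi q)) p (fun v => c3y (D v)) /\
  fder (fun q => c3z (Psi q)) p (fun v => c3z (D v)).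

Lemma vder_error Psi p D : vder Psi p D ->
  forall eps, 0 < eps -> exists delta, 0 < delta /\
    forall h, C3norm h < delta ->
      C3norm (C3sub (C3sub (Psi (C3add p h)) (Psi p)) (D h)) <= eps * C3norm h.
Proof.
  intros [Hx [Hy Hz]] eps Heps.
  destruct (Hx eps Heps) as [dx [Hdx Hbx]].
  destruct (Hy eps Heps) as [dy [Hdy Hby]].
  destruct (Hz eps Heps) as [dz [Hdz Hbz]].
  exists (Rmin dx (Rmin dy dz)). split; [repeat apply Rmin_case; lra|].
  intros h Hh.
  assert (h1 := Rlt_le_trans _ _ _ Hh (Rmin_l _ _)).
  assert (h23 := Rlt_le_trans _ _ _ Hh (Rmin_r _ _)).
  assert (h2 := Rlt_le_trans _ _ _ h23 (Rmin_l _ _)).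
  assert (h3 := Rlt_le_trans _ _ _ h23 (Rmin_r _ _)).
  apply C3norm_le; [apply Hbx|apply Hby|apply Hbz]; assumption.
Qed.

Lemma lin3_bounded D : is_lin3 D ->
  exists K, 0 <= K /\ forall v, C3norm (D v) <= K * C3norm v.
Proof.
  intros [Hx [Hy Hz]].
  destruct (lin_bounded _ Hx) as [K1 [HK1 B1]].
  destruct (lin_bounded _ Hy) as [K2 [HK2 B2]].
  destruct (lin_bounded _ Hz) as [K3 [HK3 B3]].
  exists (K1 + K2 + K3). split; [lra|]. intros v.
  assert (Hv := C3norm_pos v).
  apply C3norm_le; [eapply Rle_trans; [apply B1|]|eapply Rle_trans; [apply B2|]
   |eapply Rle_trans; [apply B3|]]; apply Rmult_le_compat_r; lra.
Qed.

Lemma is_lin_comp L D : is_lin L -> is_lin3 D -> is_lin (fun v => L (D v)).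
Proof.
  intros [a [b [c E]]] [[a1 [b1 [c1 E1]]] [[a2 [b2 [c2 E2]]] [a3 [b3 [c3 E3]]]]].
  exists (a * a1 + b * a2 + c * a3)%C, (a * b1 + b * b2 + c * b3)%C,
    (a * c1 + b * c2 + c * c3)%C.
  intros v. rewrite E. unfold Clin3 at 1. rewrite E1, E2, E3. C3ring.
Qed.

Lemma fder_comp F Psi p L D : is_lin L -> is_lin3 D ->
  vder Psi p D -> fder F (Psi p) L -> fder (fun q => F (Psi q)) p (fun v => L (D v)).
Proof.
  intros HL HD HP HF eps Heps.
  destruct (lin_bounded _ HL) as [K [HK BK]].
  destruct (lin3_bounded _ HD) as [N [HN BN]].
  destruct (vder_error _ _ _ HP 1 Rlt_0_1) as [d0 [Hd0 Hb0]].
  destruct (HF (eps / (2 * (N + 1)))) as [d1 [Hd1 Hb1]].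
  { apply Rdiv_lt_0_compat; lra. }
  destruct (vder_error _ _ _ HP (eps / (2 * (K + 1)))) as [d2 [Hd2 Hb2]].
  { apply Rdiv_lt_0_compat; lra. }
  assert (Hq : 0 < d1 / (N + 1)) by (apply Rdiv_lt_0_compat; lra).
  exists (Rmin d0 (Rmin (d1 / (N + 1)) d2)). split; [repeat apply Rmin_case; lra|].
  intros h Hh.
  assert (h1 := Rlt_le_trans _ _ _ Hh (Rmin_l _ _)).
  assert (h23 := Rlt_le_trans _ _ _ Hh (Rmin_r _ _)).
  assert (h2 := Rlt_le_trans _ _ _ h23 (Rmin_l _ _)).
  assert (h3 := Rlt_le_trans _ _ _ h23 (Rmin_r _ _)).
  specialize (Hb0 h h1). specialize (Hb2 h h3).
  set (k := C3sub (Psi (C3add p h)) (Psi p)) in *.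
  assert (Hk : C3norm k <= (N + 1) * C3norm h).
  { replace k with (C3add (C3sub k (D h)) (D h)) by (generalize (D h), k; intros; C3ring).
    eapply Rle_trans; [apply C3norm_triangle|]. generalize (BN h). lra. }
  assert (Hk1 : C3norm k < d1).
  { eapply Rle_lt_trans; [exact Hk|].
    replace d1 with ((N + 1) * (d1 / (N + 1))) by (field; lra).
    apply Rmult_lt_compat_l; lra. }
  specialize (Hb1 k Hk1).
  replace (C3add (Psi p) k) with (Psi (C3add p h)) in Hb1
    by (unfold k; generalize (Psi p), (Psi (C3add p h)); intros; C3ring).
  replace (F (Psi (C3add p h)) - F (Psi p) - L (D h))%C with
   ((F (Psi (C3add p h)) - F (Psi p) - L k) + L (C3sub k (D h)))%C
   by (rewrite (lin_sub L _ _ HL); ring).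
  eapply Rle_trans; [apply Cmod_triangle|].
  assert (A1 : eps / (2 * (N + 1)) * C3norm k <= eps / 2 * C3norm h).
  { replace (eps / 2 * C3norm h) with (eps / (2 * (N + 1)) * ((N + 1) * C3norm h))
      by (field; lra).
    apply Rmult_le_compat_l; [apply Rlt_le, Rdiv_lt_0_compat; lra|exact Hk]. }
  assert (A2 : Cmod (L (C3sub k (D h))) <= eps / 2 * C3norm h).
  { eapply Rle_trans; [apply BK|].
    replace (eps / 2 * C3norm h) with ((K + 1) * (eps / (2 * (K + 1)) * C3norm h))
      by (field; lra).
    apply Rmult_le_compat; [lra|apply C3norm_pos|lra|exact Hb2]. }
  lra.
Qed.

Lemma fder_slice F p v z L : is_lin L -> fder F (C3add p (C3scal z v)) L ->
  cder (fun w => F (C3add p (C3scal w v))) z (L v).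
Proof.
  intros HL HF eps Heps.
  assert (Hv := C3norm_pos v).
  destruct (HF (eps / (C3norm v + 1))) as [d [Hd Hb]].
  { apply Rdiv_lt_0_compat; lra. }
  exists (d / (C3norm v + 1)). split; [apply Rdiv_lt_0_compat; lra|].
  intros h Hh.
  specialize (Hb (C3scal h v)). rewrite C3norm_scal in Hb.
  assert (Hh0 := Cmod_ge_0 h).
  replace (C3add (C3add p (C3scal z v)) (C3scal h v)) with (C3add p (C3scal (z + h)%C v)) in Hb
    by (clear; C3ring).
  rewrite (lin_scal L _ _ HL) in Hb.
  replace (L v * h)%C with (h * L v)%C by ring.
  eapply Rle_trans; [apply Hb|].
  - apply (Rmult_lt_compat_r (C3norm v + 1)) in Hh; [|lra].
    replace (d / (C3norm v + 1) * (C3norm v + 1)) with d in Hh by (field; lra). nra.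
  - replace (eps * Cmod h) with (eps / (C3norm v + 1) * (Cmod h * (C3norm v + 1)))
      by (field; lra).
    apply Rmult_le_compat_l; [apply Rlt_le, Rdiv_lt_0_compat; lra|].
    apply Rmult_le_compat_l; lra.
Qed.

Lemma fder_unique F p L L' : is_lin L -> is_lin L' -> fder F p L -> fder F p L' ->
  forall v, L v = L' v.
Proof.
  intros HL HL' H H' v.
  assert (E : C3add p (C3scal 0 v) = p) by C3ring.
  apply (cder_unique (fun w => F (C3add p (C3scal w v))) 0);
    apply fder_slice; try assumption; now rewrite E.
Qed.

Definition has_vder (Psi : C3 -> C3) (p : C3) : Prop := exists D, is_lin3 D /\ vder Psi p D.

Lemma is_lin_coord : is_lin c3x /\ is_lin c3y /\ is_lin c3z.
Proof.
  split; [|split].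
  - exists (RtoC 1), (RtoC 0), (RtoC 0). intros v. clear; C3ring.
  - exists (RtoC 0), (RtoC 1), (RtoC 0). intros v. clear; C3ring.
  - exists (RtoC 0), (RtoC 0), (RtoC 1). intros v. clear; C3ring.
Qed.

Lemma fder_lin (L : C3 -> C) p : is_lin L -> fder L p L.
Proof.
  intros HL eps Heps. exists 1; split; [lra|]. intros h _.
  rewrite (lin_add L _ _ HL). replace (L p + L h - L p - L h)%C with (RtoC 0) by ring.
  rewrite Cmod_0. apply Rmult_le_pos; [lra|apply C3norm_pos].
Qed.

Lemma fder_plus_scal F G p L N (k : C) : fder F p L -> fder G p N ->
  fder (fun q => F q + k * G q)%C p (fun v => L v + k * N v)%C.
Proof.
  intros HF HG eps Heps.
  assert (Hk := Cmod_ge_0 k).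
  destruct (HF (eps / 2) ltac:(lra)) as [d1 [Hd1 H1]].
  destruct (HG (eps / (2 * (Cmod k + 1)))) as [d2 [Hd2 H2]].
  { apply Rdiv_lt_0_compat; lra. }
  exists (Rmin d1 d2). split; [apply Rmin_case; lra|]. intros h Hh.
  specialize (H1 h (Rlt_le_trans _ _ _ Hh (Rmin_l _ _))).
  specialize (H2 h (Rlt_le_trans _ _ _ Hh (Rmin_r _ _))).
  replace (F (C3add p h) + k * G (C3add p h) - (F p + k * G p) - (L h + k * N h))%C
   with ((F (C3add p h) - F p - L h) + k * (G (C3add p h) - G p - N h))%C by ring.
  eapply Rle_trans; [apply Cmod_triangle|]. rewrite Cmod_mult.
  assert (Cmod k * Cmod (G (C3add p h) - G p - N h)%C <= eps / 2 * C3norm h).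
  { replace (eps / 2 * C3norm h) with
     ((Cmod k + 1) * (eps / (2 * (Cmod k + 1)) * C3norm h)) by (field; lra).
    apply Rmult_le_compat; try apply Cmod_ge_0; [lra|exact H2]. }
  lra.
Qed.

Lemma is_lin_plus_scal L N (k : C) : is_lin L -> is_lin N -> is_lin (fun v => L v + k * N v)%C.
Proof.
  intros [x [y [z E]]] [x' [y' [z' E']]].
  exists (x + k * x')%C, (y + k * y')%C, (z + k * z')%C.
  intros v. rewrite E, E'. clear; C3ring.
Qed.

Lemma has_fder_scal F p (k : C) : has_fder F p -> has_fder (fun q => k * F q)%C p.
Proof.
  intros [L [HL HF]].
  assert (Z : is_lin (fun _ => RtoC 0)).
  { exists (RtoC 0), (RtoC 0), (RtoC 0). intros v. clear; C3ring. }
  exists (fun v => RtoC 0 + k * L v)%C. split.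
  - now apply is_lin_plus_scal.
  - assert (G := fder_plus_scal _ _ p _ _ k (fder_lin _ p Z) HF).
    apply (fder_ext_fun (fun q => 0 + k * F q)%C); [|exact G].
    exists 1; split; [lra|]. intros h _. ring.
Qed.

Lemma has_fder_comp F Psi p : has_fder F (Psi p) ->
  has_vder Psi p -> has_fder (fun q => F (Psi q)) p.
Proof.
  intros [L [HL HF]] [D [HD HP]]. exists (fun v => L (D v)). split.
  - now apply is_lin_comp.
  - now apply fder_comp.
Qed.

Lemma has_vder_components Psi p :
  has_vder Psi p <-> has_fder (fun q => c3x (Psi q)) p /\ has_fder (fun q => c3y (Psi q)) p
    /\ has_fder (fun q => c3z (Psi q)) p.
Proof.
  split.
  - intros [D [[L1 [L2 L3]] [V1 [V2 V3]]]]. repeat split; eexists; eauto.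
  - intros [[L1 [HL1 V1]] [[L2 [HL2 V2]] [L3 [HL3 V3]]]].
    exists (fun v => (L1 v, L2 v, L3 v)). repeat split; assumption.
Qed.

Lemma has_fder_lin L p : is_lin L -> has_fder L p.
Proof. intros H. exists L. split; [exact H|now apply fder_lin]. Qed.

Lemma has_fder_plus_scal F G p (k : C) : has_fder F p -> has_fder G p ->
  has_fder (fun q => F q + k * G q)%C p.
Proof.
  intros [L [HL HF]] [N [HN HG]]. exists (fun v => L v + k * N v)%C. split.
  - now apply is_lin_plus_scal.
  - now apply fder_plus_scal.
Qed.

Lemma has_fder_ext F G p : (forall q, F q = G q) -> has_fder F p -> has_fder G p.
Proof.
  intros E [L [HL HF]]. exists L. split; [exact HL|].
  apply (fder_ext_fun F); [|exact HF]. exists 1. split; [lra|]. intros h _. apply E.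
Qed.

Lemma has_fder_minus F G p : has_fder F p -> has_fder G p -> has_fder (fun q => F q - G q)%C p.
Proof.
  intros HF HG. apply (has_fder_ext (fun q => F q + (-(1)) * G q)%C).
  - intros q. ring.
  - now apply has_fder_plus_scal.
Qed.

Lemma has_vder_sub Phi Psi p : has_vder Phi p -> has_vder Psi p ->
  has_vder (fun q => C3sub (Phi q) (Psi q)) p.
Proof.
  rewrite !has_vder_components. intros [A1 [A2 A3]] [B1 [B2 B3]].
  split; [|split].
  - exact (has_fder_minus _ _ _ A1 B1).
  - exact (has_fder_minus _ _ _ A2 B2).
  - exact (has_fder_minus _ _ _ A3 B3).
Qed.

Lemma has_vder_id p : has_vder (fun q => q) p.
Proof.
  rewrite has_vder_components. destruct is_lin_coord as [H1 [H2 H3]].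
  split; [|split]; now apply has_fder_lin.
Qed.

Lemma has_vder_comp Phi Psi p : has_vder Phi (Psi p) -> has_vder Psi p ->
  has_vder (fun q => Phi (Psi q)) p.
Proof.
  intros H1 H2. apply has_vder_components in H1. destruct H1 as [A1 [A2 A3]].
  apply has_vder_components. split; [|split].
  - now apply (has_fder_comp (fun q => c3x (Phi q))).
  - now apply (has_fder_comp (fun q => c3y (Phi q))).
  - now apply (has_fder_comp (fun q => c3z (Phi q))).
Qed.

Lemma has_vder_near Psi p : has_vder Psi p -> forall eps, 0 < eps ->
  exists delta, 0 < delta /\ forall h, C3norm h < delta ->
    C3norm (C3sub (Psi (C3add p h)) (Psi p)) < eps.
Proof.
  intros [D [HD HP]] eps Heps.
  destruct (lin3_bounded _ HD) as [N [HN BN]].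
  destruct (vder_error _ _ _ HP 1 Rlt_0_1) as [d [Hd Hb]].
  exists (Rmin d (eps / (N + 2))). split.
  { apply Rmin_case; [lra|apply Rdiv_lt_0_compat; lra]. }
  intros h Hh.
  specialize (Hb h (Rlt_le_trans _ _ _ Hh (Rmin_l _ _))).
  assert (h2 := Rlt_le_trans _ _ _ Hh (Rmin_r _ _)).
  apply (Rmult_lt_compat_r (N + 2)) in h2; [|lra].
  replace (eps / (N + 2) * (N + 2)) with eps in h2 by (field; lra).
  replace (C3sub (Psi (C3add p h)) (Psi p)) with
   (C3add (C3sub (C3sub (Psi (C3add p h)) (Psi p)) (D h)) (D h))
   by (generalize (D h), (Psi (C3add p h)), (Psi p); clear; intros; C3ring).
  eapply Rle_lt_trans; [apply C3norm_triangle|].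
  generalize (BN h) (C3norm_pos h). intros. nra.
Qed.

(** The chain rule gives the derivative of each coordinate of the composition, and uniqueness of
    derivatives identifies it with that coordinate. *)
Lemma left_inverse_derivative G Psi p D E :
  is_lin3 D -> is_lin3 E -> vder Psi p D -> vder G (Psi p) E ->
  (exists r, 0 < r /\ forall h, C3norm h < r -> G (Psi (C3add p h)) = C3add p h) ->
  forall v, E (D v) = v.
Proof.
  intros HD [E1 [E2 E3]] HP [V1 [V2 V3]] [r [Hr Hid]] v.
  destruct is_lin_coord as [Cx [Cy Cz]].
  assert (Q : forall (l : C3 -> C), is_lin l -> is_lin (fun v => l (E v)) ->
     fder (fun q => l (G q)) (Psi p) (fun v => l (E v)) -> l (E (D v)) = l v).
  { intros l Hl HlE Hf.
    apply (fder_unique l p (fun v => l (E (D v))) l).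
    - exact (is_lin_comp (fun v => l (E v)) D HlE HD).
    - exact Hl.
    - apply (fder_ext_fun (fun q => l (G (Psi q)))).
      + exists r; split; [exact Hr|]. intros h Hh. now rewrite Hid.
      + exact (fder_comp (fun q => l (G q)) Psi p _ D HlE HD HP Hf).
    - now apply fder_lin. }
  assert (Q1 := Q c3x Cx E1 V1). assert (Q2 := Q c3y Cy E2 V2). assert (Q3 := Q c3z Cz E3 V3).
  destruct (E (D v)) as [[x y] z]. destruct v as [[x' y'] z'].
  unfold c3x, c3y, c3z in *; simpl in *. now subst.
Qed.

(** * Estimates on balls by restriction to complex lines *)

Definition ball_hol (F : C3 -> C) (p : C3) (r M : R) : Prop :=
  forall h, C3norm h < r -> Cmod (F (C3add p h)) <= M /\ has_fder F (C3add p h).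

Lemma ball_hol_slice F p r M v : 0 < C3norm v -> ball_hol F p r M ->
  is_disc_hol (fun w => F (C3add p (C3scal w v))) (r / C3norm v) M.
Proof.
  intros Hv H z Hz.
  destruct (H (C3scal z v)) as [HM [L [HL HF]]].
  { rewrite C3norm_scal. apply (Rmult_lt_compat_r (C3norm v)) in Hz; [|exact Hv].
    replace (r / C3norm v * C3norm v) with r in Hz by (field; lra). exact Hz. }
  split; [exact HM|]. exists (L v). now apply fder_slice.
Qed.

Lemma ball_hol_recenter H rho M p : ball_hol H C3zero rho M -> C3norm p < rho / 2 ->
  ball_hol H p (rho / 2) M.
Proof.
  intros HH Hp h Hh. replace (C3add p h) with (C3add C3zero (C3add p h)) by C3ring.
  apply HH. eapply Rle_lt_trans; [apply C3norm_triangle|lra].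
Qed.

Lemma ball_hol_pos F p r M : 0 < r -> ball_hol F p r M -> 0 <= M.
Proof.
  intros Hr H. destruct (H C3zero) as [A _].
  { rewrite C3norm_zero. exact Hr. }
  eapply Rle_trans; [apply Cmod_ge_0|exact A].
Qed.

(** On the complex line through [p] in the direction [h], the point [p + h] has parameter 1 and the
    disc has radius [r / |h|], so the disc estimate scales to the stated one. The zero vector is
    treated apart because it spans no line. *)
Lemma ball_hol_lipschitz F p r M h : 0 < r -> ball_hol F p r M -> C3norm h <= r / 2 ->
  Cmod (F (C3add p h) - F p)%C <= 32 * M / r * C3norm h.
Proof.
  intros Hr H Hh.
  destruct (Rle_lt_or_eq_dec _ _ (C3norm_pos h)) as [Hv|Hv].
  - assert (G := disc_lipschitz _ (r / C3norm h) M 0 1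
      (Rdiv_lt_0_compat _ _ Hr Hv) (ball_hol_slice F p r M h Hv H)).
    cbv beta in G. rewrite Cmod_0, Cmod_1 in G.
    replace (C3add p (C3scal 0 h)) with p in G by C3ring.
    replace (C3add p (C3scal 1 h)) with (C3add p h) in G by C3ring.
    replace (1 - 0)%C with (RtoC 1) in G by ring. rewrite Cmod_1 in G.
    replace (32 * M / r * C3norm h) with (32 * M / (r / C3norm h) * 1) by (field; lra).
    assert (1 <= r / C3norm h / 2).
    { apply (Rmult_le_reg_r (C3norm h)); [exact Hv|].
      replace (r / C3norm h / 2 * C3norm h) with (r / 2) by (field; lra). lra. }
    apply G; lra.
  - assert (E : h = C3zero) by (apply C3norm_eq_0; lra). subst h.
    replace (C3add p C3zero) with p by C3ring.
    replace (F p - F p)%C with (RtoC 0) by ring. rewrite Cmod_0, C3norm_zero. lra.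
Qed.

Lemma ball_hol_taylor F p r M L h : 0 < r -> ball_hol F p r M ->
  is_lin L -> fder F p L -> C3norm h <= r / 4 ->
  Cmod (F (C3add p h) - F p - L h)%C <= 2048 * M / r ^ 2 * C3norm h ^ 2.
Proof.
  intros Hr H HL HF Hh.
  destruct (Rle_lt_or_eq_dec _ _ (C3norm_pos h)) as [Hv|Hv].
  - assert (G := disc_taylor _ (r / C3norm h) M 1 (L h)
      (Rdiv_lt_0_compat _ _ Hr Hv) (ball_hol_slice F p r M h Hv H)).
    cbv beta in G. rewrite Cmod_1 in G.
    assert (1 <= r / C3norm h / 4).
    { apply (Rmult_le_reg_r (C3norm h)); [exact Hv|].
      replace (r / C3norm h / 4 * C3norm h) with (r / 4) by (field; lra). lra. }
    specialize (G H0).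
    replace (2048 * M / r ^ 2 * C3norm h ^ 2)
      with (2048 * M / (r / C3norm h) ^ 2 * 1 ^ 2) by (field; lra).
    replace (C3add p (C3scal 1 h)) with (C3add p h) in G by C3ring.
    replace (L h * 1)%C with (L h) in G by ring.
    assert (E : C3add p (C3scal 0 h) = p) by C3ring.
    rewrite E in G. apply G.
    apply fder_slice; [exact HL|]. now rewrite E.
  - assert (E : h = C3zero) by (apply C3norm_eq_0; lra). subst h.
    replace (C3add p C3zero) with p by C3ring.
    destruct (lin_bounded _ HL) as [K [_ B]].
    specialize (B C3zero). rewrite C3norm_zero, Rmult_0_r in B.
    replace (F p - F p - L C3zero)%C with (- L C3zero)%C by ring.
    rewrite Cmod_opp, C3norm_zero. simpl. lra.
Qed.

(** * Convergent sequences and limits of holomorphic functions *)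

Definition Cconv (u : nat -> C) (l : C) : Prop :=
  forall eps, 0 < eps -> exists N, forall n, (N <= n)%nat -> Cmod (u n - l)%C < eps.

Lemma Cconv_of_cauchy (u : nat -> C) :
  (forall eps, 0 < eps -> exists N, forall n m, (N <= n)%nat -> (N <= m)%nat ->
     Cmod (u n - u m)%C < eps) -> exists l, Cconv u l.
Proof.
  intros H.
  destruct (Rcomplete.R_complete (fun n => fst (u n))) as [x Hx].
  { intros eps Heps. destruct (H eps Heps) as [N HN]. exists N. intros n m Hn Hm.
    eapply Rle_lt_trans; [|apply (HN n m Hn Hm)].
    apply (fst_le_Cmod (u n - u m)%C). }
  destruct (Rcomplete.R_complete (fun n => snd (u n))) as [y Hy].
  { intros eps Heps. destruct (H eps Heps) as [N HN]. exists N. intros n m Hn Hm.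
    eapply Rle_lt_trans; [|apply (HN n m Hn Hm)].
    apply (snd_le_Cmod (u n - u m)%C). }
  exists (x, y). intros eps Heps.
  destruct (Hx (eps / 2) ltac:(lra)) as [N1 H1].
  destruct (Hy (eps / 2) ltac:(lra)) as [N2 H2].
  exists (Nat.max N1 N2). intros n Hn.
  eapply Rle_lt_trans; [apply Cmod_le_sum|].
  specialize (H1 n ltac:(lia)). specialize (H2 n ltac:(lia)).
  unfold Rdist in *. unfold Cminus, Cplus, Copp; simpl. unfold Rminus in *. lra.
Qed.

Lemma Cconv_bound (u : nat -> C) l w B : Cconv u l ->
  (exists N, forall n, (N <= n)%nat -> Cmod (u n - w)%C <= B) -> Cmod (l - w)%C <= B.
Proof.
  intros H [N0 HB]. apply Rnot_lt_le. intros Hlt.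
  destruct (H (Cmod (l - w)%C - B) ltac:(lra)) as [N HN].
  specialize (HN (Nat.max N N0) ltac:(lia)). specialize (HB (Nat.max N N0) ltac:(lia)).
  set (x := u (Nat.max N N0)) in *.
  assert (Cmod (l - w)%C <= Cmod (x - w)%C + Cmod (x - l)%C).
  { replace (l - w)%C with ((x - w) - (x - l))%C by ring. apply Cmod_sub_le. }
  lra.
Qed.

Lemma Cconv_plus u v l m : Cconv u l -> Cconv v m -> Cconv (fun n => u n + v n)%C (l + m)%C.
Proof.
  intros Hu Hv eps Heps.
  destruct (Hu (eps / 2) ltac:(lra)) as [N1 H1].
  destruct (Hv (eps / 2) ltac:(lra)) as [N2 H2].
  exists (Nat.max N1 N2). intros n Hn.
  specialize (H1 n ltac:(lia)). specialize (H2 n ltac:(lia)).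
  replace (u n + v n - (l + m))%C with ((u n - l) + (v n - m))%C by ring.
  eapply Rle_lt_trans; [apply Cmod_triangle|lra].
Qed.

Lemma Cconv_scal (k : C) u l : Cconv u l -> Cconv (fun n => k * u n)%C (k * l)%C.
Proof.
  intros Hu eps Heps. assert (Hk := Cmod_ge_0 k).
  destruct (Hu (eps / (Cmod k + 1))) as [N HN]; [apply Rdiv_lt_0_compat; lra|].
  exists N. intros n Hn. specialize (HN n Hn).
  replace (k * u n - k * l)%C with (k * (u n - l))%C by ring.
  rewrite Cmod_mult.
  apply (Rmult_lt_compat_r (Cmod k + 1)) in HN; [|lra].
  replace (eps / (Cmod k + 1) * (Cmod k + 1)) with eps in HN by (field; lra).
  generalize (Cmod_ge_0 (u n - l)%C). nra.
Qed.

Lemma Cconv_unique u l m : Cconv u l -> Cconv u m -> l = m.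
Proof.
  intros Hl Hm.
  assert (E : Cmod (l - m)%C <= 0).
  { apply Rnot_lt_le. intros Hlt.
    destruct (Hl (Cmod (l - m)%C / 2)) as [N1 H1]; [lra|].
    destruct (Hm (Cmod (l - m)%C / 2)) as [N2 H2]; [lra|].
    specialize (H1 (Nat.max N1 N2) ltac:(lia)). specialize (H2 (Nat.max N1 N2) ltac:(lia)).
    set (x := u (Nat.max N1 N2)) in *.
    assert (Cmod (l - m)%C <= Cmod (x - m)%C + Cmod (x - l)%C).
    { replace (l - m)%C with ((x - m) - (x - l))%C by ring. apply Cmod_sub_le. }
    lra. }
  assert (Cmod (l - m)%C = 0) by (apply Rle_antisym; [exact E|apply Cmod_ge_0]).
  apply Cmod_eq_0 in H. replace l with (l - m + m)%C by ring. rewrite H. ring.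
Qed.

(* The Taylor bound is uniform in n, so a derivative is approximated at a fixed step t
   by difference quotients, which converge; no uniformity in p is needed. *)
Lemma derivative_conv F r M p (L : nat -> C3 -> C) v : 0 < r ->
  (forall n, ball_hol (F n) p r M) ->
  (forall h, C3norm h < r -> exists l, Cconv (fun n => F n (C3add p h)) l) ->
  (forall n, is_lin (L n) /\ fder (F n) p (L n)) ->
  exists l, Cconv (fun n => L n v) l.
Proof.
  intros Hr Hol Hlim HL. apply Cconv_of_cauchy. intros eps Heps.
  set (K := 2048 * M / r ^ 2 * C3norm v ^ 2).
  assert (HM := ball_hol_pos _ _ _ _ Hr (Hol O)).
  assert (Hv := C3norm_pos v).
  assert (HK : 0 <= K).
  { apply Rmult_le_pos; [|apply pow2_ge_0].
    apply Rdiv_le_0_compat; [lra|apply pow_lt; lra]. }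
  (* The first bound makes each of the two Taylor errors at most t eps/4, the second keeps the step
     within r/4. Four errors t eps/8 from the values complete the budget t eps. *)
  set (t := Rmin (eps / (4 * (K + 1))) (r / 4 / (C3norm v + 1))).
  assert (Ht : 0 < t) by (apply Rmin_case; repeat apply Rdiv_lt_0_compat; lra).
  assert (Ht1 : t <= eps / (4 * (K + 1))) by apply Rmin_l.
  assert (Ht2 : t <= r / 4 / (C3norm v + 1)) by apply Rmin_r.
  clearbody t.
  assert (Et : Cmod (RtoC t) = t) by (rewrite Cmod_R; apply Rabs_pos_eq; lra).
  assert (Hn : C3norm (C3scal t v) <= r / 4).
  { rewrite C3norm_scal, Et.
    apply (Rmult_le_compat_r (C3norm v + 1)) in Ht2; [|lra].
    replace (r / 4 / (C3norm v + 1) * (C3norm v + 1)) with (r / 4) in Ht2 by (field; lra).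
    lra. }
  assert (T : forall n, Cmod (F n (C3add p (C3scal t v)) - F n p - t * L n v)%C <= K * t ^ 2).
  { intros n. destruct (HL n) as [H1 H2].
    assert (G := ball_hol_taylor (F n) p r M (L n) (C3scal t v) Hr (Hol n) H1 H2 Hn).
    rewrite (lin_scal _ _ _ H1), C3norm_scal, Et in G.
    unfold K. eapply Rle_trans; [exact G|right; ring]. }
  destruct (Hlim (C3scal t v) ltac:(lra)) as [l1 H1].
  destruct (Hlim C3zero ltac:(rewrite C3norm_zero; lra)) as [l0 H0].
  assert (He : 0 < t * eps / 8) by (apply Rdiv_lt_0_compat; [apply Rmult_lt_0_compat; lra|lra]).
  destruct (H1 _ He) as [N1 HN1]. destruct (H0 _ He) as [N0 HN0].
  exists (Nat.max N1 N0). intros n m Hnn Hm.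
  generalize (HN1 n ltac:(lia)) (HN1 m ltac:(lia)) (HN0 n ltac:(lia)) (HN0 m ltac:(lia))
    (T n) (T m).
  replace (C3add p C3zero) with p by C3ring.
  set (q := C3add p (C3scal t v)). intros a1 a2 a3 a4 a5 a6.
  apply (Rmult_lt_reg_l t); [exact Ht|]. rewrite <- Et at 1. rewrite <- Cmod_mult.
  replace (t * (L n v - L m v))%C with
   (((F n q - l1) - (F m q - l1)) - ((F n p - l0) - (F m p - l0))
    - ((F n q - F n p - t * L n v) - (F m q - F m p - t * L m v)))%C by ring.
  eapply Rle_lt_trans; [apply Cmod_sub_le|].
  eapply Rle_lt_trans; [apply Rplus_le_compat; [apply Cmod_sub_le|apply Cmod_sub_le]|].
  eapply Rle_lt_trans; [apply Rplus_le_compat_r, Rplus_le_compat; apply Cmod_sub_le|].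
  apply (Rmult_le_compat_r (4 * (K + 1))) in Ht1; [|lra].
  replace (eps / (4 * (K + 1)) * (4 * (K + 1))) with eps in Ht1 by (field; lra).
  assert (K * t ^ 2 <= t * (eps / 4)) by nra.
  nra.
Qed.

(** The Taylor inequality has the same constant for all [n], and both sides pass to the pointwise
    limit once the derivatives converge on the three basis vectors. The limit thus has a quadratic
    remainder at each point. *)
Lemma pointwise_limit_holomorphic F G r M :
  (forall n, ball_hol (F n) C3zero r M) ->
  (forall p, C3norm p < r -> Cconv (fun n => F n p) (G p)) ->
  ball_hol G C3zero r M.
Proof.
  intros Hol Hlim p Hp.
  replace (C3add C3zero p) with p by C3ring.
  split.
  { replace (G p) with (G p - 0)%C by ring. apply (Cconv_bound _ _ _ _ (Hlim p Hp)).
    exists O. intros n _. replace (F n p - 0)%C with (F n p) by ring.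
    replace p with (C3add C3zero p) by C3ring. now apply Hol. }
  set (rho := r - C3norm p). assert (Hrho : 0 < rho) by (unfold rho; lra).
  assert (Hin : forall h, C3norm h < rho -> C3norm (C3add p h) < r).
  { intros h Hh. eapply Rle_lt_trans; [apply C3norm_triangle|unfold rho in Hh; lra]. }
  assert (Hol' : forall n, ball_hol (F n) p rho M).
  { intros n h Hh. replace (C3add p h) with (C3add C3zero (C3add p h)) by C3ring.
    apply Hol, Hin, Hh. }
  assert (HL0 : forall n, exists L, is_lin L /\ fder (F n) p L).
  { intros n. destruct (Hol n p Hp) as [_ H].
    replace (C3add C3zero p) with p in H by C3ring. exact H. }
  destruct (functional_choice _ HL0) as [L HL].
  assert (HC : forall v, exists l, Cconv (fun n => L n v) l).
  { intros v. apply (derivative_conv F rho M p L v Hrho Hol'); [|exact HL].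
    intros h Hh. exists (G (C3add p h)). apply Hlim, Hin, Hh. }
  destruct (HC (RtoC 1, RtoC 0, RtoC 0)) as [a Ha].
  destruct (HC (RtoC 0, RtoC 1, RtoC 0)) as [b Hb].
  destruct (HC (RtoC 0, RtoC 0, RtoC 1)) as [c Hc].
  exists (Clin3 a b c). split; [apply is_lin_Clin3|].
  assert (HLv : forall v, Cconv (fun n => L n v) (Clin3 a b c v)).
  { intros v.
    assert (G0 := Cconv_plus _ _ _ _ (Cconv_scal (c3x v) _ _ Ha)
      (Cconv_plus _ _ _ _ (Cconv_scal (c3y v) _ _ Hb) (Cconv_scal (c3z v) _ _ Hc))).
    cbv beta in G0. intros eps Heps. destruct (G0 eps Heps) as [N HN].
    exists N. intros n Hn. specialize (HN n Hn).
    destruct (HL n) as [[a' [b' [c' E]]] _]. rewrite !E in HN. rewrite E.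
    eapply Rle_lt_trans; [|exact HN]. right. f_equal. clear. C3ring. }
  set (K := 2048 * M / rho ^ 2).
  assert (HM := ball_hol_pos _ _ _ _ Hrho (Hol' O)).
  assert (HK : 0 <= K).
  { apply Rdiv_le_0_compat; [lra|apply pow_lt; lra]. }
  assert (T : forall h, C3norm h <= rho / 4 ->
    Cmod (G (C3add p h) - G p - Clin3 a b c h)%C <= K * C3norm h ^ 2).
  { intros h Hh.
    assert (G1 := Cconv_plus _ _ _ _ (Hlim (C3add p h) (Hin h ltac:(lra)))
     (Cconv_scal (-(1))%C _ _ (Cconv_plus _ _ _ _ (Hlim p Hp) (HLv h)))).
    replace (G (C3add p h) - G p - Clin3 a b c h)%C
     with (G (C3add p h) + - (1) * (G p + Clin3 a b c h) - 0)%C by ring.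
    apply (Cconv_bound _ _ _ _ G1). exists O. intros n _.
    replace (F n (C3add p h) + - (1) * (F n p + L n h) - 0)%C
      with (F n (C3add p h) - F n p - L n h)%C by ring.
    apply (ball_hol_taylor (F n) p rho M); try apply HL; auto. }
  intros eps Heps.
  exists (Rmin (rho / 4) (eps / (K + 1))). split.
  { apply Rmin_case; [lra|apply Rdiv_lt_0_compat; lra]. }
  intros h Hh.
  assert (h1 := Rlt_le_trans _ _ _ Hh (Rmin_l _ _)).
  assert (h2 := Rlt_le_trans _ _ _ Hh (Rmin_r _ _)).
  eapply Rle_trans; [apply T; lra|].
  apply (Rmult_lt_compat_r (K + 1)) in h2; [|lra].
  replace (eps / (K + 1) * (K + 1)) with eps in h2 by (field; lra).
  generalize (C3norm_pos h). intros. nra.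
Qed.

(** * Linearization by Euler steps *)

Definition diag3 (a1 a2 a3 : C) (p : C3) : C3 :=
  ((a1 * c3x p)%C, (a2 * c3y p)%C, (a3 * c3z p)%C).

Definition euler (Y : C3 -> C3) (t : R) (p : C3) : C3 := C3add p (C3scal (RtoC t) (Y p)).

(** The squared modulus is (1 - t)^2 + t^2 y^2 with y the imaginary part of [a]. Squaring the right
    side produces the cross term 2 (1 - t) t^2 |a|^2, which dominates t^2 y^2 as soon as t is at
    most 1/2. *)
Lemma Cmod_euler_upper (a : C) t : fst a = -1 -> 0 <= t <= 1 / 2 ->
  Cmod (1 + RtoC t * a)%C <= 1 - t + t ^ 2 * Cmod a ^ 2.
Proof.
  intros Ha Ht. destruct a as [x y]; simpl in Ha; subst x.
  assert (Hy : y ^ 2 <= Cmod (-1, y) ^ 2).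
  { rewrite <- Rsqr_pow2, (Rsqr_abs y), Rsqr_pow2.
    apply pow_incr. split; [apply Rabs_pos|apply (snd_le_Cmod (-1, y))]. }
  set (N := Cmod (-1, y) ^ 2) in *.
  unfold Cmod at 1, RtoC, Cplus, Cmult; simpl.
  assert (0 <= y ^ 2) by apply pow2_ge_0.
  assert (0 <= t ^ 2) by apply pow2_ge_0.
  assert (Q : 0 <= t ^ 2 * N) by (apply Rmult_le_pos; lra).
  rewrite <- (sqrt_pow2 (1 - t + t * (t * 1) * N)).
  2: { replace (t * (t * 1)) with (t ^ 2) by ring. lra. }
  apply sqrt_le_1_alt.
  replace (t * (t * 1)) with (t ^ 2) by ring.
  assert (t ^ 2 * y ^ 2 <= t ^ 2 * N) by (apply Rmult_le_compat_l; lra).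
  nra.
Qed.

Lemma Cmod_euler_lower (a : C) t : fst a = -1 -> 1 - t <= Cmod (1 + RtoC t * a)%C.
Proof.
  intros Ha. eapply Rle_trans; [|apply fst_le_Cmod].
  eapply Rle_trans; [|apply Rle_abs]. right.
  unfold RtoC, Cplus, Cmult; simpl. rewrite Ha. ring.
Qed.

Lemma geometric_small (c q : R) : 0 <= q < 1 -> forall eps, 0 < eps ->
  exists N, forall n, (N <= n)%nat -> Rabs (c * q ^ n) < eps.
Proof.
  intros Hq eps Heps.
  destruct (pow_lt_1_zero q ltac:(rewrite Rabs_pos_eq; lra) (eps / (Rabs c + 1))) as [N HN].
  { apply Rdiv_lt_0_compat; [lra|]. generalize (Rabs_pos c); lra. }
  exists N. intros n Hn. specialize (HN n Hn).
  assert (Hc := Rabs_pos c).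
  rewrite Rabs_mult. apply (Rmult_lt_compat_r (Rabs c + 1)) in HN; [|lra].
  replace (eps / (Rabs c + 1) * (Rabs c + 1)) with eps in HN by (field; lra).
  generalize (Rabs_pos (q ^ n)). nra.
Qed.

Lemma Cconv_geometric (u : nat -> C) c q : 0 <= q < 1 ->
  (forall n, Cmod (u (S n) - u n)%C <= c * q ^ n) -> exists l, Cconv u l.
Proof.
  intros Hq Hu. apply Cconv_of_cauchy.
  assert (Hc : 0 <= c).
  { generalize (Hu O) (Cmod_ge_0 (u 1%nat - u O)%C). simpl. lra. }
  assert (T : forall n k, Cmod (u (n + k)%nat - u n)%C <= c / (1 - q) * q ^ n * (1 - q ^ k)).
  { intros n k. induction k as [|k IH].
    - rewrite Nat.add_0_r. replace (u n - u n)%C with (RtoC 0) by ring.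
      rewrite Cmod_0. simpl. lra.
    - rewrite Nat.add_succ_r.
      replace (u (S (n + k)) - u n)%C with
       ((u (S (n + k)) - u (n + k)%nat) + (u (n + k)%nat - u n))%C by ring.
      eapply Rle_trans; [apply Cmod_triangle|].
      generalize (Hu (n + k)%nat). rewrite pow_add. intros G.
      replace (c / (1 - q) * q ^ n * (1 - q ^ S k)) with
       (c * (q ^ n * q ^ k) + c / (1 - q) * q ^ n * (1 - q ^ k)) by (simpl; field; lra).
      lra. }
  assert (T' : forall n k, Cmod (u (n + k)%nat - u n)%C <= c / (1 - q) * q ^ n).
  { intros n k. eapply Rle_trans; [apply T|].
    assert (0 <= c / (1 - q) * q ^ n).
    { apply Rmult_le_pos; [apply Rdiv_le_0_compat; lra|apply pow_le; lra]. }
    assert (0 <= q ^ k) by (apply pow_le; lra). nra. }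
  intros eps Heps.
  destruct (geometric_small (c / (1 - q)) q Hq (eps / 2) ltac:(lra)) as [N HN].
  exists N. intros n m Hn Hm.
  specialize (HN N (Nat.le_refl N)).
  assert (H1 := T' N (n - N)%nat). assert (H2 := T' N (m - N)%nat).
  replace (N + (n - N))%nat with n in H1 by lia.
  replace (N + (m - N))%nat with m in H2 by lia.
  assert (HA := Rle_abs (c / (1 - q) * q ^ N)).
  replace (u n - u m)%C with ((u n - u N) - (u m - u N))%C by ring.
  eapply Rle_lt_trans; [apply Cmod_sub_le|lra].
Qed.

(** Stands in for letting the step size [t] tend to 0 in an inequality. *)
Lemma Rle_0_of_small x T d : 0 < d -> (forall t, 0 < t <= d -> x <= T * t) -> x <= 0.
Proof.
  intros Hd H. apply Rnot_lt_le. intros Hx.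
  assert (HT := Rabs_pos T). assert (HT' := Rle_abs T).
  assert (Q : 0 < x / (2 * (Rabs T + 1))) by (apply Rdiv_lt_0_compat; lra).
  set (t := Rmin d (x / (2 * (Rabs T + 1)))).
  assert (Ht : 0 < t) by (apply Rmin_case; lra).
  assert (Ht1 : t <= d) by apply Rmin_l.
  assert (Ht2 : t <= x / (2 * (Rabs T + 1))) by apply Rmin_r.
  apply (Rmult_le_compat_r (2 * (Rabs T + 1))) in Ht2; [|lra].
  replace (x / (2 * (Rabs T + 1)) * (2 * (Rabs T + 1))) with x in Ht2 by (field; lra).
  specialize (H t ltac:(lra)). nra.
Qed.

Lemma Cconv_shift u v (w : C) : (forall n, u n = v (S n)) -> Cconv v w -> Cconv u w.
Proof.
  intros E H eps Heps. destruct (H eps Heps) as [N HN]. exists N. intros n Hn.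
  rewrite E. apply HN. lia.
Qed.

Section Euler_iteration.
Variables (Y : C3 -> C3) (a1 a2 a3 : C) (K B r : R).
Hypotheses (Ha1 : fst a1 = -1) (Ha2 : fst a2 = -1) (Ha3 : fst a3 = -1).
Hypotheses (HB1 : Cmod a1 <= B) (HB2 : Cmod a2 <= B) (HB3 : Cmod a3 <= B) (HB : 1 <= B).
Hypotheses (HK : 0 <= K) (Hr : 0 < r) (HKr : K * r <= 1 / 16).
Hypothesis HY : forall p, C3norm p < r ->
  C3norm (C3sub (Y p) (diag3 a1 a2 a3 p)) <= K * C3norm p ^ 2.

(** Chosen so that the second-order term t^2 |a|^2 in |1 + t a| costs at most t/16. The nonlinear
    part costs another t/16 because [K * r <= 1 / 16], whence the rate 1 - 7t/8 of an Euler step. *)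
Definition max_step : R := 1 / (16 * B ^ 2).

Lemma max_step_bounds : 0 < max_step /\ max_step <= 1 / 16 /\ max_step * B ^ 2 = 1 / 16
  /\ max_step * B <= 1 / 16.
Proof.
  assert (1 <= B ^ 2) by nra.
  assert (E : max_step * B ^ 2 = 1 / 16) by (unfold max_step; field; lra).
  assert (0 < max_step) by (unfold max_step; apply Rdiv_lt_0_compat; lra).
  assert (0 <= max_step * (B - 1)) by (apply Rmult_le_pos; lra).
  assert (0 <= max_step * B * (B - 1)).
  { apply Rmult_le_pos; [apply Rmult_le_pos; lra|lra]. }
  repeat split; try lra; nra.
Qed.

Lemma diag3_norm_euler t p : 0 <= t <= max_step ->
  C3norm (C3add p (C3scal (RtoC t) (diag3 a1 a2 a3 p))) <= (1 - t + t / 16) * C3norm p.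
Proof.
  intros Ht. destruct max_step_bounds as [M0 [M1 [M2 M3]]].
  assert (E : forall a w, fst a = -1 -> Cmod a <= B -> Cmod w <= C3norm p ->
     Cmod (w + RtoC t * (a * w))%C <= (1 - t + t / 16) * C3norm p).
  { intros a w Ha HaB Hw.
    replace (w + RtoC t * (a * w))%C with ((1 + RtoC t * a) * w)%C by ring.
    rewrite Cmod_mult. apply Rmult_le_compat; try apply Cmod_ge_0; [|exact Hw].
    eapply Rle_trans; [apply Cmod_euler_upper; [exact Ha|lra]|].
    apply Rplus_le_compat_l.
    replace (t ^ 2 * Cmod a ^ 2) with (t * (t * Cmod a ^ 2)) by ring.
    replace (t / 16) with (t * (1 / 16)) by field.
    apply Rmult_le_compat_l; [lra|].
    rewrite <- M2. apply Rmult_le_compat; [lra|apply pow2_ge_0|lra|].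
    apply pow_incr. split; [apply Cmod_ge_0|exact HaB]. }
  apply C3norm_le; unfold C3add, C3scal, diag3; [apply (E a1)|apply (E a2)|apply (E a3)];
    try assumption; [apply C3norm_x|apply C3norm_y|apply C3norm_z].
Qed.

Lemma euler_norm t p : 0 <= t <= max_step -> C3norm p < r ->
  C3norm (euler Y t p) <= (1 - 7 / 8 * t) * C3norm p.
Proof.
  intros Ht Hp. unfold euler.
  replace (C3add p (C3scal (RtoC t) (Y p))) with
   (C3add (C3add p (C3scal (RtoC t) (diag3 a1 a2 a3 p)))
      (C3scal (RtoC t) (C3sub (Y p) (diag3 a1 a2 a3 p))))
   by (generalize (Y p), (diag3 a1 a2 a3 p); clear; intros; C3ring).
  eapply Rle_trans; [apply C3norm_triangle|].
  rewrite C3norm_scal, Cmod_R, Rabs_pos_eq by lra.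
  assert (H1 := diag3_norm_euler t p Ht). assert (H2 := HY p Hp).
  assert (Hp0 := C3norm_pos p).
  assert (K * C3norm p <= 1 / 16).
  { eapply Rle_trans; [|exact HKr]. apply Rmult_le_compat_l; lra. }
  assert (t * C3norm (C3sub (Y p) (diag3 a1 a2 a3 p)) <= t * (1 / 16 * C3norm p)).
  { apply Rmult_le_compat_l; [lra|]. eapply Rle_trans; [exact H2|].
    replace (K * C3norm p ^ 2) with (K * C3norm p * C3norm p) by ring.
    apply Rmult_le_compat_r; lra. }
  lra.
Qed.

Lemma euler_ball t p rho : 0 <= t <= max_step -> rho <= r -> C3norm p < rho ->
  C3norm (euler Y t p) < rho.
Proof.
  intros Ht Hrho Hp. eapply Rle_lt_trans; [apply euler_norm; lra|].
  assert (Hp0 := C3norm_pos p). nra.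
Qed.

Lemma field_norm p : C3norm p < r -> C3norm (Y p) <= (B + 1) * C3norm p.
Proof.
  intros Hp. assert (Hp0 := C3norm_pos p).
  replace (Y p) with (C3add (diag3 a1 a2 a3 p) (C3sub (Y p) (diag3 a1 a2 a3 p)))
   by (generalize (Y p), (diag3 a1 a2 a3 p); clear; intros; C3ring).
  eapply Rle_trans; [apply C3norm_triangle|].
  assert (C3norm (diag3 a1 a2 a3 p) <= B * C3norm p).
  { assert (E : forall a w, Cmod a <= B -> Cmod w <= C3norm p ->
      Cmod (a * w)%C <= B * C3norm p).
    { intros a w H1 H2. rewrite Cmod_mult.
      apply Rmult_le_compat; try apply Cmod_ge_0; assumption. }
    apply C3norm_le; unfold diag3; apply E; try assumption;
      [apply C3norm_x|apply C3norm_y|apply C3norm_z]. }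
  assert (H2 := HY p Hp).
  assert (K * C3norm p <= 1 / 16).
  { eapply Rle_trans; [|exact HKr]. apply Rmult_le_compat_l; lra. }
  nra.
Qed.

Section Coordinate.
(** Abstracts a coordinate function together with its eigenvalue, so that one argument serves x, y
    and z. *)
Variables (l : C3 -> C) (a : C).
Hypotheses (Hlin : is_lin l) (Hl1 : forall p, Cmod (l p) <= C3norm p).
Hypotheses (Hla : forall p, l (diag3 a1 a2 a3 p) = (a * l p)%C) (Ha : fst a = -1).

Lemma euler_factor_bound t : 0 <= t <= max_step ->
  (1 + RtoC t * a)%C <> RtoC 0 /\ Cmod (/ (1 + RtoC t * a))%C <= / (1 - t)
  /\ Cmod (/ (1 + RtoC t * a))%C <= 2.
Proof.
  intros Ht. destruct max_step_bounds as [M0 [M1 _]].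
  assert (L := Cmod_euler_lower a t Ha).
  assert (N0 : (1 + RtoC t * a)%C <> RtoC 0).
  { apply Cmod_gt_0. lra. }
  assert (H : Cmod (/ (1 + RtoC t * a))%C <= / (1 - t)).
  { rewrite Cmod_inv by exact N0. apply Rinv_le_contravar; lra. }
  repeat split; [exact N0|exact H|].
  eapply Rle_trans; [exact H|]. replace 2 with (/ (1 / 2)) by field.
  apply Rinv_le_contravar; lra.
Qed.

(* The squared contraction rate [(1 - 7/8 t)^2] of an Euler step beats the expansion rate
   [1 / (1 - t)] of the inverse multiplier. *)
Lemma euler_contraction (w : C3 -> C) W rho t : 0 <= t <= max_step -> rho <= r -> 0 <= W ->
  (forall p, C3norm p < rho -> Cmod (w p) <= W * C3norm p ^ 2) ->
  forall p, C3norm p < rho ->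
    Cmod (/ (1 + RtoC t * a) * w (euler Y t p))%C <= (1 - t / 2) * W * C3norm p ^ 2.
Proof.
  intros Ht Hrho HW Hw p Hp.
  destruct (euler_factor_bound t Ht) as [N0 [F1 _]].
  destruct max_step_bounds as [M0 [M1 _]].
  assert (Hp0 := C3norm_pos p).
  assert (G := Hw _ (euler_ball t p rho Ht Hrho Hp)).
  assert (N := euler_norm t p Ht ltac:(lra)).
  rewrite Cmod_mult.
  apply Rle_trans with (/ (1 - t) * (W * ((1 - 7 / 8 * t) * C3norm p) ^ 2)).
  - apply Rmult_le_compat; try apply Cmod_ge_0; [exact F1|].
    eapply Rle_trans; [exact G|]. apply Rmult_le_compat_l; [exact HW|].
    apply pow_incr. split; [apply C3norm_pos|exact N].
  - apply (Rmult_le_reg_l (1 - t)); [lra|].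
    replace ((1 - t) * (/ (1 - t) * (W * ((1 - 7 / 8 * t) * C3norm p) ^ 2)))
      with ((1 - 7 / 8 * t) ^ 2 * (W * C3norm p ^ 2)) by (field; lra).
    replace ((1 - t) * ((1 - t / 2) * W * C3norm p ^ 2))
      with ((1 - t) * (1 - t / 2) * (W * C3norm p ^ 2)) by ring.
    (* What remains is (1 - 7t/8)^2 <= (1 - t)(1 - t/2), that is 17 t^2/64 <= t/4. *)
    apply Rmult_le_compat_r.
    + apply Rmult_le_pos; [exact HW|apply pow2_ge_0].
    + nra.
Qed.

(** [w] equals its transform by the operator of norm [1 - t/2] plus an error of size 2e, so
    iteration gives at most the geometric sum 2e / (t/2). The a priori constant [W] is multiplied by
    (1 - t/2)^n and disappears. The division by [t] is why defects must be small compared with the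
    step. *)
Lemma euler_defect_bound (w : C3 -> C) W e rho t : 0 < t <= max_step -> rho <= r ->
  0 <= W -> 0 <= e ->
  (forall p, C3norm p < rho -> Cmod (w p) <= W * C3norm p ^ 2) ->
  (forall p, C3norm p < rho ->
    Cmod (w (euler Y t p) - (1 + RtoC t * a) * w p)%C <= e * C3norm p ^ 2) ->
  forall p, C3norm p < rho -> Cmod (w p) <= 4 * e / t * C3norm p ^ 2.
Proof.
  intros Ht Hrho HW He Hw Hd.
  destruct (euler_factor_bound t ltac:(lra)) as [N0 [_ F2]].
  destruct max_step_bounds as [M0 [M1 _]].
  assert (Hd' : forall p, C3norm p < rho ->
    Cmod (w p - / (1 + RtoC t * a) * w (euler Y t p))%C <= 2 * e * C3norm p ^ 2).
  { intros p Hp.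
    replace (w p - / (1 + RtoC t * a) * w (euler Y t p))%C with
     (- (/ (1 + RtoC t * a) * (w (euler Y t p) - (1 + RtoC t * a) * w p)))%C
     by (field; exact N0).
    rewrite Cmod_opp, Cmod_mult, Rmult_assoc.
    apply Rmult_le_compat; try apply Cmod_ge_0; [exact F2|now apply Hd]. }
  assert (E0 : 0 <= 4 * e / t) by (apply Rdiv_le_0_compat; lra).
  assert (It : forall n p, C3norm p < rho ->
    Cmod (w p) <= (W * (1 - t / 2) ^ n + 4 * e / t) * C3norm p ^ 2).
  { induction n as [|n IH]; intros p Hp.
    - eapply Rle_trans; [now apply Hw|]. apply Rmult_le_compat_r; [apply pow2_ge_0|].
      simpl. lra.
    - assert (P : 0 <= W * (1 - t / 2) ^ n).
      { apply Rmult_le_pos; [exact HW|apply pow_le; lra]. }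
      assert (C := euler_contraction w _ rho t ltac:(lra) Hrho
        (Rplus_le_le_0_compat _ _ P E0) IH p Hp).
      replace (w p) with ((w p - / (1 + RtoC t * a) * w (euler Y t p))
        + / (1 + RtoC t * a) * w (euler Y t p))%C by ring.
      eapply Rle_trans; [apply Cmod_triangle|].
      assert (D := Hd' p Hp).
      replace ((W * (1 - t / 2) ^ S n + 4 * e / t) * C3norm p ^ 2)
       with (2 * e * C3norm p ^ 2
          + (1 - t / 2) * (W * (1 - t / 2) ^ n + 4 * e / t) * C3norm p ^ 2)
       by (simpl; field; lra).
      lra. }
  intros p Hp. apply Rnot_lt_le. intros Hlt.
  assert (Hp2 : 0 <= C3norm p ^ 2) by apply pow2_ge_0.
  destruct (geometric_small (W * C3norm p ^ 2) (1 - t / 2) ltac:(lra)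
    (Cmod (w p) - 4 * e / t * C3norm p ^ 2) ltac:(lra)) as [N HN].
  specialize (HN N (Nat.le_refl N)). specialize (It N p Hp).
  assert (HA := Rle_abs (W * C3norm p ^ 2 * (1 - t / 2) ^ N)). nra.
Qed.

Hypothesis HYhol : forall p, C3norm p < r -> has_vder Y p.

Lemma euler_vder t p : C3norm p < r -> has_vder (euler Y t) p.
Proof.
  intros Hp. destruct (HYhol p Hp) as [D [[L1 [L2 L3]] [V1 [V2 V3]]]].
  destruct is_lin_coord as [Cx [Cy Cz]].
  exists (fun v => C3add v (C3scal (RtoC t) (D v))). split; [split; [|split]|split; [|split]].
  - exact (is_lin_plus_scal _ _ (RtoC t) Cx L1).
  - exact (is_lin_plus_scal _ _ (RtoC t) Cy L2).
  - exact (is_lin_plus_scal _ _ (RtoC t) Cz L3).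
  - exact (fder_plus_scal _ _ _ _ _ (RtoC t) (fder_lin _ p Cx) V1).
  - exact (fder_plus_scal _ _ _ _ _ (RtoC t) (fder_lin _ p Cy) V2).
  - exact (fder_plus_scal _ _ _ _ _ (RtoC t) (fder_lin _ p Cz) V3).
Qed.

(** The Koenigs sequence: [l] composed with n Euler steps, divided by (1 + t a)^n. *)
Fixpoint euler_iter (t : R) (n : nat) : C3 -> C :=
  match n with
  | O => l
  | S n => fun p => (/ (1 + RtoC t * a) * euler_iter t n (euler Y t p))%C
  end.

Lemma euler_coordinate_defect t p : 0 <= t <= max_step -> C3norm p < r ->
  Cmod (/ (1 + RtoC t * a) * (l (euler Y t p) - (1 + RtoC t * a) * l p))%C
    <= 2 * t * K * C3norm p ^ 2.
Proof.
  intros Ht Hp. destruct (euler_factor_bound t Ht) as [N0 [_ F2]].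
  unfold euler. rewrite (lin_add l _ _ Hlin), (lin_scal l _ _ Hlin).
  replace (l p + t * l (Y p) - (1 + t * a) * l p)%C with (t * (l (Y p) - a * l p))%C by ring.
  rewrite <- Hla, <- (lin_sub l _ _ Hlin).
  rewrite !Cmod_mult, Cmod_R, Rabs_pos_eq by lra.
  replace (2 * t * K * C3norm p ^ 2) with (2 * (t * (K * C3norm p ^ 2))) by ring.
  apply Rmult_le_compat; try apply Cmod_ge_0; [|exact F2|].
  - apply Rmult_le_pos; [lra|apply Cmod_ge_0].
  - apply Rmult_le_compat_l; [lra|]. eapply Rle_trans; [apply Hl1|now apply HY].
Qed.

(** The constant 4K is the fixed point of W -> (1 - t/2) W + 2 t K. Being independent of both [n]
    and [t], the bound survives the two limits to come. *)
Lemma euler_iter_tangent t n : 0 <= t <= max_step -> forall p, C3norm p < r ->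
  Cmod (euler_iter t n p - l p)%C <= 4 * K * C3norm p ^ 2.
Proof.
  intros Ht. induction n as [|n IH]; intros p Hp; simpl euler_iter.
  - replace (l p - l p)%C with (RtoC 0) by ring. rewrite Cmod_0.
    apply Rmult_le_pos; [lra|apply pow2_ge_0].
  - destruct (euler_factor_bound t Ht) as [N0 _].
    replace (/ (1 + t * a) * euler_iter t n (euler Y t p) - l p)%C with
      (/ (1 + t * a) * (euler_iter t n (euler Y t p) - l (euler Y t p))
       + / (1 + t * a) * (l (euler Y t p) - (1 + t * a) * l p))%C by (field; exact N0).
    eapply Rle_trans; [apply Cmod_triangle|].
    assert (C := euler_contraction (fun q => euler_iter t n q - l q)%C (4 * K) r t Ht
       (Rle_refl r) ltac:(lra) IH p Hp).
    cbv beta in C.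
    assert (D := euler_coordinate_defect t p Ht Hp). lra.
Qed.

Lemma euler_iter_step t n : 0 <= t <= max_step -> forall p, C3norm p < r ->
  Cmod (euler_iter t (S n) p - euler_iter t n p)%C
    <= 2 * t * K * (1 - t / 2) ^ n * C3norm p ^ 2.
Proof.
  intros Ht. destruct max_step_bounds as [M0 [M1 _]].
  destruct (euler_factor_bound t Ht) as [N0 _].
  induction n as [|n IH]; intros p Hp.
  - simpl euler_iter.
    replace (/ (1 + t * a) * l (euler Y t p) - l p)%C with
      (/ (1 + t * a) * (l (euler Y t p) - (1 + t * a) * l p))%C by (field; exact N0).
    rewrite pow_O, Rmult_1_r. now apply euler_coordinate_defect.
  - assert (P : 0 <= 2 * t * K * (1 - t / 2) ^ n).
    { repeat apply Rmult_le_pos; try lra. apply pow_le; lra. }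
    assert (C := euler_contraction _ _ r t Ht (Rle_refl r) P IH p Hp).
    cbv beta in C.
    replace (euler_iter t (S (S n)) p - euler_iter t (S n) p)%C with
     (/ (1 + t * a) * (euler_iter t (S n) (euler Y t p) - euler_iter t n (euler Y t p)))%C
     by (simpl; ring).
    eapply Rle_trans; [exact C|]. simpl. right; ring.
Qed.

Lemma euler_iter_hol t n : 0 <= t <= max_step ->
  ball_hol (euler_iter t n) C3zero r (r + 4 * K * r ^ 2).
Proof.
  intros Ht p0 Hp0. replace (C3add C3zero p0) with p0 by C3ring.
  split.
  - replace (euler_iter t n p0) with ((euler_iter t n p0 - l p0) + l p0)%C by ring.
    eapply Rle_trans; [apply Cmod_triangle|].
    assert (T := euler_iter_tangent t n Ht p0 Hp0).
    assert (G := Hl1 p0). assert (P := C3norm_pos p0).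
    assert (C3norm p0 ^ 2 <= r ^ 2) by (apply pow_incr; lra).
    assert (4 * K * C3norm p0 ^ 2 <= 4 * K * r ^ 2) by (apply Rmult_le_compat_l; lra).
    lra.
  - revert p0 Hp0. induction n as [|n IH]; intros p Hp; simpl euler_iter.
    + exists l. split; [exact Hlin|now apply fder_lin].
    + apply (has_fder_scal (fun q => euler_iter t n (euler Y t q))).
      apply has_fder_comp.
      * apply IH. now apply euler_ball.
      * now apply euler_vder.
Qed.

Lemma euler_linearization t : 0 < t <= max_step -> exists H : C3 -> C,
  ball_hol H C3zero r (r + 4 * K * r ^ 2) /\
  (forall p, C3norm p < r -> Cmod (H p - l p)%C <= 4 * K * C3norm p ^ 2) /\
  (forall p, C3norm p < r -> H (euler Y t p) = ((1 + RtoC t * a) * H p)%C).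
Proof.
  intros Ht. destruct max_step_bounds as [M0 [M1 _]].
  assert (Ht' : 0 <= t <= max_step) by lra.
  assert (Hex : forall p, exists w, C3norm p < r -> Cconv (fun n => euler_iter t n p) w).
  { intros p. destruct (Rlt_dec (C3norm p) r) as [Hp|Hp]; [|exists (RtoC 0); contradiction].
    destruct (Cconv_geometric (fun n => euler_iter t n p)
       (2 * t * K * C3norm p ^ 2) (1 - t / 2) ltac:(lra)) as [w Hw].
    - intros n. eapply Rle_trans; [now apply euler_iter_step|right; ring].
    - now exists w. }
  destruct (functional_choice _ Hex) as [H HH].
  exists H. split; [|split].
  - apply (pointwise_limit_holomorphic (euler_iter t)); [|exact HH].
    intros n. now apply euler_iter_hol.
  - intros p Hp. apply (Cconv_bound _ _ _ _ (HH p Hp)).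
    exists O. intros n _. now apply euler_iter_tangent.
  - intros p Hp. destruct (euler_factor_bound t Ht') as [N0 _].
    assert (C1 := HH _ (euler_ball t p r Ht' (Rle_refl r) Hp)).
    assert (C2 := Cconv_scal (1 + t * a) _ _ (HH p Hp)).
    apply (Cconv_unique (fun n => euler_iter t n (euler Y t p))); [exact C1|].
    (* Evaluating the n-th iterate after an Euler step is [1 + t a] times the iterate of index n +
       1, so the functional equation is an index shift in the limit. *)
    apply Cconv_shift with (2 := C2).
    intros n. simpl. field. exact N0.
Qed.

Lemma field_step t p : 0 <= t <= max_step -> C3norm p < r / 2 ->
  C3norm (C3scal (RtoC t) (Y p)) <= t * ((B + 1) * C3norm p) /\
  C3norm (C3scal (RtoC t) (Y p)) <= r / 2 / 4.
Proof.
  intros Ht Hp. destruct max_step_bounds as [M0 [M1 [M2 M3]]].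
  assert (Hp0 := C3norm_pos p).
  rewrite C3norm_scal, Cmod_R, Rabs_pos_eq by lra.
  assert (N := field_norm p ltac:(lra)).
  assert (S : t * C3norm (Y p) <= t * ((B + 1) * C3norm p)) by (apply Rmult_le_compat_l; lra).
  split; [exact S|].
  assert (T : t * (B + 1) <= 1 / 8).
  { assert (t * B <= max_step * B) by (apply Rmult_le_compat_r; lra). lra. }
  assert (t * (B + 1) * C3norm p <= 1 / 8 * C3norm p) by (apply Rmult_le_compat_r; lra).
  lra.
Qed.

(** Both squares matter: [t^2] leaves a factor [t] after the division in [euler_defect_bound], and
    [|p|^2], available because |Y(p)| is at most (B + 1) |p|, fits the weighted size for which the
    iteration contracts. *)
Lemma taylor_along_field H M p L t : ball_hol H C3zero r M -> C3norm p < r / 2 ->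
  is_lin L -> fder H p L -> 0 <= t <= max_step ->
  Cmod (H (euler Y t p) - H p - RtoC t * L (Y p))%C
    <= 2048 * M / (r / 2) ^ 2 * (B + 1) ^ 2 * t ^ 2 * C3norm p ^ 2.
Proof.
  intros HH Hp HL HF Ht.
  destruct (field_step t p Ht Hp) as [S1 S2].
  assert (HM := ball_hol_pos _ _ _ _ Hr HH).
  rewrite <- (lin_scal L _ _ HL). unfold euler.
  eapply Rle_trans.
  - apply (ball_hol_taylor H p (r / 2) M); try assumption; [lra|].
    now apply ball_hol_recenter.
  - replace (2048 * M / (r / 2) ^ 2 * (B + 1) ^ 2 * t ^ 2 * C3norm p ^ 2)
     with (2048 * M / (r / 2) ^ 2 * (t * ((B + 1) * C3norm p)) ^ 2) by ring.
    apply Rmult_le_compat_l.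
    + apply Rdiv_le_0_compat; [lra|]. apply pow_lt; lra.
    + apply pow_incr. split; [apply C3norm_pos|exact S1].
Qed.

(** An infinitesimal eigenfunction is one for Euler steps up to [T t^2 |p|^2]; [euler_defect_bound]
    turns this into |w(p)| <= 4 T t |p|^2 for every small [t]. This gives the uniqueness of the
    center manifold. *)
Lemma eigenfunction_vanishes w W M :
  ball_hol w C3zero r M -> 0 <= W ->
  (forall p, C3norm p < r -> Cmod (w p) <= W * C3norm p ^ 2) ->
  (forall p L, C3norm p < r -> is_lin L -> fder w p L -> L (Y p) = (a * w p)%C) ->
  forall p, C3norm p < r / 2 -> w p = RtoC 0.
Proof.
  intros Hw HW Hb HL p Hp.
  destruct max_step_bounds as [M0 [M1 _]].
  assert (HM := ball_hol_pos _ _ _ _ Hr Hw).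
  set (T := 2048 * M / (r / 2) ^ 2 * (B + 1) ^ 2).
  assert (HT : 0 <= T).
  { apply Rmult_le_pos; [|apply pow2_ge_0].
    apply Rdiv_le_0_compat; [lra|]. apply pow_lt; lra. }
  apply Cmod_eq_0. apply Rle_antisym; [|apply Cmod_ge_0].
  apply (Rle_0_of_small _ (4 * T * C3norm p ^ 2) max_step M0). intros t Ht.
  replace (4 * T * C3norm p ^ 2 * t) with (4 * (T * t ^ 2) / t * C3norm p ^ 2)
    by (field; lra).
  apply (euler_defect_bound w W (T * t ^ 2) (r / 2) t); try assumption; try lra.
  - apply Rmult_le_pos; [exact HT|apply pow2_ge_0].
  - intros q Hq. apply Hb; lra.
  - intros q Hq. destruct (Hw q ltac:(lra)) as [_ [L [HL1 HL2]]].
    replace (C3add C3zero q) with q in HL2 by C3ring.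
    assert (G := taylor_along_field w M q L t Hw Hq HL1 HL2 ltac:(lra)).
    rewrite (HL q L ltac:(lra) HL1 HL2) in G.
    replace (w (euler Y t q) - (1 + t * a) * w q)%C
     with (w (euler Y t q) - w q - t * (a * w q))%C by ring.
    exact G.
Qed.

(* The linearizations for two steps are compared on Euler steps much shorter than both, on
   which each of them is almost an eigenfunction. *)
Theorem linearizing_coordinate : exists (H : C3 -> C),
  ball_hol H C3zero (r / 2) (r + 4 * K * r ^ 2) /\
  (forall p, C3norm p < r / 2 -> Cmod (H p - l p)%C <= 4 * K * C3norm p ^ 2) /\
  (forall p L, C3norm p < r / 2 -> is_lin L -> fder H p L -> L (Y p) = (a * H p)%C).
Proof.
  destruct max_step_bounds as [M0 [M1 _]].
  set (M := r + 4 * K * r ^ 2).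
  assert (HM : 0 <= M).
  { unfold M. assert (0 <= K * r ^ 2) by (apply Rmult_le_pos; [lra|apply pow2_ge_0]). lra. }
  set (T := 2048 * M / (r / 2) ^ 2 * (B + 1) ^ 2).
  assert (HT : 0 <= T).
  { apply Rmult_le_pos; [|apply pow2_ge_0].
    apply Rdiv_le_0_compat; [lra|]. apply pow_lt; lra. }
  set (d := fun n : nat => max_step / (INR n + 1)).
  assert (Hd : forall n, 0 < d n <= max_step).
  { intros n. assert (Hn := pos_INR n). unfold d. split.
    - apply Rdiv_lt_0_compat; lra.
    - apply (Rmult_le_reg_r (INR n + 1)); [lra|].
      replace (max_step / (INR n + 1) * (INR n + 1)) with max_step by (field; lra). nra. }
  assert (Hd0 : forall eps, 0 < eps -> exists N, forall n, (N <= n)%nat -> d n < eps).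
  { intros eps Heps. destruct (INR_unbounded (max_step / eps)) as [N HN].
    exists N. intros n Hn. apply le_INR in Hn. unfold d.
    assert (Q : 0 < max_step / eps) by (apply Rdiv_lt_0_compat; lra).
    apply (Rmult_lt_reg_r (INR n + 1)); [lra|].
    replace (max_step / (INR n + 1) * (INR n + 1)) with (eps * (max_step / eps))
      by (field; lra).
    apply Rmult_lt_compat_l; lra. }
  destruct (functional_choice _ (fun n => euler_linearization (d n) (Hd n))) as [H HH].
  (* [H n] is an exact eigenfunction for its own step [d n]. Taylor at that step, divided by [d n],
     shows that it satisfies the differential equation up to [T * d n]; Taylor at the step [t] then
     adds [T * t ^ 2]. *)
  assert (Def : forall n t p, 0 < t <= max_step -> C3norm p < r / 2 ->
    Cmod (H n (euler Y t p) - (1 + RtoC t * a) * H n p)%C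
      <= (T * t ^ 2 + t * (T * d n)) * C3norm p ^ 2).
  { intros n t p Ht Hp. destruct (HH n) as [Hol [Htan Heq]].
    destruct (Hol p ltac:(lra)) as [_ [L [HL1 HL2]]].
    replace (C3add C3zero p) with p in HL2 by C3ring.
    assert (G1 := taylor_along_field _ _ p L (d n) Hol Hp HL1 HL2
       ltac:(destruct (Hd n); lra)).
    fold M in G1. fold T in G1. rewrite (Heq p ltac:(lra)) in G1.
    replace ((1 + d n * a) * H n p - H n p - d n * L (Y p))%C
      with (d n * (a * H n p - L (Y p)))%C in G1 by ring.
    rewrite Cmod_mult, Cmod_R, Rabs_pos_eq in G1 by (destruct (Hd n); lra).
    assert (G2 : Cmod (a * H n p - L (Y p))%C <= T * d n * C3norm p ^ 2).
    { apply (Rmult_le_reg_l (d n)); [apply Hd|]. lra. }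
    assert (G3 := taylor_along_field _ _ p L t Hol Hp HL1 HL2 ltac:(lra)).
    fold M in G3. fold T in G3.
    replace (H n (euler Y t p) - (1 + t * a) * H n p)%C with
     ((H n (euler Y t p) - H n p - t * L (Y p)) - t * (a * H n p - L (Y p)))%C by ring.
    eapply Rle_trans; [apply Cmod_sub_le|].
    rewrite Cmod_mult, Cmod_R, Rabs_pos_eq by lra.
    assert (t * Cmod (a * H n p - L (Y p))%C <= t * (T * d n * C3norm p ^ 2))
      by (apply Rmult_le_compat_l; lra).
    lra. }
  (* The difference is quadratically small with constant 8K, and its defect divided by [t] gives 8 T
     t + 4 T (d n + d m); only the second term remains as [t] tends to 0. *)
  assert (Cmp : forall n m p, C3norm p < r / 2 ->
    Cmod (H n p - H m p)%C <= 4 * T * (d n + d m) * C3norm p ^ 2).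
  { intros n m p Hp.
    assert (Hp2 : 0 <= C3norm p ^ 2) by apply pow2_ge_0.
    apply Rminus_le.
    apply (Rle_0_of_small _ (8 * T * C3norm p ^ 2) max_step M0). intros t Ht.
    assert (Hn := Hd n). assert (Hm := Hd m).
    assert (E0 : 0 <= 2 * T * t ^ 2 + t * T * (d n + d m)).
    { assert (0 <= t ^ 2) by apply pow2_ge_0.
      assert (0 <= T * t ^ 2) by (apply Rmult_le_pos; lra).
      assert (0 <= t * T) by (apply Rmult_le_pos; lra).
      assert (0 <= t * T * (d n + d m)) by (apply Rmult_le_pos; lra). lra. }
    assert (G := euler_defect_bound (fun q => H n q - H m q)%C (8 * K)
      (2 * T * t ^ 2 + t * T * (d n + d m)) (r / 2) t Ht ltac:(lra) ltac:(lra) E0).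
    cbv beta in G.
    eapply Rle_trans; [apply Rplus_le_compat_r, G; [| |exact Hp]|].
    - intros q Hq. destruct (HH n) as [_ [Tn _]]. destruct (HH m) as [_ [Tm _]].
      replace (H n q - H m q)%C with ((H n q - l q) - (H m q - l q))%C by ring.
      eapply Rle_trans; [apply Cmod_sub_le|].
      generalize (Tn q ltac:(lra)) (Tm q ltac:(lra)). lra.
    - intros q Hq. generalize (Def n t q Ht Hq) (Def m t q Ht Hq). intros D1 D2.
      replace (H n (euler Y t q) - H m (euler Y t q) - (1 + t * a) * (H n q - H m q))%C
       with ((H n (euler Y t q) - (1 + t * a) * H n q)
             - (H m (euler Y t q) - (1 + t * a) * H m q))%C by ring.
      eapply Rle_trans; [apply Cmod_sub_le|]. lra.
    - right. field. lra. }
  assert (Hex : forall p, exists w, C3norm p < r / 2 -> Cconv (fun n => H n p) w).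
  { intros p. destruct (Rlt_dec (C3norm p) (r / 2)) as [Hp|Hp];
      [|exists (RtoC 0); contradiction].
    destruct (Cconv_of_cauchy (fun n => H n p)) as [w Hw]; [|now exists w].
    intros eps Heps.
    assert (Hp2 : 0 <= C3norm p ^ 2) by apply pow2_ge_0.
    set (Q := 4 * T * C3norm p ^ 2).
    assert (HQ : 0 <= Q) by (apply Rmult_le_pos; [lra|exact Hp2]).
    destruct (Hd0 (eps / (2 * (Q + 1)))) as [N HN]; [apply Rdiv_lt_0_compat; lra|].
    exists N. intros n m Hn Hm. eapply Rle_lt_trans; [now apply Cmp|].
    generalize (HN n Hn) (HN m Hm). destruct (Hd n) as [P1 _]. destruct (Hd m) as [P2 _].
    intros G1 G2.
    replace (4 * T * (d n + d m) * C3norm p ^ 2) with (Q * (d n + d m)) by (unfold Q; ring).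
    assert (G : d n + d m < eps / (Q + 1)).
    { replace (eps / (Q + 1)) with (2 * (eps / (2 * (Q + 1)))) by (field; lra). lra. }
    apply (Rmult_lt_compat_r (Q + 1)) in G; [|lra].
    replace (eps / (Q + 1) * (Q + 1)) with eps in G by (field; lra). nra. }
  destruct (functional_choice _ Hex) as [H' HH'].
  assert (Hol' : ball_hol H' C3zero (r / 2) M).
  { apply (pointwise_limit_holomorphic H); [|exact HH'].
    intros n p Hp. apply HH. lra. }
  exists H'. split; [exact Hol'|split].
  - intros p Hp. apply (Cconv_bound _ _ _ _ (HH' p Hp)).
    exists O. intros n _. apply HH. lra.
  - intros p L Hp HL1 HL2.
    assert (Hp2 : 0 <= C3norm p ^ 2) by apply pow2_ge_0.
    (* In the limit over [n] the term with [d n] vanishes; [s] is an auxiliary bound for [d n] that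
       is then sent to 0. *)
    assert (DL : forall t, 0 < t <= max_step ->
      Cmod (H' (euler Y t p) - (1 + RtoC t * a) * H' p)%C <= T * t ^ 2 * C3norm p ^ 2).
    { intros t Ht. apply Rminus_le.
      apply (Rle_0_of_small _ (t * T * C3norm p ^ 2) 1 Rlt_0_1). intros s Hs.
      enough (Q : Cmod (H' (euler Y t p) - (1 + t * a) * H' p)%C
        <= T * t ^ 2 * C3norm p ^ 2 + t * T * C3norm p ^ 2 * s) by lra.
      assert (C1 := HH' _ (euler_ball t p (r / 2) ltac:(lra) ltac:(lra) Hp)).
      assert (C2 := Cconv_scal (-(1 + t * a)) _ _ (HH' p Hp)).
      assert (C3 := Cconv_plus _ _ _ _ C1 C2).
      replace (H' (euler Y t p) - (1 + t * a) * H' p)%C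
       with (H' (euler Y t p) + - (1 + t * a) * H' p - 0)%C by ring.
      apply (Cconv_bound _ _ _ _ C3).
      destruct (Hd0 s ltac:(lra)) as [N HN]. exists N. intros n Hn.
      replace (H n (euler Y t p) + - (1 + t * a) * H n p - 0)%C
       with (H n (euler Y t p) - (1 + t * a) * H n p)%C by ring.
      eapply Rle_trans; [apply (Def n t p Ht Hp)|].
      specialize (HN n Hn).
      replace (T * t ^ 2 * C3norm p ^ 2 + t * T * C3norm p ^ 2 * s)
       with ((T * t ^ 2 + t * (T * s)) * C3norm p ^ 2) by ring.
      apply Rmult_le_compat_r; [exact Hp2|]. apply Rplus_le_compat_l.
      apply Rmult_le_compat_l; [lra|]. apply Rmult_le_compat_l; lra. }
    (* Differentiability with error E / (2 (|Y p| + 1)) absorbs half of t E. The Euler defect bounds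
       the other half by a multiple of t^2, which is impossible for small [t] unless E = 0. *)
    assert (E : Cmod (L (Y p) - a * H' p)%C <= 0).
    { assert (HN := C3norm_pos (Y p)).
      apply Rnot_lt_le. intros Hpos.
      set (E := Cmod (L (Y p) - a * H' p)%C) in *.
      destruct (HL2 (E / (2 * (C3norm (Y p) + 1)))) as [dl [Hdl Hb]].
      { apply Rdiv_lt_0_compat; lra. }
      set (d1 := Rmin max_step (dl / (C3norm (Y p) + 1))).
      assert (D0 : 0 < d1) by (apply Rmin_case; [lra|apply Rdiv_lt_0_compat; lra]).
      assert (D1 : d1 <= max_step) by apply Rmin_l.
      assert (D2 : d1 <= dl / (C3norm (Y p) + 1)) by apply Rmin_r.
      clearbody d1.
      apply (Rmult_le_compat_r (C3norm (Y p) + 1)) in D2; [|lra].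
      replace (dl / (C3norm (Y p) + 1) * (C3norm (Y p) + 1)) with dl in D2 by (field; lra).
      assert (X : E / 2 <= 0).
      { apply (Rle_0_of_small _ (T * C3norm p ^ 2) d1 D0). intros t Ht.
        specialize (Hb (C3scal t (Y p))).
        rewrite C3norm_scal, Cmod_R, Rabs_pos_eq, (lin_scal L _ _ HL1) in Hb by lra.
        specialize (Hb ltac:(nra)). fold (euler Y t p) in Hb.
        specialize (DL t ltac:(lra)).
        assert (G : t * E <= T * t ^ 2 * C3norm p ^ 2
           + E / (2 * (C3norm (Y p) + 1)) * (t * C3norm (Y p))).
        { unfold E at 1. rewrite <- (Rabs_pos_eq t) at 1 by lra.
          rewrite <- Cmod_R, <- Cmod_mult.
          replace (t * (L (Y p) - a * H' p))%C with
           ((H' (euler Y t p) - (1 + t * a) * H' p)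
            - (H' (euler Y t p) - H' p - t * L (Y p)))%C by ring.
          eapply Rle_trans; [apply Cmod_sub_le|lra]. }
        assert (E / (2 * (C3norm (Y p) + 1)) * (t * C3norm (Y p)) <= t * (E / 2)).
        { replace (t * (E / 2)) with
           (E / (2 * (C3norm (Y p) + 1)) * (t * (C3norm (Y p) + 1))) by (field; lra).
          apply Rmult_le_compat_l; [apply Rlt_le, Rdiv_lt_0_compat; lra|].
          apply Rmult_le_compat_l; lra. }
        apply (Rmult_le_reg_l t); [lra|]. nra. }
      lra. }
    assert (E0 : Cmod (L (Y p) - a * H' p)%C = 0)
      by (apply Rle_antisym; [exact E|apply Cmod_ge_0]).
    apply Cmod_eq_0 in E0.
    replace (L (Y p)) with ((L (Y p) - a * H' p) + a * H' p)%C by ring.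
    rewrite E0. ring.
Qed.

End Coordinate.
End Euler_iteration.

(** * Local inversion *)

(** On the ball of radius R the function is at most K R^2, so the Cauchy-type Lipschitz bound on
    balls of radius R/2 is 64 K R, which shrinks with R. *)
Lemma quadratic_lipschitz U K R :
  0 < R -> 0 <= K -> (forall p, C3norm p < R -> has_fder U p) ->
  (forall p, C3norm p < R -> Cmod (U p) <= K * C3norm p ^ 2) ->
  forall p q, C3norm p < R / 8 -> C3norm q < R / 8 ->
    Cmod (U p - U q)%C <= 64 * K * R * C3norm (C3sub p q).
Proof.
  intros HR HK Hd Hb p q Hp Hq.
  assert (Hol : ball_hol U C3zero R (K * R ^ 2)).
  { intros h Hh. replace (C3add C3zero h) with h by C3ring. split; [|now apply Hd].
    eapply Rle_trans; [now apply Hb|]. apply Rmult_le_compat_l; [exact HK|].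
    apply pow_incr. split; [apply C3norm_pos|lra]. }
  assert (Hol' := ball_hol_recenter U R _ q Hol ltac:(lra)).
  assert (Hs : C3norm (C3sub p q) <= R / 2 / 2).
  { eapply Rle_trans; [apply C3norm_sub|lra]. }
  assert (G := ball_hol_lipschitz U q (R / 2) _ (C3sub p q) ltac:(lra) Hol' Hs).
  replace (C3add q (C3sub p q)) with p in G by C3ring.
  eapply Rle_trans; [exact G|]. right. field. lra.
Qed.

Lemma C3conv_limit (u : nat -> C3) (v : C3) :
  Cconv (fun n => c3x (u n)) (c3x v) -> Cconv (fun n => c3y (u n)) (c3y v) ->
  Cconv (fun n => c3z (u n)) (c3z v) ->
  forall eps, 0 < eps -> exists N, forall n, (N <= n)%nat -> C3norm (C3sub (u n) v) < eps.
Proof.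
  intros H1 H2 H3 eps Heps.
  destruct (H1 eps Heps) as [N1 G1]. destruct (H2 eps Heps) as [N2 G2].
  destruct (H3 eps Heps) as [N3 G3].
  exists (N1 + N2 + N3)%nat. intros n Hn.
  apply C3norm_lt; [apply G1|apply G2|apply G3]; lia.
Qed.

(** Write [Psi] as the identity plus [U], with [U] 1/2-Lipschitz near 0. The inverse at [q] is the
    fixed point of p -> q - U p. Its Picard iterates are holomorphic in [q] and uniformly bounded,
    so the pointwise limit is holomorphic. [rho0] lets the caller cap the radius. *)
Theorem local_inverse (Psi : C3 -> C3) r K rho0 :
  0 < r -> 0 <= K -> 0 < rho0 ->
  (forall p, C3norm p < r -> has_vder Psi p) ->
  (forall p, C3norm p < r -> C3norm (C3sub (Psi p) p) <= K * C3norm p ^ 2) ->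
  exists (rho : R) (G : C3 -> C3), 0 < rho /\ 2 * rho <= r /\ 2 * rho <= rho0 /\
    (forall p q, C3norm p < 2 * rho -> C3norm q < 2 * rho ->
       C3norm (C3sub p q) <= 2 * C3norm (C3sub (Psi p) (Psi q))) /\
    (forall q, C3norm q < rho ->
       C3norm (G q) <= 2 * C3norm q /\ Psi (G q) = q /\ has_vder G q).
Proof.
  intros Hr HK Hrho0 Hder Hquad.
  (* Makes the Lipschitz constant 64 K R of [U] at most 1/2. *)
  assert (HR0 : 0 < 1 / (128 * (K + 1))) by (apply Rdiv_lt_0_compat; lra).
  set (R := Rmin (Rmin r rho0) (1 / (128 * (K + 1)))).
  assert (HR : 0 < R) by (repeat apply Rmin_case; lra).
  assert (HRr : R <= r) by (eapply Rle_trans; [apply Rmin_l|apply Rmin_l]).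
  assert (HRrho : R <= rho0) by (eapply Rle_trans; [apply Rmin_l|apply Rmin_r]).
  assert (HRK : R <= 1 / (128 * (K + 1))) by apply Rmin_r.
  clearbody R.
  assert (HKR : 64 * K * R <= 1 / 2).
  { apply (Rmult_le_compat_l (64 * (K + 1))) in HRK; [|lra].
    replace (64 * (K + 1) * (1 / (128 * (K + 1)))) with (1 / 2) in HRK by (field; lra).
    lra. }
  set (U := fun p => C3sub (Psi p) p).
  assert (HU : forall p, C3norm p < r -> has_vder U p).
  { intros p Hp. apply has_vder_sub; [now apply Hder|apply has_vder_id]. }
  assert (Lip : forall p q, C3norm p < R / 8 -> C3norm q < R / 8 ->
     C3norm (C3sub (U p) (U q)) <= 1 / 2 * C3norm (C3sub p q)).
  { intros p q Hp Hq. assert (N := C3norm_pos (C3sub p q)).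
    assert (64 * K * R * C3norm (C3sub p q) <= 1 / 2 * C3norm (C3sub p q))
      by (apply Rmult_le_compat_r; lra).
    apply C3norm_le; (eapply Rle_trans; [|exact H]).
    - apply (quadratic_lipschitz (fun p => c3x (U p))); try assumption.
      + intros x Hx. apply (has_vder_components U x). apply HU. lra.
      + intros x Hx. eapply Rle_trans; [apply C3norm_x|]. apply Hquad. lra.
    - apply (quadratic_lipschitz (fun p => c3y (U p))); try assumption.
      + intros x Hx. apply (has_vder_components U x). apply HU. lra.
      + intros x Hx. eapply Rle_trans; [apply C3norm_y|]. apply Hquad. lra.
    - apply (quadratic_lipschitz (fun p => c3z (U p))); try assumption.
      + intros x Hx. apply (has_vder_components U x). apply HU. lra.
      + intros x Hx. eapply Rle_trans; [apply C3norm_z|]. apply Hquad. lra. }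
  assert (U0 : U C3zero = C3zero).
  { apply C3norm_eq_0. eapply Rle_trans; [apply Hquad; rewrite C3norm_zero; lra|].
    rewrite C3norm_zero. right; ring. }
  assert (LipZ : forall p, C3norm p < R / 8 -> C3norm (U p) <= 1 / 2 * C3norm p).
  { intros p Hp. assert (G := Lip p C3zero Hp ltac:(rewrite C3norm_zero; lra)).
    rewrite U0 in G. replace (C3sub (U p) C3zero) with (U p) in G
      by (generalize (U p); clear; intros; C3ring).
    replace (C3sub p C3zero) with p in G by C3ring. exact G. }
  set (It := fix It (n : nat) (q : C3) : C3 :=
     match n with O => C3zero | S n => C3sub q (U (It n q)) end).
  (* |q| + (1/2)(2|q|) = 2|q|, so the iterates stay below R/8, where the Lipschitz bound on [U] is
     valid. *)
  assert (B : forall n q, C3norm q < R / 16 -> C3norm (It n q) <= 2 * C3norm q).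
  { induction n as [|n IH]; intros q Hq; simpl.
    - rewrite C3norm_zero. generalize (C3norm_pos q); lra.
    - eapply Rle_trans; [apply C3norm_sub|].
      generalize (LipZ (It n q) ltac:(generalize (IH q Hq); lra)) (IH q Hq). lra. }
  assert (St : forall n q, C3norm q < R / 16 ->
     C3norm (C3sub (It (S n) q) (It n q)) <= C3norm q * (1 / 2) ^ n).
  { induction n as [|n IH]; intros q Hq.
    - simpl. rewrite U0. replace (C3sub (C3sub q C3zero) C3zero) with q by C3ring. lra.
    - replace (C3sub (It (S (S n)) q) (It (S n) q))
       with (C3sub (U (It n q)) (U (It (S n) q)))
       by (simpl; generalize (U (It n q)), (U (C3sub q (U (It n q)))); clear; intros; C3ring).
      rewrite C3norm_sym.
      eapply Rle_trans; [apply Lip; [generalize (B (S n) q Hq)|generalize (B n q Hq)]; lra|].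
      generalize (IH q Hq).
      replace ((1 / 2) ^ S n) with (1 / 2 * (1 / 2) ^ n) by (simpl; ring). lra. }
  assert (Hex : forall q, exists v, C3norm q < R / 16 ->
     Cconv (fun n => c3x (It n q)) (c3x v) /\ Cconv (fun n => c3y (It n q)) (c3y v) /\
     Cconv (fun n => c3z (It n q)) (c3z v)).
  { intros q. destruct (Rlt_dec (C3norm q) (R / 16)) as [Hq|Hq];
      [|exists C3zero; contradiction].
    destruct (Cconv_geometric (fun n => c3x (It n q)) (C3norm q) (1 / 2) ltac:(lra)) as [x Hx].
    { intros n. eapply Rle_trans; [|now apply St]. apply (C3norm_x (C3sub _ _)). }
    destruct (Cconv_geometric (fun n => c3y (It n q)) (C3norm q) (1 / 2) ltac:(lra)) as [y Hy].
    { intros n. eapply Rle_trans; [|now apply St]. apply (C3norm_y (C3sub _ _)). }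
    destruct (Cconv_geometric (fun n => c3z (It n q)) (C3norm q) (1 / 2) ltac:(lra)) as [z Hz].
    { intros n. eapply Rle_trans; [|now apply St]. apply (C3norm_z (C3sub _ _)). }
    exists (x, y, z). intros _. repeat split; assumption. }
  destruct (functional_choice _ Hex) as [G HG].
  assert (Hlim : forall q, C3norm q < R / 16 -> forall eps, 0 < eps ->
     exists N, forall n, (N <= n)%nat -> C3norm (C3sub (It n q) (G q)) < eps).
  { intros q Hq. destruct (HG q Hq) as [G1 [G2 G3]]. now apply C3conv_limit. }
  assert (GB : forall q, C3norm q < R / 16 -> C3norm (G q) <= 2 * C3norm q).
  { intros q Hq. apply Rnot_lt_le. intros Hlt.
    destruct (Hlim q Hq (C3norm (G q) - 2 * C3norm q) ltac:(lra)) as [N HN].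
    specialize (HN N (Nat.le_refl N)). specialize (B N q Hq).
    assert (C3norm (G q) <= C3norm (It N q) + C3norm (C3sub (It N q) (G q))).
    { replace (G q) with (C3sub (It N q) (C3sub (It N q) (G q))) at 1
        by (generalize (It N q), (G q); clear; intros; C3ring).
      apply C3norm_sub. }
    lra. }
  assert (GU : forall q, C3norm q < R / 16 -> C3add (G q) (U (G q)) = q).
  { intros q Hq. apply C3sub_eq. apply Rnot_lt_le. intros Hlt.
    set (e := C3norm (C3sub (C3add (G q) (U (G q))) q)) in *.
    destruct (Hlim q Hq (e / 2) ltac:(lra)) as [N HN].
    assert (HN1 := HN N (Nat.le_refl N)). assert (HN2 := HN (S N) ltac:(lia)).
    assert (G1 := GB q Hq). assert (G2 := B N q Hq).
    assert (HL := Lip (It N q) (G q) ltac:(lra) ltac:(lra)).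
    assert (e <= C3norm (C3sub (It (S N) q) (G q)) + C3norm (C3sub (U (It N q)) (U (G q)))).
    { unfold e.
      replace (C3sub (C3add (G q) (U (G q))) q) with
       (C3sub (C3sub C3zero (C3sub (It (S N) q) (G q))) (C3sub (U (It N q)) (U (G q)))).
      - eapply Rle_trans; [apply C3norm_sub|]. rewrite C3norm_opp. lra.
      - simpl. generalize (U (It N q)), (U (G q)), (G q). clear; intros; C3ring. }
    lra. }
  assert (Hol : forall n q, C3norm q < R / 16 -> has_vder (It n) q).
  { induction n as [|n IH]; intros q Hq; simpl.
    - apply has_vder_components.
      assert (Z : has_fder (fun _ => RtoC 0) q).
      { apply has_fder_lin. exists (RtoC 0), (RtoC 0), (RtoC 0). intros v. clear; C3ring. }
      repeat split; exact Z.
    - apply has_vder_sub; [apply has_vder_id|].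
      apply has_vder_comp; [|now apply IH]. apply HU.
      generalize (B n q Hq). lra. }
  assert (GH : forall q, C3norm q < R / 16 -> has_vder G q).
  { assert (BH : ball_hol (fun q => c3x (G q)) C3zero (R / 16) (R / 8) /\
      ball_hol (fun q => c3y (G q)) C3zero (R / 16) (R / 8) /\
      ball_hol (fun q => c3z (G q)) C3zero (R / 16) (R / 8)).
    { split; [|split].
      - apply (pointwise_limit_holomorphic (fun n q => c3x (It n q))).
        + intros n h Hh. replace (C3add C3zero h) with h by C3ring. split.
          * eapply Rle_trans; [apply C3norm_x|]. generalize (B n h Hh). lra.
          * apply (has_vder_components (It n) h). now apply Hol.
        + intros p Hp. now apply HG.
      - apply (pointwise_limit_holomorphic (fun n q => c3y (It n q))).
        + intros n h Hh. replace (C3add C3zero h) with h by C3ring. split.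
          * eapply Rle_trans; [apply C3norm_y|]. generalize (B n h Hh). lra.
          * apply (has_vder_components (It n) h). now apply Hol.
        + intros p Hp. now apply HG.
      - apply (pointwise_limit_holomorphic (fun n q => c3z (It n q))).
        + intros n h Hh. replace (C3add C3zero h) with h by C3ring. split.
          * eapply Rle_trans; [apply C3norm_z|]. generalize (B n h Hh). lra.
          * apply (has_vder_components (It n) h). now apply Hol.
        + intros p Hp. now apply HG. }
    destruct BH as [B1 [B2 B3]]. intros q Hq. apply has_vder_components.
    destruct (B1 q Hq) as [_ F1]. destruct (B2 q Hq) as [_ F2]. destruct (B3 q Hq) as [_ F3].
    replace (C3add C3zero q) with q in F1, F2, F3 by C3ring. repeat split; assumption. }
  exists (R / 16), G. split; [lra|]. split; [lra|]. split; [lra|]. split.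
  - intros p q Hp Hq. assert (HL := Lip p q ltac:(lra) ltac:(lra)).
    assert (C3norm (C3sub p q) <=
       C3norm (C3sub (Psi p) (Psi q)) + C3norm (C3sub (U p) (U q))).
    { replace (C3sub p q) with
       (C3sub (C3sub (Psi p) (Psi q)) (C3sub (U p) (U q))) at 1
       by (unfold U; generalize (Psi p), (Psi q); clear; intros; C3ring).
      apply C3norm_sub. }
    lra.
  - intros q Hq. split; [now apply GB|]. split; [|now apply GH].
    transitivity (C3add (G q) (U (G q))); [|now apply GU].
    unfold U. generalize (Psi (G q)). generalize (G q). clear; intros; C3ring.
Qed.

(** * Straightening the system *)

(** The Taylor bound requires [F] to be bounded on a ball; differentiability at the origin with
    error 1 supplies such a bound. *)
Lemma taylor_origin F L r : 0 < r -> (forall p, C3norm p < r -> has_fder F p) ->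
  F C3zero = RtoC 0 -> is_lin L -> fder F C3zero L ->
  exists r' K, 0 < r' <= r /\ 0 <= K /\
    forall p, C3norm p < r' -> Cmod (F p - L p)%C <= K * C3norm p ^ 2.
Proof.
  intros Hr Hd F0 HL HF.
  destruct (lin_bounded _ HL) as [N [HN BN]].
  destruct (HF 1 Rlt_0_1) as [d [Hd0 Hb]].
  set (R := Rmin r d). assert (HR : 0 < R) by (apply Rmin_case; lra).
  assert (HRr : R <= r) by apply Rmin_l. assert (HRd : R <= d) by apply Rmin_r.
  clearbody R.
  assert (Hol : ball_hol F C3zero R ((N + 1) * R)).
  { intros h Hh. replace (C3add C3zero h) with h by C3ring. split; [|apply Hd; lra].
    specialize (Hb h ltac:(lra)). replace (C3add C3zero h) with h in Hb by C3ring.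
    rewrite F0 in Hb. replace (F h) with ((F h - 0 - L h) + L h)%C by ring.
    eapply Rle_trans; [apply Cmod_triangle|]. generalize (BN h) (C3norm_pos h).
    intros. nra. }
  exists (R / 4), (2048 * ((N + 1) * R) / R ^ 2).
  split; [lra|]. split.
  { apply Rdiv_le_0_compat; [|apply pow_lt; lra].
    assert (0 <= (N + 1) * R) by (apply Rmult_le_pos; lra). lra. }
  intros p Hp. assert (G := ball_hol_taylor F C3zero R _ L p HR Hol HL HF ltac:(lra)).
  rewrite F0 in G. replace (C3add C3zero p) with p in G by C3ring.
  replace (F p - L p)%C with (F p - 0 - L p)%C by ring. exact G.
Qed.

Lemma holomorphic_order2_bound f : holomorphic_near0 f -> vanishes_order2 f ->
  exists r K, 0 < r /\ 0 <= K /\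
    forall p, C3norm p < r -> has_fder f p /\ Cmod (f p) <= K * C3norm p ^ 2.
Proof.
  intros [r [Hr Hh]] [f0 fd]. apply has_cderiv3_fder in fd.
  destruct (taylor_origin f (Clin3 C0 C0 C0) r Hr) as [r' [K [Hr' [HK HB]]]].
  - intros p Hp. apply has_fder_cderiv3. now apply Hh.
  - exact f0.
  - apply is_lin_Clin3.
  - exact fd.
  - exists r', K. split; [lra|]. split; [exact HK|]. intros p Hp. split.
    + apply has_fder_cderiv3. apply Hh. lra.
    + replace (f p) with (f p - Clin3 C0 C0 C0 p)%C by (generalize (f p); intros; C3ring).
      now apply HB.
Qed.

Lemma common_contraction_time (omega : R) (lambda : C) : omega <> 0 -> fst lambda <> 0 ->
  exists tau : C, tau <> RtoC 0 /\ fst (tau * Cimag omega)%C = -1 /\ fst (tau * lambda)%C = -1.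
Proof.
  intros Ho Hl. destruct lambda as [x y]; simpl in Hl.
  (* Solves two real linear equations: Im(tau) omega = 1, then Re(tau) x - Im(tau) y = -1. *)
  exists ((-1 + y / omega) / x, 1 / omega). repeat split.
  - intros E. apply (f_equal snd) in E. simpl in E.
    assert (1 / omega * omega = 0) by (rewrite E; ring).
    replace (1 / omega * omega) with 1 in H by (field; exact Ho). lra.
  - simpl. field. split; assumption.
  - simpl. field. split; assumption.
Qed.

Lemma system_rotated omega lambda f g h :
  omega <> 0 -> fst lambda <> 0 ->
  holomorphic_near0 f -> holomorphic_near0 g -> holomorphic_near0 h ->
  vanishes_order2 f -> vanishes_order2 g -> vanishes_order2 h ->
  exists (tau : C) r K, tau <> RtoC 0 /\
    fst (tau * Cimag omega)%C = -1 /\ fst (tau * lambda)%C = -1 /\ 0 < r /\ 0 <= K /\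
    forall p, C3norm p < r ->
      has_vder (fun q => C3scal tau (system omega lambda f g h q)) p /\
      C3norm (C3sub (C3scal tau (system omega lambda f g h p))
        (diag3 (tau * Cimag omega) (tau * Cimag omega) (tau * lambda) p))
        <= K * C3norm p ^ 2.
Proof.
  intros Ho Hl Hf Hg Hh Vf Vg Vh.
  destruct (common_contraction_time omega lambda Ho Hl) as [tau [T0 [T1 T2]]].
  destruct (holomorphic_order2_bound f Hf Vf) as [rf [Kf [Hrf [HKf Bf]]]].
  destruct (holomorphic_order2_bound g Hg Vg) as [rg [Kg [Hrg [HKg Bg]]]].
  destruct (holomorphic_order2_bound h Hh Vh) as [rh [Kh [Hrh [HKh Bh]]]].
  assert (Ht := Cmod_ge_0 tau).
  exists tau, (Rmin rf (Rmin rg rh)), (Cmod tau * (Kf + Kg + Kh)).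
  split; [exact T0|]. split; [exact T1|]. split; [exact T2|].
  split; [repeat apply Rmin_case; lra|].
  split; [apply Rmult_le_pos; lra|].
  intros p Hp.
  assert (h1 := Rlt_le_trans _ _ _ Hp (Rmin_l _ _)).
  assert (h23 := Rlt_le_trans _ _ _ Hp (Rmin_r _ _)).
  assert (h2 := Rlt_le_trans _ _ _ h23 (Rmin_l _ _)).
  assert (h3 := Rlt_le_trans _ _ _ h23 (Rmin_r _ _)).
  destruct (Bf p h1) as [Df Ef]. destruct (Bg p h2) as [Dg Eg]. destruct (Bh p h3) as [Dh Eh].
  destruct is_lin_coord as [Cx [Cy Cz]].
  split.
  - assert (S : forall (b : C) (l F : C3 -> C), is_lin l -> has_fder F p ->
       has_fder (fun q => tau * (b * l q + F q))%C p).
    { intros b l F Hlin HF. apply has_fder_scal.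
      apply (has_fder_ext (fun q => F q + b * l q)%C); [intros q; ring|].
      apply has_fder_plus_scal; [exact HF|now apply has_fder_lin]. }
    apply has_vder_components. split; [|split].
    + exact (S (Cimag omega) c3x f Cx Df).
    + exact (S (Cimag omega) c3y g Cy Dg).
    + exact (S lambda c3z h Cz Dh).
  - assert (N : forall (b w F : C) k, 0 <= k -> Cmod F <= k * C3norm p ^ 2 ->
       k <= Kf + Kg + Kh ->
       Cmod (tau * (b * w + F) - tau * b * w)%C <= Cmod tau * (Kf + Kg + Kh) * C3norm p ^ 2).
    { intros b w F k Hk HF Hk'.
      replace (tau * (b * w + F) - tau * b * w)%C with (tau * F)%C by ring.
      rewrite Cmod_mult, Rmult_assoc. apply Rmult_le_compat_l; [exact Ht|].
      eapply Rle_trans; [exact HF|]. apply Rmult_le_compat_r; [apply pow2_ge_0|exact Hk']. }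
    apply C3norm_le.
    + apply (N (Cimag omega) (c3x p) (f p) Kf); lra.
    + apply (N (Cimag omega) (c3y p) (g p) Kg); lra.
    + apply (N lambda (c3z p) (h p) Kh); lra.
Qed.

Lemma straightening (X : C3 -> C3) (tau b1 b2 b3 : C) r K :
  tau <> RtoC 0 -> fst (tau * b1)%C = -1 -> fst (tau * b2)%C = -1 -> fst (tau * b3)%C = -1 ->
  0 < r -> 0 <= K ->
  (forall p, C3norm p < r -> has_vder (fun q => C3scal tau (X q)) p /\
     C3norm (C3sub (C3scal tau (X p)) (diag3 (tau * b1) (tau * b2) (tau * b3) p))
       <= K * C3norm p ^ 2) ->
  exists (H : C3 -> C3) r' K', 0 < r' /\ 0 <= K' /\
    (forall p, C3norm p < r' -> has_vder H p) /\
    (forall p, C3norm p < r' -> C3norm (C3sub (H p) p) <= K' * C3norm p ^ 2) /\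
    (forall p D, C3norm p < r' -> is_lin3 D -> vder H p D ->
       D (X p) = diag3 b1 b2 b3 (H p)).
Proof.
  intros T0 T1 T2 T3 Hr HK HX.
  set (Y := fun q => C3scal tau (X q)).
  set (a1 := (tau * b1)%C). set (a2 := (tau * b2)%C). set (a3 := (tau * b3)%C).
  set (B := 1 + Cmod a1 + Cmod a2 + Cmod a3).
  assert (P1 := Cmod_ge_0 a1). assert (P2 := Cmod_ge_0 a2). assert (P3 := Cmod_ge_0 a3).
  assert (Q : 0 < 1 / (16 * (K + 1))) by (apply Rdiv_lt_0_compat; lra).
  set (R := Rmin r (1 / (16 * (K + 1)))).
  assert (HR : 0 < R) by (apply Rmin_case; lra).
  assert (HRr : R <= r) by apply Rmin_l.
  assert (HRK : R <= 1 / (16 * (K + 1))) by apply Rmin_r.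
  clearbody R.
  assert (HKR : K * R <= 1 / 16).
  { apply (Rmult_le_compat_l (K + 1)) in HRK; [|lra].
    replace ((K + 1) * (1 / (16 * (K + 1)))) with (1 / 16) in HRK by (field; lra). lra. }
  destruct is_lin_coord as [Cx [Cy Cz]].
  assert (Lin := fun l a Hlin Hl1 Hla Ha => linearizing_coordinate Y a1 a2 a3 K B R T1 T2 T3
    ltac:(unfold B; lra) ltac:(unfold B; lra) ltac:(unfold B; lra) ltac:(unfold B; lra)
    HK HR HKR (fun p Hp => proj2 (HX p (Rlt_le_trans _ _ _ Hp HRr))) l a Hlin Hl1 Hla Ha
    (fun p Hp => proj1 (HX p (Rlt_le_trans _ _ _ Hp HRr)))).
  destruct (Lin c3x a1 Cx C3norm_x (fun _ => eq_refl) T1) as [H1 [Hol1 [Tan1 Eq1]]].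
  destruct (Lin c3y a2 Cy C3norm_y (fun _ => eq_refl) T2) as [H2 [Hol2 [Tan2 Eq2]]].
  destruct (Lin c3z a3 Cz C3norm_z (fun _ => eq_refl) T3) as [H3 [Hol3 [Tan3 Eq3]]].
  exists (fun p => (H1 p, H2 p, H3 p)), (R / 2), (4 * K).
  split; [lra|]. split; [lra|]. split; [|split].
  - intros p Hp. apply has_vder_components.
    destruct (Hol1 p Hp) as [_ F1]. destruct (Hol2 p Hp) as [_ F2].
    destruct (Hol3 p Hp) as [_ F3]. replace (C3add C3zero p) with p in F1, F2, F3 by C3ring.
    repeat split; assumption.
  - intros p Hp. apply C3norm_le; [now apply Tan1|now apply Tan2|now apply Tan3].
  - intros p D Hp [L1 [L2 L3]] [V1 [V2 V3]].
    assert (Cancel : forall (L : C3 -> C) (b w : C), is_lin L ->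
       L (Y p) = (tau * b * w)%C -> L (X p) = (b * w)%C).
    { intros L b w HL E. unfold Y in E. rewrite (lin_scal L _ _ HL) in E.
      replace (L (X p)) with (/ tau * (tau * L (X p)))%C by (field; exact T0).
      rewrite E. field. exact T0. }
    assert (E1 := Cancel _ _ _ L1 (Eq1 p _ Hp L1 V1)).
    assert (E2 := Cancel _ _ _ L2 (Eq2 p _ Hp L2 V2)).
    assert (E3 := Cancel _ _ _ L3 (Eq3 p _ Hp L3 V3)).
    cbv beta in E1, E2, E3. unfold diag3.
    change (c3x (H1 p, H2 p, H3 p)) with (H1 p).
    change (c3y (H1 p, H2 p, H3 p)) with (H2 p).
    change (c3z (H1 p, H2 p, H3 p)) with (H3 p).
    rewrite <- E1, <- E2, <- E3. now destruct (D (X p)) as [[? ?] ?].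
Qed.

Section Inverse.
Variables (Psi G : C3 -> C3) (r rho : R).
Hypotheses (Hrho : 0 < rho) (Hr : 2 * rho <= r).
Hypothesis Hder : forall p, C3norm p < r -> has_vder Psi p.
Hypothesis Hinj : forall p q, C3norm p < 2 * rho -> C3norm q < 2 * rho ->
   C3norm (C3sub p q) <= 2 * C3norm (C3sub (Psi p) (Psi q)).
Hypothesis HG : forall q, C3norm q < rho ->
   C3norm (G q) <= 2 * C3norm q /\ Psi (G q) = q /\ has_vder G q.

(** [G (Psi p)] and [p] have the same image under [Psi], and both lie where [Psi] is injective. *)
Lemma local_inverse_left p : C3norm p < 2 * rho -> C3norm (Psi p) < rho -> G (Psi p) = p.
Proof.
  intros Hp Hq. destruct (HG _ Hq) as [B [E _]].
  apply C3sub_eq. eapply Rle_trans; [apply Hinj; [lra|exact Hp]|].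
  rewrite E, C3norm_sub_diag. lra.
Qed.

Lemma local_inverse_derivative p D E : C3norm p < 2 * rho -> C3norm (Psi p) < rho ->
  is_lin3 D -> is_lin3 E -> vder Psi p D -> vder G (Psi p) E -> forall v, E (D v) = v.
Proof.
  intros Hp Hq HD HE VD VE. apply (left_inverse_derivative G Psi p); try assumption.
  (* To be differentiated, the left inverse identity must hold on a neighbourhood; continuity of
     [Psi] keeps nearby images in the domain of [G]. *)
  destruct (has_vder_near Psi p (Hder p ltac:(lra)) (rho - C3norm (Psi p)) ltac:(lra))
    as [d [Hd Hb]].
  exists (Rmin d (2 * rho - C3norm p)). split; [apply Rmin_case; lra|].
  intros h Hh.
  specialize (Hb h (Rlt_le_trans _ _ _ Hh (Rmin_l _ _))).
  assert (h2 := Rlt_le_trans _ _ _ Hh (Rmin_r _ _)).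
  apply local_inverse_left.
  - eapply Rle_lt_trans; [apply C3norm_triangle|lra].
  - replace (Psi (C3add p h)) with
     (C3add (C3sub (Psi (C3add p h)) (Psi p)) (Psi p))
     by (generalize (Psi (C3add p h)), (Psi p); clear; intros; C3ring).
    eapply Rle_lt_trans; [apply C3norm_triangle|lra].
Qed.
End Inverse.

(** * Isochronous orbits *)

Lemma has_velocity_cvel gamma t v : has_velocity gamma t v <->
  cvel (fun s => c3x (gamma s)) t (c3x v) /\ cvel (fun s => c3y (gamma s)) t (c3y v) /\
  cvel (fun s => c3z (gamma s)) t (c3z v).
Proof. unfold has_velocity, cvel. tauto. Qed.

Lemma has_velocity_error gamma t v : has_velocity gamma t v ->
  forall eps, 0 < eps -> exists delta, 0 < delta /\ forall h, Rabs h < delta ->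
    C3norm (C3sub (C3sub (gamma (t + h)) (gamma t)) (C3scal (RtoC h) v)) <= eps * Rabs h.
Proof.
  intros H eps Heps. apply has_velocity_cvel in H. destruct H as [H1 [H2 H3]].
  rewrite cvel_linear_error in H1, H2, H3.
  destruct (H1 eps Heps) as [d1 [Hd1 B1]]. destruct (H2 eps Heps) as [d2 [Hd2 B2]].
  destruct (H3 eps Heps) as [d3 [Hd3 B3]].
  exists (Rmin d1 (Rmin d2 d3)). split; [repeat apply Rmin_case; lra|].
  intros h Hh.
  assert (h1 := Rlt_le_trans _ _ _ Hh (Rmin_l _ _)).
  assert (h23 := Rlt_le_trans _ _ _ Hh (Rmin_r _ _)).
  assert (h2 := Rlt_le_trans _ _ _ h23 (Rmin_l _ _)).
  assert (h3 := Rlt_le_trans _ _ _ h23 (Rmin_r _ _)).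
  apply C3norm_le; [apply B1|apply B2|apply B3]; assumption.
Qed.

Lemma has_velocity_near gamma t v : has_velocity gamma t v ->
  forall eps, 0 < eps -> exists delta, 0 < delta /\ forall s, Rabs (s - t) < delta ->
    C3norm (C3sub (gamma s) (gamma t)) < eps.
Proof.
  intros H eps Heps. assert (Hv := C3norm_pos v).
  destruct (has_velocity_error _ _ _ H 1 Rlt_0_1) as [d [Hd Hb]].
  exists (Rmin d (eps / (C3norm v + 2))). split.
  { apply Rmin_case; [lra|apply Rdiv_lt_0_compat; lra]. }
  intros s Hs.
  specialize (Hb (s - t) (Rlt_le_trans _ _ _ Hs (Rmin_l _ _))).
  replace (t + (s - t)) with s in Hb by ring.
  assert (h2 := Rlt_le_trans _ _ _ Hs (Rmin_r _ _)).
  apply (Rmult_lt_compat_r (C3norm v + 2)) in h2; [|lra].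
  replace (eps / (C3norm v + 2) * (C3norm v + 2)) with eps in h2 by (field; lra).
  set (w := C3scal (RtoC (s - t)) v) in *.
  assert (Hw : C3norm w = Rabs (s - t) * C3norm v) by (unfold w; now rewrite C3norm_scal, Cmod_R).
  replace (C3sub (gamma s) (gamma t)) with
   (C3add (C3sub (C3sub (gamma s) (gamma t)) w) w)
   by (generalize (gamma s), (gamma t), w; clear; intros; C3ring).
  eapply Rle_lt_trans; [apply C3norm_triangle|].
  generalize (Rabs_pos (s - t)). intros. nra.
Qed.

Lemma cvel_fder F gamma t v L : has_velocity gamma t v -> is_lin L -> fder F (gamma t) L ->
  cvel (fun s => F (gamma s)) t (L v).
Proof.
  intros Hv HL HF. apply cvel_linear_error. intros eps Heps.
  destruct (lin_bounded _ HL) as [K [HK BK]].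
  assert (Nv := C3norm_pos v).
  destruct (HF (eps / (2 * (C3norm v + 1)))) as [d1 [Hd1 B1]].
  { apply Rdiv_lt_0_compat; lra. }
  destruct (has_velocity_error _ _ _ Hv (Rmin 1 (eps / (2 * (K + 1))))) as [d2 [Hd2 B2]].
  { apply Rmin_case; [lra|apply Rdiv_lt_0_compat; lra]. }
  destruct (has_velocity_near _ _ _ Hv d1 Hd1) as [d3 [Hd3 B3]].
  exists (Rmin d2 d3). split; [apply Rmin_case; lra|]. intros h Hh.
  specialize (B2 h (Rlt_le_trans _ _ _ Hh (Rmin_l _ _))).
  specialize (B3 (t + h)). replace (t + h - t) with h in B3 by ring.
  specialize (B3 (Rlt_le_trans _ _ _ Hh (Rmin_r _ _))).
  set (k := C3sub (gamma (t + h)) (gamma t)) in *.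
  specialize (B1 k B3).
  replace (C3add (gamma t) k) with (gamma (t + h)) in B1
    by (unfold k; generalize (gamma t), (gamma (t + h)); clear; intros; C3ring).
  assert (Hh0 := Rabs_pos h).
  set (e2 := Rmin 1 (eps / (2 * (K + 1)))) in *.
  assert (E1 : e2 <= 1) by apply Rmin_l.
  assert (E2 : e2 <= eps / (2 * (K + 1))) by apply Rmin_r.
  assert (Hk : C3norm k <= (C3norm v + 1) * Rabs h).
  { replace k with (C3add (C3sub k (C3scal h v)) (C3scal h v))
      by (generalize k; clear; intros; C3ring).
    eapply Rle_trans; [apply C3norm_triangle|]. rewrite C3norm_scal, Cmod_R.
    assert (e2 * Rabs h <= 1 * Rabs h) by (apply Rmult_le_compat_r; lra). lra. }
  replace (F (gamma (t + h)%R) - F (gamma t) - h * L v)%C with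
   ((F (gamma (t + h)%R) - F (gamma t) - L k) + L (C3sub k (C3scal h v)))%C
   by (rewrite (lin_sub L _ _ HL), (lin_scal L _ _ HL); ring).
  eapply Rle_trans; [apply Cmod_triangle|].
  assert (A1 : eps / (2 * (C3norm v + 1)) * C3norm k <= eps / 2 * Rabs h).
  { replace (eps / 2 * Rabs h) with
     (eps / (2 * (C3norm v + 1)) * ((C3norm v + 1) * Rabs h)) by (field; lra).
    apply Rmult_le_compat_l; [apply Rlt_le, Rdiv_lt_0_compat; lra|exact Hk]. }
  assert (A2 : Cmod (L (C3sub k (C3scal h v))) <= eps / 2 * Rabs h).
  { eapply Rle_trans; [apply BK|].
    replace (eps / 2 * Rabs h) with ((K + 1) * (eps / (2 * (K + 1)) * Rabs h)) by (field; lra).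
    apply Rmult_le_compat; [lra|apply C3norm_pos|lra|].
    eapply Rle_trans; [exact B2|]. apply Rmult_le_compat_r; lra. }
  lra.
Qed.

Lemma cvel_cexp (a u : C) t :
  cvel (fun s => cexp (RtoC s * a) * u)%C t (a * (cexp (RtoC t * a) * u))%C.
Proof.
  assert (D : cder (fun w => cexp w * u)%C (RtoC 0 + RtoC t * a)%C (cexp (RtoC t * a) * u)%C).
  { rewrite Cplus_0_l.
    replace (cexp (t * a) * u)%C with (cexp (t * a) * u + cexp (t * a) * 0)%C by ring.
    apply cder_mult; [apply cder_cexp|].
    intros eps Heps. exists 1; split; [lra|]. intros h _.
    replace (u - u - 0 * h)%C with (RtoC 0) by ring. rewrite Cmod_0.
    apply Rmult_le_pos; [lra|apply Cmod_ge_0]. }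
  destruct (cder_line _ _ a _ _ D) as [G1 G2].
  replace (a * (cexp (t * a) * u))%C with (cexp (t * a) * u * a)%C by ring.
  split.
  - eapply derivable_pt_lim_ext; [|exact G1]. intros s; cbv beta; now rewrite Cplus_0_l.
  - eapply derivable_pt_lim_ext; [|exact G2]. intros s; cbv beta; now rewrite Cplus_0_l.
Qed.

Lemma cvel_mult f g t l m : cvel f t l -> cvel g t m ->
  cvel (fun s => f s * g s)%C t (l * g t + f t * m)%C.
Proof.
  intros [F1 F2] [G1 G2]. split; simpl.
  - replace (fst l * fst (g t) - snd l * snd (g t) + (fst (f t) * fst m - snd (f t) * snd m))
     with ((fst l * fst (g t) + fst (f t) * fst m) - (snd l * snd (g t) + snd (f t) * snd m))
     by ring.
    apply (derivable_pt_lim_minus (fun s => fst (f s) * fst (g s))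
      (fun s => snd (f s) * snd (g s))).
    + apply (derivable_pt_lim_mult (fun s => fst (f s)) (fun s => fst (g s))); assumption.
    + apply (derivable_pt_lim_mult (fun s => snd (f s)) (fun s => snd (g s))); assumption.
  - replace (fst l * snd (g t) + snd l * fst (g t) + (fst (f t) * snd m + snd (f t) * fst m))
     with ((fst l * snd (g t) + fst (f t) * snd m) + (snd l * fst (g t) + snd (f t) * fst m))
     by ring.
    apply (derivable_pt_lim_plus (fun s => fst (f s) * snd (g s))
      (fun s => snd (f s) * fst (g s))).
    + apply (derivable_pt_lim_mult (fun s => fst (f s)) (fun s => snd (g s))); assumption.
    + apply (derivable_pt_lim_mult (fun s => snd (f s)) (fun s => fst (g s))); assumption.
Qed.

Lemma zero_derivative_constant (f : R -> R) a b :
  (forall t, a < t < b -> derivable_pt_lim f t 0) ->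
  forall s t, a < s < b -> a < t < b -> f s = f t.
Proof.
  intros H.
  assert (W : forall s t, a < s < b -> a < t < b -> s < t -> f s = f t).
  { intros s t Hs Ht Hst.
    destruct (MVT_cor2 f (fun _ => 0) s t Hst) as [c [E _]].
    - intros c Hc. apply H. lra.
    - lra. }
  intros s t Hs Ht. destruct (Rtotal_order s t) as [L|[E|L]].
  - now apply W.
  - now rewrite E.
  - symmetry. now apply W.
Qed.

(** The product of [k] with exp(-t a) has derivative zero. *)
Lemma linear_curve (k : R -> C) (a : C) c d :
  (forall t, c < t < d -> cvel k t (a * k t)%C) ->
  forall s t, c < s < d -> c < t < d -> k t = (cexp (RtoC (t - s) * a) * k s)%C.
Proof.
  intros H s t Hs Ht.
  set (m := fun t => (cexp (RtoC t * - a) * 1 * k t)%C).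
  assert (Dm : forall t, c < t < d -> cvel m t 0).
  { intros u Hu.
    replace (RtoC 0) with (- a * (cexp (u * - a) * 1) * k u + cexp (u * - a) * 1 * (a * k u))%C
      by ring.
    apply (cvel_mult (fun t => cexp (RtoC t * - a) * 1)%C k); [apply cvel_cexp|now apply H]. }
  assert (E : m t = m s).
  { apply injective_projections.
    - apply (zero_derivative_constant (fun t => fst (m t)) c d); try assumption.
      intros u Hu. apply (Dm u Hu).
    - apply (zero_derivative_constant (fun t => snd (m t)) c d); try assumption.
      intros u Hu. apply (Dm u Hu). }
  unfold m in E.
  assert (Z : (cexp (t * a) * cexp (t * - a))%C = RtoC 1).
  { rewrite <- cexp_plus. replace (t * a + t * - a)%C with (RtoC 0) by ring. apply cexp_0. }
  transitivity (cexp (t * a) * (cexp (t * - a) * 1 * k t))%C.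
  - transitivity ((cexp (t * a) * cexp (t * - a)) * k t)%C; [rewrite Z|]; ring.
  - rewrite E. replace ((t - s)%R * a)%C with (t * a + s * - a)%C
      by (rewrite RtoC_minus; ring).
    rewrite cexp_plus. ring.
Qed.

(** Connectedness by calculus: the indicator function of a locally constant property has derivative
    0, hence is constant on the interval. *)
Lemma clopen_on_interval (U : R -> Prop) a b t0 : a < t0 < b -> U t0 ->
  (forall t, a < t < b -> exists d, 0 < d /\ forall s, Rabs (s - t) < d -> (U s <-> U t)) ->
  forall t, a < t < b -> U t.
Proof.
  intros H0 U0 Hloc t Ht.
  set (ind := fun t => if excluded_middle_informative (U t) then 1 else 0).
  assert (D : forall t, a < t < b -> derivable_pt_lim ind t 0).
  { intros s Hs eps Heps. destruct (Hloc s Hs) as [d [Hd Hb]].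
    exists (mkposreal d Hd). simpl. intros h Nh Hh.
    assert (E : ind (s + h) = ind s).
    { specialize (Hb (s + h)). replace (s + h - s) with h in Hb by ring.
      specialize (Hb Hh). unfold ind.
      destruct (excluded_middle_informative (U (s + h)));
      destruct (excluded_middle_informative (U s)); tauto. }
    rewrite E. replace ((ind s - ind s) / h - 0) with 0 by (field; exact Nh).
    rewrite Rabs_R0. exact Heps. }
  assert (E := zero_derivative_constant ind a b D t t0 Ht H0).
  unfold ind in E. destruct (excluded_middle_informative (U t)); [assumption|].
  destruct (excluded_middle_informative (U t0)); [lra|contradiction].
Qed.

Lemma rotation_period (omega : R) : omega <> 0 ->
  cexp (RtoC (2 * PI / Rabs omega) * Cimag omega)%C = RtoC 1.
Proof.
  intros Ho. unfold cexp, RtoC, Cmult, Cimag; simpl.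
  replace (2 * PI / Rabs omega * 0 - 0 * omega) with 0 by (field; now apply Rabs_no_R0).
  rewrite exp_0.
  destruct (Rlt_or_le omega 0) as [H|H].
  - rewrite (Rabs_left omega H).
    replace (2 * PI / - omega * omega + 0 * 0) with (- (2 * PI)) by (field; lra).
    rewrite cos_neg, sin_neg, cos_2PI, sin_2PI. f_equal; ring.
  - rewrite Rabs_pos_eq by lra.
    replace (2 * PI / omega * omega + 0 * 0) with (2 * PI) by (field; lra).
    rewrite cos_2PI, sin_2PI. f_equal; ring.
Qed.

Lemma rotation_nontrivial (omega tau : R) : omega <> 0 -> 0 < tau < 2 * PI / Rabs omega ->
  cexp (RtoC tau * Cimag omega)%C <> RtoC 1.
Proof.
  intros Ho Ht E. apply (f_equal fst) in E. unfold cexp in E; simpl in E.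
  replace (tau * 0 - 0 * omega) with 0 in E by ring. rewrite exp_0 in E.
  replace (tau * omega + 0 * 0) with (tau * omega) in E by ring.
  assert (Ho' := Rabs_pos_lt omega Ho).
  assert (C : cos (tau * Rabs omega) = 1).
  { unfold Rabs. destruct (Rcase_abs omega).
    - replace (tau * - omega) with (- (tau * omega)) by ring. rewrite cos_neg. lra.
    - lra. }
  assert (H1 : tau * Rabs omega < 2 * PI).
  { replace (2 * PI) with (2 * PI / Rabs omega * Rabs omega) by (field; lra).
    apply Rmult_lt_compat_r; lra. }
  assert (H2 : 0 < tau * Rabs omega) by (apply Rmult_lt_0_compat; lra).
  set (x := tau * Rabs omega) in *.
  replace x with (2 * (x / 2)) in C by field.
  (* 1 - cos x = 2 sin^2(x/2), which is positive for x strictly between 0 and 2 pi. *)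
  rewrite cos_2a_sin in C.
  assert (S : 0 < sin (x / 2)) by (apply sin_gt_0; lra).
  assert (0 < sin (x / 2) * sin (x / 2)) by (apply Rmult_lt_0_compat; lra). lra.
Qed.

Section Isochronous.
Variables (omega : R) (lambda : C) (X : C3 -> C3) (H G : C3 -> C3) (r K rho : R).
Hypotheses (Homega : omega <> 0) (HK : 0 <= K) (Hrho : 0 < rho) (Hr : 2 * rho <= r).
Let A := diag3 (Cimag omega) (Cimag omega) lambda.
Hypothesis Hder : forall p, C3norm p < r -> has_vder H p.
Hypothesis Htan : forall p, C3norm p < r -> C3norm (C3sub (H p) p) <= K * C3norm p ^ 2.
Hypothesis Hconj : forall p D, C3norm p < r -> is_lin3 D -> vder H p D -> D (X p) = A (H p).
Hypothesis Hinj : forall p q, C3norm p < 2 * rho -> C3norm q < 2 * rho ->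
   C3norm (C3sub p q) <= 2 * C3norm (C3sub (H p) (H q)).
Hypothesis HG : forall q, C3norm q < rho ->
   C3norm (G q) <= 2 * C3norm q /\ H (G q) = q /\ has_vder G q.

Lemma straightened_velocity eta t : has_velocity eta t (X (eta t)) -> C3norm (eta t) < r ->
  cvel (fun s => c3x (H (eta s))) t (Cimag omega * c3x (H (eta t)))%C /\
  cvel (fun s => c3y (H (eta s))) t (Cimag omega * c3y (H (eta t)))%C /\
  cvel (fun s => c3z (H (eta s))) t (lambda * c3z (H (eta t)))%C.
Proof.
  intros Hv Hp. destruct (Hder _ Hp) as [D [HD HV]].
  assert (E := Hconj _ D Hp HD HV).
  destruct HD as [L1 [L2 L3]]. destruct HV as [V1 [V2 V3]].
  assert (W1 := cvel_fder _ _ _ _ _ Hv L1 V1).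
  assert (W2 := cvel_fder _ _ _ _ _ Hv L2 V2).
  assert (W3 := cvel_fder _ _ _ _ _ Hv L3 V3).
  cbv beta in W1, W2, W3. rewrite E in W1, W2, W3. repeat split; first [apply W1|apply W2|apply W3].
Qed.

(** After [H], both solutions are explicit exponentials with the same value at [t0]; injectivity of
    [H] on the ball brings the equality back. *)
Lemma solutions_agree_near eta gam a b t0 :
  (forall t, a < t < b -> has_velocity eta t (X (eta t)) /\ C3norm (eta t) < 2 * rho) ->
  (forall t, a < t < b -> has_velocity gam t (X (gam t)) /\ C3norm (gam t) < 2 * rho) ->
  a < t0 < b -> eta t0 = gam t0 -> forall t, a < t < b -> eta t = gam t.
Proof.
  intros He Hg Ht0 E t Ht.
  assert (S : forall u,
    (forall t, a < t < b -> has_velocity u t (X (u t)) /\ C3norm (u t) < 2 * rho) ->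
    H (u t) = ((cexp (RtoC (t - t0) * Cimag omega) * c3x (H (u t0)))%C,
               (cexp (RtoC (t - t0) * Cimag omega) * c3y (H (u t0)))%C,
               (cexp (RtoC (t - t0) * lambda) * c3z (H (u t0)))%C)).
  { intros u Hu.
    assert (V := fun s (Hs : a < s < b) =>
      straightened_velocity u s (proj1 (Hu s Hs)) ltac:(destruct (Hu s Hs); lra)).
    rewrite <- (linear_curve (fun s => c3x (H (u s))) (Cimag omega) a b
       (fun s Hs => proj1 (V s Hs)) t0 t Ht0 Ht).
    rewrite <- (linear_curve (fun s => c3y (H (u s))) (Cimag omega) a b
       (fun s Hs => proj1 (proj2 (V s Hs))) t0 t Ht0 Ht).
    rewrite <- (linear_curve (fun s => c3z (H (u s))) lambda a b
       (fun s Hs => proj2 (proj2 (V s Hs))) t0 t Ht0 Ht).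
    now destruct (H (u t)) as [[? ?] ?]. }
  apply C3sub_eq. eapply Rle_trans; [apply Hinj; [apply He|apply Hg]; exact Ht|].
  rewrite (S eta He), (S gam Hg), E.
  rewrite C3norm_sub_diag. lra.
Qed.

(** If [D] is the derivative of [H] at [G q], then D X(G q) = A q, and [E] undoes [D]. *)
Lemma inverse_conjugates q : C3norm q < rho -> forall E, is_lin3 E -> vder G q E ->
  E (A q) = X (G q).
Proof.
  intros Hq E HE VE. destruct (HG q Hq) as [B [HGq _]].
  assert (Hp : C3norm (G q) < 2 * rho) by lra.
  destruct (Hder (G q) ltac:(lra)) as [D [HD VD]].
  assert (C := Hconj (G q) D ltac:(lra) HD VD). rewrite HGq in C. rewrite <- C.
  apply (local_inverse_derivative H G r rho Hr Hder Hinj HG (G q) D E); try assumption.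
  - now rewrite HGq.
  - now rewrite HGq.
Qed.

(** The linear flow on the plane z = 0, onto which [q] is projected. Its orbits do not increase the
    norm, so they never leave the domain of [G] and yield solutions for all times. *)
Definition rotation_orbit (q : C3) (t : R) : C3 :=
  ((cexp (RtoC t * Cimag omega) * c3x q)%C, (cexp (RtoC t * Cimag omega) * c3y q)%C, RtoC 0).

Lemma Cmod_rotation t : Cmod (cexp (RtoC t * Cimag omega)%C) = 1.
Proof.
  rewrite Cmod_cexp. unfold RtoC, Cimag, Cmult; simpl.
  replace (t * 0 - 0 * omega) with 0 by ring. apply exp_0.
Qed.

Lemma rotation_orbit_norm q t : C3norm (rotation_orbit q t) <= C3norm q.
Proof.
  apply C3norm_le; unfold rotation_orbit, c3x, c3y, c3z; simpl fst; simpl snd.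
  - rewrite Cmod_mult, Cmod_rotation, Rmult_1_l. apply (C3norm_x q).
  - rewrite Cmod_mult, Cmod_rotation, Rmult_1_l. apply (C3norm_y q).
  - rewrite Cmod_0. apply C3norm_pos.
Qed.

Lemma rotation_orbit_0 q : c3z q = RtoC 0 -> rotation_orbit q 0 = q.
Proof.
  intros Hz. unfold rotation_orbit. rewrite Cmult_0_l, cexp_0, !Cmult_1_l, <- Hz.
  now destruct q as [[? ?] ?].
Qed.

Lemma rotation_orbit_velocity q t :
  has_velocity (rotation_orbit q) t (A (rotation_orbit q t)).
Proof.
  apply has_velocity_cvel. split; [|split].
  - exact (cvel_cexp (Cimag omega) (c3x q) t).
  - exact (cvel_cexp (Cimag omega) (c3y q) t).
  - apply cvel_linear_error. intros eps Heps. exists 1; split; [lra|]. intros h _.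
    change (Cmod (0 - 0 - h * (lambda * 0))%C <= eps * Rabs h).
    replace (0 - 0 - h * (lambda * 0))%C with (RtoC 0) by ring. rewrite Cmod_0.
    apply Rmult_le_pos; [lra|apply Rabs_pos].
Qed.

Lemma rotation_orbit_solves q : C3norm q < rho ->
  solves_global X (fun t => G (rotation_orbit q t)).
Proof.
  intros Hq t.
  assert (Hn : C3norm (rotation_orbit q t) < rho)
    by (eapply Rle_lt_trans; [apply rotation_orbit_norm|exact Hq]).
  destruct (HG _ Hn) as [_ [_ [E [HE VE]]]].
  rewrite <- (inverse_conjugates _ Hn E HE VE).
  assert (Hv := rotation_orbit_velocity q t).
  destruct HE as [L1 [L2 L3]]. destruct VE as [V1 [V2 V3]].
  apply has_velocity_cvel. split; [|split].
  - exact (cvel_fder _ _ _ _ _ Hv L1 V1).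
  - exact (cvel_fder _ _ _ _ _ Hv L2 V2).
  - exact (cvel_fder _ _ _ _ _ Hv L3 V3).
Qed.

(** Minimality is tested at time 0: applying [H] to a coincidence gives c x = x and c y = y with c
    different from 1, forcing [q = 0]. *)
Lemma rotation_orbit_least_period q : C3norm q < rho -> c3z q = RtoC 0 -> q <> C3zero ->
  least_period (fun t => G (rotation_orbit q t)) (2 * PI / Rabs omega).
Proof.
  intros Hq Hz Hq0.
  assert (Hn : forall t, C3norm (rotation_orbit q t) < rho)
    by (intros t; eapply Rle_lt_trans; [apply rotation_orbit_norm|exact Hq]).
  assert (Add : forall t s, cexp (RtoC (t + s) * Cimag omega)%C
     = (cexp (RtoC t * Cimag omega) * cexp (RtoC s * Cimag omega))%C).
  { intros t s. rewrite <- cexp_plus, RtoC_plus. f_equal. ring. }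
  split; [|split].
  - apply Rdiv_lt_0_compat; [generalize PI_RGT_0; lra|now apply Rabs_pos_lt].
  - intros t. f_equal. unfold rotation_orbit.
    rewrite Add, rotation_period by exact Homega. now rewrite Cmult_1_r.
  - intros s Hs. exists 0. rewrite Rplus_0_l. intros E.
    apply (f_equal H) in E.
    rewrite (proj1 (proj2 (HG _ (Hn s)))), (proj1 (proj2 (HG _ (Hn 0)))) in E.
    rewrite rotation_orbit_0 in E by exact Hz.
    assert (N := rotation_nontrivial omega s Homega Hs).
    set (c := cexp (s * Cimag omega)%C) in *.
    assert (Z : forall w : C, (c * w)%C = w -> w = RtoC 0).
    { intros w Hw. destruct (Ceq_dec w 0) as [E0|E0]; [exact E0|exfalso].
      apply N. replace c with (c * w / w)%C by (field; exact E0). rewrite Hw. field. exact E0. }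
    apply Hq0. destruct q as [[x y] z]. unfold c3z in Hz; simpl in Hz.
    unfold rotation_orbit, c3x, c3y in E; simpl in E. fold c in E.
    injection E as Ex Ey _.
    assert (E1 : (c * x)%C = x)
      by (apply injective_projections; [exact (f_equal fst Ex)|exact (f_equal snd Ex)]).
    assert (E2 : (c * y)%C = y)
      by (apply injective_projections; [exact (f_equal fst Ey)|exact (f_equal snd Ey)]).
    rewrite Hz, (Z x E1), (Z y E2). reflexivity.
Qed.

Lemma straightening_zero : H C3zero = C3zero.
Proof.
  assert (T := Htan C3zero ltac:(rewrite C3norm_zero; lra)).
  rewrite C3norm_zero in T. apply C3sub_eq. eapply Rle_trans; [exact T|right; ring].
Qed.

Theorem straightened_isochronous :
  isochronous_center X (fun p => c3z (H p) = C0) (2 * PI / Rabs omega).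
Proof.
  (* |H p| <= N |p| on the ball of radius 2 rho, so starting points below rho / N are sent into the
     domain of [G]. *)
  set (N := 1 + K * (2 * rho)).
  assert (HN : 1 <= N) by (unfold N; assert (0 <= K * (2 * rho)) by (apply Rmult_le_pos; lra); lra).
  assert (Hd : 0 < rho / N) by (apply Rdiv_lt_0_compat; lra).
  assert (Hd1 : rho / N <= rho).
  { apply (Rmult_le_reg_r N); [lra|]. replace (rho / N * N) with rho by (field; lra). nra. }
  exists (rho / N). split; [exact Hd|]. intros p HS Hp0 Hp.
  set (q := H p).
  assert (Hp1 : C3norm p < 2 * rho) by lra.
  assert (Hq : C3norm q < rho).
  { assert (T := Htan p ltac:(lra)).
    apply Rle_lt_trans with (N * C3norm p).
    - replace q with (C3add (C3sub q p) p) by (generalize q; clear; intros; C3ring).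
      eapply Rle_trans; [apply C3norm_triangle|]. fold q in T.
      assert (K * C3norm p <= K * (2 * rho)) by (apply Rmult_le_compat_l; lra).
      generalize (C3norm_pos p). intros. unfold N. nra.
    - apply (Rmult_lt_compat_l N) in Hp; [|lra].
      replace (N * (rho / N)) with rho in Hp by (field; lra). exact Hp. }
  assert (HGq : G q = p) by (apply (local_inverse_left H G rho Hinj HG); assumption).
  assert (Hq0 : q <> C3zero).
  { intros E. apply Hp0. apply C3sub_eq.
    eapply Rle_trans; [apply Hinj; [exact Hp1|rewrite C3norm_zero; lra]|].
    fold q. rewrite E, straightening_zero.
    rewrite C3norm_sub_diag. lra. }
  set (gam := fun t => G (rotation_orbit q t)).
  assert (Sg : solves_global X gam) by (now apply rotation_orbit_solves).
  assert (Pg : least_period gam (2 * PI / Rabs omega)) by (now apply rotation_orbit_least_period).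
  assert (G0 : gam 0 = p) by (unfold gam; rewrite rotation_orbit_0; [exact HGq|exact HS]).
  assert (Bg : forall t, C3norm (gam t) < 2 * rho).
  { intros t. assert (B := rotation_orbit_norm q t).
    destruct (HG (rotation_orbit q t) ltac:(lra)) as [B' _]. unfold gam. lra. }
  split; [now exists gam|].
  intros eta a b Hab E0 Se. exists gam. split; [exact Sg|]. split; [exact Pg|].
  (* An arbitrary local solution [eta] might leave the ball where [H] is controlled, but [gam] does
     not. Near a time of agreement continuity keeps [eta] in the ball, so local uniqueness applies;
     near a time of disagreement continuity keeps the curves apart. *)
  apply (clopen_on_interval (fun t => eta t = gam t) a b 0 Hab); [congruence|].
  intros t Ht.
  destruct (excluded_middle_informative (eta t = gam t)) as [E|NE].
  - destruct (has_velocity_near eta t _ (Se t Ht) (2 * rho - C3norm (eta t))) as [d [Hd0 Hb]].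
    { rewrite E. generalize (Bg t). lra. }
    set (d' := Rmin d (Rmin (t - a) (b - t))).
    assert (D0 : 0 < d') by (repeat apply Rmin_case; lra).
    assert (D1 : d' <= d) by apply Rmin_l.
    assert (D2 : d' <= t - a) by (eapply Rle_trans; [apply Rmin_r|apply Rmin_l]).
    assert (D3 : d' <= b - t) by (eapply Rle_trans; [apply Rmin_r|apply Rmin_r]).
    clearbody d'.
    exists d'. split; [exact D0|]. intros s Hs. split; [intros _; exact E|intros _].
    apply Rabs_def2 in Hs.
    apply (solutions_agree_near eta gam (t - d') (t + d') t); [| |lra|exact E|lra].
    + intros u Hu. split; [apply Se; lra|].
      specialize (Hb u ltac:(apply Rabs_def1; lra)).
      replace (eta u) with (C3add (C3sub (eta u) (eta t)) (eta t))
        by (generalize (eta u), (eta t); clear; intros; C3ring).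
      eapply Rle_lt_trans; [apply C3norm_triangle|lra].
    + intros u _. split; [apply Sg|apply Bg].
  - set (e := C3norm (C3sub (eta t) (gam t))).
    assert (He : 0 < e).
    { apply Rnot_le_lt. intros Hle. apply NE. now apply C3sub_eq. }
    destruct (has_velocity_near eta t _ (Se t Ht) (e / 2) ltac:(lra)) as [d1 [Hd1' B1]].
    destruct (has_velocity_near gam t _ (Sg t) (e / 2) ltac:(lra)) as [d2 [Hd2' B2]].
    exists (Rmin d1 d2). split; [apply Rmin_case; lra|]. intros s Hs.
    specialize (B1 s (Rlt_le_trans _ _ _ Hs (Rmin_l _ _))).
    specialize (B2 s (Rlt_le_trans _ _ _ Hs (Rmin_r _ _))).
    split; [|contradiction]. intros E. exfalso. rewrite E in B1.
    assert (e < e); [|lra]. unfold e at 1.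
    replace (C3sub (eta t) (gam t)) with
      (C3sub (C3sub (gam s) (gam t)) (C3sub (gam s) (eta t)))
      by (generalize (eta t), (gam t), (gam s); clear; intros; C3ring).
    eapply Rle_lt_trans; [apply C3norm_sub|lra].
Qed.

End Isochronous.

(** * Uniqueness of the center manifold *)

(** A change of coordinates that straightens the zero set of [F] to the plane z = 0; inverting it
    plays the part of the implicit function theorem. *)
Definition replace_z (F : C3 -> C) (p : C3) : C3 := (c3x p, c3y p, F p).

Lemma replace_z_vder F p : has_fder F p -> has_vder (replace_z F) p.
Proof.
  intros HF. apply has_vder_components. destruct is_lin_coord as [Cx [Cy _]].
  split; [|split]; [now apply has_fder_lin|now apply has_fder_lin|exact HF].
Qed.

Lemma replace_z_tangent F p B : Cmod (F p - c3z p)%C <= B -> C3norm (C3sub (replace_z F p) p) <= B.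
Proof.
  intros HB. assert (HB0 : 0 <= B) by (eapply Rle_trans; [apply Cmod_ge_0|exact HB]).
  apply C3norm_le; unfold C3sub, replace_z, c3x, c3y; simpl fst; simpl snd.
  - match goal with |- Cmod (?x - ?x)%C <= _ => replace (x - x)%C with (RtoC 0) by ring end.
    rewrite Cmod_0. exact HB0.
  - match goal with |- Cmod (?x - ?x)%C <= _ => replace (x - x)%C with (RtoC 0) by ring end.
    rewrite Cmod_0. exact HB0.
  - exact HB.
Qed.

Section Uniqueness.
Variables (X : C3 -> C3) (tau b1 b2 b3 : C) (H3 F : C3 -> C) (c : C) (r K M : R).
Hypotheses (T1 : fst (tau * b1)%C = -1) (T2 : fst (tau * b2)%C = -1)
  (T3 : fst (tau * b3)%C = -1).
Hypotheses (Hr : 0 < r) (HK : 0 <= K) (Hc : c <> RtoC 0).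
Hypothesis HX : forall p, C3norm p < r ->
  C3norm (C3sub (C3scal tau (X p)) (diag3 (tau * b1) (tau * b2) (tau * b3) p))
    <= K * C3norm p ^ 2.
Hypothesis HH : forall p, C3norm p < r -> has_fder H3 p.
Hypothesis HHt : forall p, C3norm p < r -> Cmod (H3 p - c3z p)%C <= K * C3norm p ^ 2.
Hypothesis HHe : forall p L, C3norm p < r -> is_lin L -> fder H3 p L ->
  L (X p) = (b3 * H3 p)%C.
Hypothesis HF : forall p, C3norm p < r -> has_fder F p.
Hypothesis HFt : forall p, C3norm p < r -> Cmod (F p - c * c3z p)%C <= K * C3norm p ^ 2.
Hypothesis HFi : forall p L, C3norm p < r -> F p = RtoC 0 -> is_lin L -> fder F p L ->
  L (X p) = RtoC 0.

Lemma center_manifold_unique : exists rho, 0 < rho /\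
  forall p, C3norm p < rho -> (H3 p = RtoC 0 <-> F p = RtoC 0).
Proof.
  assert (Hc0 : 0 < Cmod c) by now apply Cmod_gt_0.
  set (F1 := fun p => (/ c * F p)%C).
  set (Kc := / Cmod c * K).
  assert (HKc : 0 <= Kc).
  { apply Rmult_le_pos; [apply Rlt_le, Rinv_0_lt_compat; lra|exact HK]. }
  assert (HF1 : forall p, C3norm p < r -> has_fder F1 p).
  { intros p Hp. apply has_fder_scal. now apply HF. }
  assert (HF1t : forall p, C3norm p < r -> Cmod (F1 p - c3z p)%C <= Kc * C3norm p ^ 2).
  { intros p Hp. unfold F1, Kc.
    replace (/ c * F p - c3z p)%C with (/ c * (F p - c * c3z p))%C by (field; exact Hc).
    rewrite Cmod_mult, Cmod_inv by exact Hc. rewrite Rmult_assoc.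
    apply Rmult_le_compat_l; [apply Rlt_le, Rinv_0_lt_compat; lra|now apply HFt]. }
  set (Psi := replace_z F1).
  assert (HPsi : forall p, C3norm p < r -> has_vder Psi p).
  { intros p Hp. apply replace_z_vder. now apply HF1. }
  (* Only the injectivity is kept: on this ball a zero of [H3] is determined by its x and y. The
     next inverse is capped by [2 * rho2] to stay inside it. *)
  destruct (local_inverse (replace_z H3) r K r Hr HK Hr) as
    [rho2 [_ [Hrho2 [Hr2 [_ [Inj2 _]]]]]].
  { intros p Hp. apply replace_z_vder. now apply HH. }
  { intros p Hp. apply replace_z_tangent. now apply HHt. }
  destruct (local_inverse Psi r Kc (2 * rho2) Hr HKc ltac:(lra) HPsi) as
    [rho [G [Hrho [Hr1 [Hr12 [Inj HG]]]]]].
  { intros p Hp. apply replace_z_tangent. now apply HF1t. }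
  set (pr := fun q : C3 => (c3x q, c3y q, RtoC 0) : C3).
  assert (Npr : forall q, C3norm (pr q) <= C3norm q).
  { intros q. apply C3norm_le; [apply (C3norm_x q)|apply (C3norm_y q)|].
    unfold pr, c3z; simpl. rewrite Cmod_0. apply C3norm_pos. }
  (* [P q] is the point of the manifold F = 0 above the x and y of [q], and [k] is [H3] read on this
     graph. *)
  set (P := fun q => G (pr q)).
  set (k := fun q => H3 (P q)).
  assert (HP : forall q, C3norm q < rho -> C3norm (P q) <= 2 * C3norm q /\
     Psi (P q) = pr q /\ F (P q) = RtoC 0).
  { intros q Hq. assert (N := Npr q). destruct (HG (pr q) ltac:(lra)) as [B [E _]].
    split; [unfold P; lra|]. split; [exact E|].
    apply (f_equal c3z) in E. unfold Psi, replace_z, pr, c3z, F1 in E; simpl in E.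
    replace (F (P q)) with (c * (/ c * F (P q)))%C by (field; exact Hc).
    unfold P, pr. rewrite E. ring. }
  assert (HPxy : forall q, C3norm q < rho -> c3x (P q) = c3x q /\ c3y (P q) = c3y q).
  { intros q Hq. destruct (HP q Hq) as [_ [E _]]. split.
    - exact (f_equal c3x E).
    - exact (f_equal c3y E). }
  assert (SqP : forall q, C3norm q < rho -> C3norm (P q) ^ 2 <= 4 * C3norm q ^ 2).
  { intros q Hq. destruct (HP q Hq) as [B _].
    replace (4 * C3norm q ^ 2) with ((2 * C3norm q) ^ 2) by ring.
    apply pow_incr. split; [apply C3norm_pos|exact B]. }
  assert (Hk : forall q, C3norm q < rho -> Cmod (k q) <= 4 * (K + Kc) * C3norm q ^ 2).
  { intros q Hq. destruct (HP q Hq) as [B [_ F0]]. assert (S := SqP q Hq).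
    assert (A1 := HHt (P q) ltac:(lra)). assert (A2 := HF1t (P q) ltac:(lra)).
    unfold F1 in A2. rewrite F0 in A2. unfold k.
    replace (H3 (P q)) with ((H3 (P q) - c3z (P q)) - (/ c * 0 - c3z (P q)))%C by ring.
    eapply Rle_trans; [apply Cmod_sub_le|].
    assert (K * C3norm (P q) ^ 2 <= K * (4 * C3norm q ^ 2)) by (apply Rmult_le_compat_l; lra).
    assert (Kc * C3norm (P q) ^ 2 <= Kc * (4 * C3norm q ^ 2)) by (apply Rmult_le_compat_l; lra).
    lra. }
  assert (Lpr : is_lin3 pr).
  { destruct is_lin_coord as [Cx [Cy _]]. split; [|split]; [exact Cx|exact Cy|].
    exists (RtoC 0), (RtoC 0), (RtoC 0). intros v. unfold pr. clear; C3ring. }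
  assert (Vpr : forall q, vder pr q pr).
  { intros q. destruct Lpr as [L1 [L2 L3]].
    split; [|split]; now apply fder_lin. }
  assert (Hkd : forall q, C3norm q < rho -> exists LH E, is_lin LH /\ is_lin3 E /\
     fder H3 (P q) LH /\ vder G (pr q) E /\ fder k q (fun v => LH (E (pr v)))).
  { intros q Hq. destruct (HP q Hq) as [B _].
    destruct (HH (P q) ltac:(lra)) as [LH [HLH VLH]].
    assert (N := Npr q).
    destruct (HG (pr q) ltac:(lra)) as [_ [_ [E [HE VE]]]].
    exists LH, E. split; [exact HLH|]. split; [exact HE|]. split; [exact VLH|].
    split; [exact VE|].
    assert (LE : is_lin (fun v => LH (E v))) by now apply is_lin_comp.
    assert (VE' : fder (fun q => H3 (G q)) (pr q) (fun v => LH (E v))) by now apply fder_comp.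
    exact (fder_comp (fun q => H3 (G q)) pr q (fun v => LH (E v)) pr LE Lpr (Vpr q) VE'). }
  set (Y := fun q => C3scal tau (X q)).
  (* The rotated field restricted to the manifold lives in two dimensions. The linear third
     component [tau * b3 * z] completes it to a field on three-space, so that
     [eigenfunction_vanishes] applies; [k] does not depend on z. *)
  set (Yr := fun q => (c3x (Y (P q)), c3y (Y (P q)), (tau * b3 * c3z q)%C) : C3).
  assert (HY : forall q, C3norm q < rho ->
    C3norm (C3sub (Yr q) (diag3 (tau * b1) (tau * b2) (tau * b3) q)) <= 4 * K * C3norm q ^ 2).
  { intros q Hq. destruct (HP q Hq) as [B _]. destruct (HPxy q Hq) as [Ex Ey].
    assert (S := SqP q Hq). assert (A1 := HX (P q) ltac:(lra)). fold (Y (P q)) in A1.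
    assert (A2 : K * C3norm (P q) ^ 2 <= 4 * K * C3norm q ^ 2).
    { replace (4 * K * C3norm q ^ 2) with (K * (4 * C3norm q ^ 2)) by ring.
      apply Rmult_le_compat_l; lra. }
    assert (A3 := Rle_trans _ _ _ A1 A2).
    apply C3norm_le.
    - eapply Rle_trans; [|exact A3]. eapply Rle_trans; [|apply C3norm_x].
      right. apply f_equal.
      change ((c3x (Y (P q)) - tau * b1 * c3x q)%C
        = (c3x (Y (P q)) - tau * b1 * c3x (P q))%C).
      now rewrite Ex.
    - eapply Rle_trans; [|exact A3]. eapply Rle_trans; [|apply C3norm_y].
      right. apply f_equal.
      change ((c3y (Y (P q)) - tau * b2 * c3y q)%C
        = (c3y (Y (P q)) - tau * b2 * c3y (P q))%C).
      now rewrite Ey.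
    - unfold C3sub, Yr, diag3, c3z; simpl.
      match goal with |- Cmod (?x - ?x)%C <= _ => replace (x - x)%C with (RtoC 0) by ring end.
      rewrite Cmod_0. eapply Rle_trans; [apply C3norm_pos|exact A3]. }
  assert (Heig : forall q L, C3norm q < rho -> is_lin L -> fder k q L ->
    L (Yr q) = (tau * b3 * k q)%C).
  { intros q L Hq HL VL. destruct (Hkd q Hq) as [LH [E [HLH [HE [VLH [VE Vk]]]]]].
    destruct (HP q Hq) as [B [EP F0]]. assert (N := Npr q).
    assert (Lk : is_lin (fun v => LH (E (pr v)))).
    { apply (is_lin_comp (fun v => LH (E v)) pr); [now apply is_lin_comp|exact Lpr]. }
    rewrite (fder_unique k q _ _ HL Lk VL Vk (Yr q)).
    destruct (HF (P q) ltac:(lra)) as [LF [HLF VLF]].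
    set (D := fun v : C3 => (c3x v, c3y v, (/ c * LF v)%C) : C3).
    assert (HD : is_lin3 D).
    { destruct is_lin_coord as [Cx [Cy _]]. split; [exact Cx|split; [exact Cy|]].
      destruct HLF as [a1 [a2 [a3 Ea]]].
      exists (/ c * a1)%C, (/ c * a2)%C, (/ c * a3)%C. intros v. unfold D, c3z at 1. simpl.
      rewrite Ea. clear. C3ring. }
    assert (VD : vder Psi (P q) D).
    { destruct is_lin_coord as [Cx [Cy _]]. split; [|split].
      - exact (fder_lin c3x (P q) Cx).
      - exact (fder_lin c3y (P q) Cy).
      - assert (Z : is_lin (fun _ => RtoC 0)).
        { exists (RtoC 0), (RtoC 0), (RtoC 0). intros v. clear; C3ring. }
        assert (Q := fder_plus_scal _ _ (P q) _ _ (/ c)%C (fder_lin _ (P q) Z) VLF).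
        apply (fder_ext_fun (fun p => 0 + / c * F p)%C).
        + exists 1; split; [lra|]. intros h _.
          unfold Psi, replace_z, c3z, F1; simpl. ring.
        + apply fder_ext with (2 := Q). intros v. unfold D, c3z; simpl. ring. }
    assert (ED : E (D (Y (P q))) = Y (P q)).
    { rewrite <- EP in VE.
      apply (local_inverse_derivative Psi G r rho Hr1 HPsi Inj HG (P q) D E);
        try assumption; try lra. rewrite EP. lra. }
    assert (DY : D (Y (P q)) = pr (Yr q)).
    { unfold D, pr, Yr. unfold c3x, c3y; simpl. f_equal.
      unfold Y. rewrite (lin_scal LF _ _ HLF), (HFi (P q) LF ltac:(lra) F0 HLF VLF). ring. }
    rewrite <- DY, ED. unfold Y at 1. rewrite (lin_scal LH _ _ HLH).
    rewrite (HHe (P q) LH ltac:(lra) HLH VLH). unfold k. ring. }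
  set (B := 1 + Cmod (tau * b1)%C + Cmod (tau * b2)%C + Cmod (tau * b3)%C).
  generalize (Cmod_ge_0 (tau * b1)%C) (Cmod_ge_0 (tau * b2)%C) (Cmod_ge_0 (tau * b3)%C).
  intros P1 P2 P3.
  (* The quadratic constant of [Yr] is 4K, since |P q| <= 2|q|; hence 64 instead of 16. *)
  assert (Q : 0 < 1 / (64 * (K + 1))) by (apply Rdiv_lt_0_compat; lra).
  set (R := Rmin rho (1 / (64 * (K + 1)))).
  assert (HR : 0 < R) by (apply Rmin_case; lra).
  assert (HRr : R <= rho) by apply Rmin_l.
  assert (HRK : R <= 1 / (64 * (K + 1))) by apply Rmin_r.
  clearbody R.
  assert (HKR : 4 * K * R <= 1 / 16).
  { apply (Rmult_le_compat_l (4 * (K + 1))) in HRK; [|lra].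
    replace (4 * (K + 1) * (1 / (64 * (K + 1)))) with (1 / 16) in HRK by (field; lra). lra. }
  assert (KK : 0 <= 4 * (K + Kc)) by lra.
  assert (Hol : ball_hol k C3zero R (4 * (K + Kc) * R ^ 2)).
  { intros q Hq. replace (C3add C3zero q) with q by C3ring. split.
    - eapply Rle_trans; [apply Hk; lra|]. apply Rmult_le_compat_l; [exact KK|].
      apply pow_incr. split; [apply C3norm_pos|lra].
    - destruct (Hkd q ltac:(lra)) as [LH [E [HLH [HE [_ [_ Vk]]]]]].
      eexists. split; [|exact Vk].
      apply (is_lin_comp (fun v => LH (E v)) pr); [now apply is_lin_comp|exact Lpr]. }
  assert (K0 : forall q, C3norm q < R / 2 -> k q = RtoC 0).
  { apply (eigenfunction_vanishes Yr (tau * b1) (tau * b2) (tau * b3) (4 * K) B R T1 T2 T3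
      ltac:(unfold B; lra) ltac:(unfold B; lra) ltac:(unfold B; lra) ltac:(unfold B; lra)
      ltac:(lra) HR HKR (fun q Hq => HY q (Rlt_le_trans _ _ _ Hq HRr)) (tau * b3) T3 k
      (4 * (K + Kc)) _ Hol KK).
    - intros q Hq. apply Hk. lra.
    - intros q L Hq. apply Heig. lra. }
  exists (R / 2). split; [lra|]. intros p Hp.
  assert (kp := K0 p Hp). destruct (HP p ltac:(lra)) as [B' [EP F0]].
  destruct (HPxy p ltac:(lra)) as [Ex Ey].
  (* If H3(p) = 0, then [p] and [P p] share x, y and the value of [H3], so they coincide and F(p) =
     0. If F(p) = 0, then [p] lies on the graph, p = P p, and H3(p) = k(p) = 0. *)
  split; intros E.
  - assert (Epp : P p = p).
    { apply C3sub_eq. eapply Rle_trans; [apply Inj2; lra|].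
      replace (replace_z H3 (P p)) with (replace_z H3 p).
      - rewrite C3norm_sub_diag. lra.
      - unfold replace_z. rewrite Ex, Ey, E. unfold k in kp. now rewrite kp. }
    now rewrite Epp in F0.
  - assert (Epr : Psi p = pr p).
    { unfold Psi, replace_z, pr, F1. rewrite E. f_equal. ring. }
    assert (Epp : P p = p).
    { unfold P. rewrite <- Epr.
      apply (local_inverse_left Psi G rho Inj HG); [lra|].
      rewrite Epr. generalize (Npr p). lra. }
    unfold k in kp. now rewrite Epp in kp.
Qed.

End Uniqueness.

(** * Existence, uniqueness and isochrony combined *)

Theorem theorem3p3 (omega : R) (lambda : Cpx) (f g h : C3 -> Cpx) :
  omega <> 0 -> fst lambda <> 0 ->
  holomorphic_near0 f -> holomorphic_near0 g -> holomorphic_near0 h ->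
  vanishes_order2 f -> vanishes_order2 g -> vanishes_order2 h ->
  exists S : C3 -> Prop,
    xy_center_manifold (system omega lambda f g h) S /\
    (forall S', xy_center_manifold (system omega lambda f g h) S' ->
                germ_eq S S') /\
    isochronous_center (system omega lambda f g h) S (2 * PI / Rabs omega).
Proof.
  intros Ho Hl Hf Hg Hh Vf Vg Vh.
  destruct (system_rotated omega lambda f g h Ho Hl Hf Hg Hh Vf Vg Vh)
    as [tau [r0 [K0 [T0 [T1 [T3 [Hr0 [HK0 HX]]]]]]]].
  set (X := system omega lambda f g h) in *.
  destruct (straightening X tau (Cimag omega) (Cimag omega) lambda r0 K0 T0 T1 T1 T3 Hr0 HK0 HX)
    as [H [r [K [Hr [HK [Hder [Htan Hconj]]]]]]].
  assert (Hz : forall p, C3norm p < r -> has_fder (fun q => c3z (H q)) p).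
  { intros p Hp. apply (has_vder_components H p). now apply Hder. }
  assert (Hzt : forall p, C3norm p < r -> Cmod (c3z (H p) - c3z p)%C <= K * C3norm p ^ 2).
  { intros p Hp. eapply Rle_trans; [apply (C3norm_z (C3sub (H p) p))|now apply Htan]. }
  assert (Hze : forall p L, C3norm p < r -> is_lin L -> fder (fun q => c3z (H q)) p L ->
    L (X p) = (lambda * c3z (H p))%C).
  { intros p L Hp HL VL. destruct (Hder p Hp) as [D [HD VD]].
    assert (E := Hconj p D Hp HD VD).
    rewrite (fder_unique _ p L (fun v => c3z (D v)) HL (proj2 (proj2 HD)) VL (proj2 (proj2 VD))).
    exact (f_equal c3z E). }
  exists (fun p => c3z (H p) = C0). split; [|split].
  - exists r, (fun p => c3z (H p)).
    assert (H0 : H C3zero = C3zero)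
      (* Any [rho] with [2 * rho <= r] would serve here. *)
      by (apply (straightening_zero H r K (r / 2)); try assumption; lra).
    split; [exact Hr|]. split; [|split; [|split; [|split]]].
    + intros p Hp. apply has_fder_cderiv3. now apply Hz.
    + now rewrite H0.
    + exists (RtoC 1). split.
      { intros E. apply (f_equal fst) in E. simpl in E. lra. }
      apply has_cderiv3_fder. intros eps Heps.
      exists (Rmin r (eps / (K + 1))). split.
      { apply Rmin_case; [lra|apply Rdiv_lt_0_compat; lra]. }
      intros v Hv.
      assert (T := Hzt v (Rlt_le_trans _ _ _ Hv (Rmin_l _ _))).
      assert (h2 := Rlt_le_trans _ _ _ Hv (Rmin_r _ _)).
      apply (Rmult_lt_compat_r (K + 1)) in h2; [|lra].
      replace (eps / (K + 1) * (K + 1)) with eps in h2 by (field; lra).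
      replace (C3add C3zero v) with v by (clear; C3ring). rewrite H0.
      replace (c3z (H v) - c3z C3zero - Clin3 C0 C0 (RtoC 1) v)%C with (c3z (H v) - c3z v)%C.
      * eapply Rle_trans; [exact T|]. generalize (C3norm_pos v). intros. nra.
      * generalize (H v). clear. intros. C3ring.
    + intros p _. tauto.
    + intros p a b c Hp E Hd. apply has_cderiv3_fder in Hd.
      rewrite (Hze p _ Hp (is_lin_Clin3 a b c) Hd), E.
      exact (Cmult_0_r lambda).
  - intros S' [r1 [F [Hr1 [HFh [F0 [[c [Hc Hd]] [HS' Hinv]]]]]]].
    apply has_cderiv3_fder in Hd.
    destruct (taylor_origin F (Clin3 C0 C0 c) r1 Hr1) as [r2 [K2 [Hr2 [HK2 HT]]]];
      [|exact F0|apply is_lin_Clin3|exact Hd|].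
    { intros p Hp. apply has_fder_cderiv3. now apply HFh. }
    (* The uniqueness argument uses one radius and one quadratic constant for the field, for [H] and
       for [F]; the minimum and the sum of the constants provide them. *)
    set (R := Rmin (Rmin r0 r) r2).
    assert (HR : 0 < R) by (repeat apply Rmin_case; lra).
    assert (R0 : R <= r0) by (eapply Rle_trans; [apply Rmin_l|apply Rmin_l]).
    assert (R1 : R <= r) by (eapply Rle_trans; [apply Rmin_l|apply Rmin_r]).
    assert (R2 : R <= r2) by apply Rmin_r.
    clearbody R.
    assert (Up : forall k p, 0 <= k <= K0 + K + K2 ->
       k * C3norm p ^ 2 <= (K0 + K + K2) * C3norm p ^ 2).
    { intros k p Hk. apply Rmult_le_compat_r; [apply pow2_ge_0|lra]. }
    destruct (center_manifold_unique X tau (Cimag omega) (Cimag omega) lambda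
      (fun q => c3z (H q)) F c R (K0 + K + K2) T1 T1 T3 HR ltac:(lra) Hc) as [rho [Hrho HU]].
    + intros p Hp. eapply Rle_trans; [apply HX; lra|]. apply Up. lra.
    + intros p Hp. apply Hz. lra.
    + intros p Hp. eapply Rle_trans; [apply Hzt; lra|]. apply Up. lra.
    + intros p L Hp. apply Hze. lra.
    + intros p Hp. apply has_fder_cderiv3. apply HFh. lra.
    + intros p Hp.
      replace (F p - c * c3z p)%C with (F p - Clin3 C0 C0 c p)%C
        by (generalize (F p); clear; intros; C3ring).
      eapply Rle_trans; [apply HT; lra|]. apply Up. lra.
    + intros p L Hp E HL VL. destruct HL as [a [b [d EL]]].
      rewrite EL. apply (Hinv p a b d); [lra|exact E|].
      apply has_cderiv3_fder. now apply fder_ext with L.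
    + exists (Rmin rho r1). split; [apply Rmin_case; lra|]. intros p Hp.
      rewrite (HS' p (Rlt_le_trans _ _ _ Hp (Rmin_r _ _))).
      apply HU. exact (Rlt_le_trans _ _ _ Hp (Rmin_l _ _)).
  - destruct (local_inverse H r K r Hr HK Hr Hder Htan)
      as [rho [G [Hrho [Hr1 [_ [Inj HG]]]]]].
    exact (straightened_isochronous omega lambda X H G r K rho Ho HK Hrho Hr1 Hder Htan
      Hconj Inj HG).
Qed.
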